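(* Fix an odd prime $p$. Let $\mathcal{G}_{2,p}$ be the class of all closed subgroups $G$ of $S_\infty$ that are procountable, nilpotent of class at most $2$, and of exponent $p$ (a Borel subset of the standard Borel space of closed subgroups of $S_\infty$). Then the equivalence relation $\ell_\infty$ is Borel reducible to the relation of topological isomorphism on $\mathcal{G}_{2,p}$. Consequently, topological isomorphism on $\mathcal{G}_{2,p}$ is not Borel reducible to any orbit equivalence relation induced by a Borel action of a Polish group; in particular, it is not Borel reducible to $\mathrm{GI}$.
   Context: $S_\infty$ is the group of all permutations of $\mathbb{N}$ with the topology of pointwise convergence; its closed subgroups form a standard Borel space (with the Effros Borel structure). A topological group $G$ is procountable if it is topologically isomorphic to the inverse limit of an inverse system $(G_n,p_n)_{n\in\mathbb{N}}$ of countable groups and surjective homomorphisms $p_n\colon G_{n+1}\to G_n$, where the inverse limit carries the subspace topology from $\prod_n G_n$ with each $G_n$ discrete. $\ell_\infty$ is the equivalence relation on $\mathbb{R}^{\mathbb{N}}$ given by $(x_n)\,\ell_\infty\,(y_n)$ iff there is $M\in\mathbb{R}$ with $|x_n-y_n|<M$ for all $n$. $\mathrm{GI}$ is the isomorphism relation on countable graphs (symmetric irreflexive relations on $\mathbb{N}$). An equivalence relation $E$ on a standard Borel space $X$ is Borel reducible to $F$ on $Y$ if there is a Borel map $f\colon X\to Y$ with $xEx'\iff f(x)Ff(x')$. *)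

(* Defs.v *)
From HB Require Import structures.
From mathcomp Require Import all_boot all_order all_algebra.
From mathcomp Require Import all_classical all_reals all_analysis.
Set Implicit Arguments.
Unset Strict Implicit.
Unset Printing Implicit Defensive.
Import Order.TTheory GRing.Theory Num.Theory.
Import numFieldNormedType.Exports.
Local Open Scope classical_set_scope.
Local Open Scope group_scope.

HB.structure Definition PreTopologicalGroup := {G of Topological G & Group G}.

HB.mixin Record PreTopologicalGroup_isTopologicalGroup G
    & PreTopologicalGroup G := {
  mulg_continuous : continuous (fun x : G * G => x.1 * x.2) ;
  invg_continuous : continuous (fun x : G => x^-1)
}.

#[short(type="topologicalGroupType")]
HB.structure Definition TopologicalGroup :=
  {G of PreTopologicalGroup G & PreTopologicalGroup_isTopologicalGroup G}.

Definition is_subgroup (G : groupType) (H : set G) : Prop :=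
  [/\ H 1, forall x y, H x -> H y -> H (x * y) & forall x, H x -> H x^-1].

(* Isomorphism of the topological groups A and B, where A and B are subgroups
   of topological groups and carry the subspace topologies.  The maps f and g
   matter only on A and on B. *)
Definition top_isomorphic (G K : topologicalGroupType) (A : set G) (B : set K)
    : Prop :=
  exists (f : G -> K) (g : K -> G),
    [/\ (forall x, A x -> B (f x)) /\ (forall y, B y -> A (g y)),
        (forall x, A x -> g (f x) = x) /\ (forall y, B y -> f (g y) = y),
        forall x y, A x -> A y -> f (x * y) = f x * f y,
        {within A, continuous f} & {within B, continuous g}].

Definition Sinf : Type := set_type [set f : {ptws nat -> nat} | bijective f].

HB.instance Definition _ :=
  Topological.copy Sinf (set_type [set f : {ptws nat -> nat} | bijective f]).

Section Sinf_group.

Definition Sinf_fun (s : Sinf) : nat -> nat := set_val s.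

Lemma Sinf_funP (s : Sinf) : bijective (Sinf_fun s).
Proof. by case: s => f fP; exact: (set_mem fP). Qed.

Definition Sinf_mk (f : nat -> nat) (fP : bijective f) : Sinf :=
  exist _ (f : {ptws nat -> nat}) (mem_set fP).

Lemma Sinf_eq (s t : Sinf) : Sinf_fun s =1 Sinf_fun t -> s = t.
Proof. by move=> st; apply: val_inj; apply/funext. Qed.

Definition Sinf_one : Sinf := @Sinf_mk id (Bijective (frefl id) (frefl id)).

Definition Sinf_mul (s t : Sinf) : Sinf :=
  Sinf_mk (bij_comp (Sinf_funP s) (Sinf_funP t)).

Lemma Sinf_inv_subproof (s : Sinf) :
  exists g, cancel (Sinf_fun s) g /\ cancel g (Sinf_fun s).
Proof. by have [g sg gs] := Sinf_funP s; exists g. Qed.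

Definition Sinf_invfun (s : Sinf) : nat -> nat :=
  projT1 (cid (Sinf_inv_subproof s)).

Lemma Sinf_invfunK (s : Sinf) : cancel (Sinf_fun s) (Sinf_invfun s).
Proof. by rewrite /Sinf_invfun; case: cid => g []. Qed.

Lemma Sinf_funK (s : Sinf) : cancel (Sinf_invfun s) (Sinf_fun s).
Proof. by rewrite /Sinf_invfun; case: cid => g []. Qed.

Definition Sinf_inv (s : Sinf) : Sinf :=
  Sinf_mk (Bijective (Sinf_funK s) (Sinf_invfunK s)).

Lemma Sinf_mulA : associative Sinf_mul.
Proof. by move=> s t u; exact: Sinf_eq. Qed.

Lemma Sinf_mul1g : left_id Sinf_one Sinf_mul.
Proof. by move=> s; exact: Sinf_eq. Qed.

Lemma Sinf_mulg1 : right_id Sinf_one Sinf_mul.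
Proof. by move=> s; exact: Sinf_eq. Qed.

Lemma Sinf_mulVg : left_inverse Sinf_one Sinf_inv Sinf_mul.
Proof. by move=> s; apply: Sinf_eq => n; exact: Sinf_invfunK. Qed.

Lemma Sinf_mulgV : right_inverse Sinf_one Sinf_inv Sinf_mul.
Proof. by move=> s; apply: Sinf_eq => n; exact: Sinf_funK. Qed.

HB.instance Definition _ := isGroup.Build Sinf
  Sinf_mulA Sinf_mul1g Sinf_mulg1 Sinf_mulVg Sinf_mulgV.

End Sinf_group.

Lemma prod_continuous (I : eqType) (K : I -> topologicalType)
    (T : topologicalType) (f : T -> prod_topology K) :
  (forall i, continuous (fun x => f x i)) -> continuous f.
Proof.
move=> fc x; apply/cvg_sup => i.
exact: (@continuous_comp_initial (prod_topology K) T (K i) (fun g => g i) f).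
Qed.


Lemma Sinf_near (s : Sinf) n : \forall t \near s, Sinf_fun t n = Sinf_fun s n.
Proof.
have c : continuous (fun t : Sinf => Sinf_fun t n).
  move=> t; apply: (@continuous_comp _ {ptws nat -> nat} nat
    (@set_val _ [set f : {ptws nat -> nat} | bijective f]) (fun g => g n)).
    exact: initial_continuous.
  exact: (@proj_continuous nat (fun=> nat) n).
have := c s [set Sinf_fun s n]; apply.
by rewrite nbhs_principalE; apply/principal_filterP.
Qed.

Lemma Sinf_continuous (T : topologicalType) (f : T -> Sinf) :
  (forall x n, \forall y \near x, Sinf_fun (f y) n = Sinf_fun (f x) n) ->
  continuous f.
Proof.
move=> fc; apply: (@continuous_comp_initial Sinf T {ptws nat -> nat}
  (@set_val _ [set f : {ptws nat -> nat} | bijective f]) f).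
apply: prod_continuous => n x A Ax.
have Axn : A (Sinf_fun (f x) n) by exact: nbhs_singleton.
by apply: filterS (fc x n) => y /= fy; move: Axn; rewrite -fy.
Qed.

Lemma Sinf_mulg_continuous : continuous (fun x : Sinf * Sinf => x.1 * x.2).
Proof.
apply: Sinf_continuous => -[s t] n /=.
exists ([set s' | Sinf_fun s' (Sinf_fun t n) = Sinf_fun s (Sinf_fun t n)],
        [set t' | Sinf_fun t' n = Sinf_fun t n]) => /=.
  by split; exact: Sinf_near.
move=> [s' t'] /= [s's t't].
by transitivity (Sinf_fun s' (Sinf_fun t' n)) => //; rewrite t't.
Qed.

Lemma Sinf_invg_continuous : continuous (fun x : Sinf => x^-1).
Proof.
apply: Sinf_continuous => s n.
apply: filterS (Sinf_near s (Sinf_fun s^-1 n)) => t ts.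
apply: (can_inj (Sinf_invfunK t)).
transitivity n; first exact: (Sinf_funK t).
by rewrite ts; exact: esym (Sinf_funK s n).
Qed.

HB.instance Definition _ := PreTopologicalGroup_isTopologicalGroup.Build Sinf
  Sinf_mulg_continuous Sinf_invg_continuous.

Definition discrete_group (G : groupType) : Type := G.

HB.instance Definition _ (G : groupType) := Group.on (discrete_group G).
HB.instance Definition _ (G : groupType) :=
  Topological.copy (discrete_group G) (discrete_topology G).


Lemma discrete_group_continuous (G : groupType) (T : topologicalType)
    (f : discrete_group G -> T) : continuous f.
Proof. by move=> x A /nbhs_singleton Ax; apply/principal_filterP. Qed.

Lemma discrete_group_mulg_continuous (G : groupType) :
  continuous (fun x : discrete_group G * discrete_group G => x.1 * x.2).
Proof.
move=> [x y] A /nbhs_singleton Axy.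
exists ([set x], [set y]) => /=; first by split; exact/principal_filterP.
by move=> [x' y'] /= [-> ->].
Qed.

HB.instance Definition _ (G : groupType) :=
  PreTopologicalGroup_isTopologicalGroup.Build (discrete_group G)
    (@discrete_group_mulg_continuous G)
    (@discrete_group_continuous G _ (fun x => x^-1)).

Definition prod_group (I : Type) (G : I -> Type) : Type := prod_topology G.

HB.instance Definition _ (I : Type) (G : I -> topologicalType) :=
  Topological.copy (prod_group G) (prod_topology G).

Section prod_group.
Variables (I : eqType) (G : I -> topologicalGroupType).
Implicit Types x y z : prod_group G.

Lemma prod_group_eq x y : (forall i, x i = y i) -> x = y.
Proof. by move=> xy; apply: functional_extensionality_dep. Qed.

Definition prod_mul x y : prod_group G := fun i => x i * y i.
Definition prod_inv x : prod_group G := fun i => (x i)^-1.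
Definition prod_one : prod_group G := fun=> 1.

Lemma prod_mulA : associative prod_mul.
Proof. by move=> x y z; apply: prod_group_eq => i; exact: mulgA. Qed.

Lemma prod_mul1g : left_id prod_one prod_mul.
Proof. by move=> x; apply: prod_group_eq => i; exact: mul1g. Qed.

Lemma prod_mulg1 : right_id prod_one prod_mul.
Proof. by move=> x; apply: prod_group_eq => i; exact: mulg1. Qed.

Lemma prod_mulVg : left_inverse prod_one prod_inv prod_mul.
Proof. by move=> x; apply: prod_group_eq => i; exact: mulVg. Qed.

Lemma prod_mulgV : right_inverse prod_one prod_inv prod_mul.
Proof. by move=> x; apply: prod_group_eq => i; exact: mulgV. Qed.

HB.instance Definition _ := isGroup.Build (prod_group G)
  prod_mulA prod_mul1g prod_mulg1 prod_mulVg prod_mulgV.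

Lemma prod_mulg_continuous :
  continuous (fun x : prod_group G * prod_group G => x.1 * x.2).
Proof.
apply: (@prod_continuous I G) => i x.
apply: (@continuous_comp _ (G i * G i)%type _
  (fun x : prod_group G * prod_group G => (x.1 i, x.2 i))
  (fun x : G i * G i => x.1 * x.2)); last exact: mulg_continuous.
apply: cvg_pair => /=.
- apply: (@continuous_comp _ (prod_group G) _ fst (fun y => y i)).
    exact: cvg_fst.
  exact: (@proj_continuous I G i).
- apply: (@continuous_comp _ (prod_group G) _ snd (fun y => y i)).
    exact: cvg_snd.
  exact: (@proj_continuous I G i).
Qed.

Lemma prod_invg_continuous : continuous (fun x : prod_group G => x^-1).
Proof.
apply: (@prod_continuous I G) => i x.
apply: (@continuous_comp _ (G i) _ (fun x : prod_group G => x i)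
  (fun x : G i => x^-1)); last exact: invg_continuous.
exact: (@proj_continuous I G i).
Qed.

HB.instance Definition _ := PreTopologicalGroup_isTopologicalGroup.Build
  (prod_group G) prod_mulg_continuous prod_invg_continuous.

End prod_group.

Definition inverse_limit (A : nat -> groupType) (p : forall n, A n.+1 -> A n) :
    set (prod_group (fun n => discrete_group (A n))) :=
  [set x | forall n, p n (x n.+1) = x n].

Definition procountable (G : topologicalGroupType) (H : set G) : Prop :=
  exists (A : nat -> groupType) (p : forall n, A n.+1 -> A n),
    [/\ forall n, countable [set: A n],
        forall n x y, p n (x * y) = p n x * p n y,
        forall n, range (p n) = setT
      & top_isomorphic H (inverse_limit p)].

Definition generated_subgroup (G : groupType) (A : set G) : set G :=
  smallest (@is_subgroup G) A.

Definition commutator_subgroup (G : groupType) (A B : set G) : set G :=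
  generated_subgroup [set [~ x, y] | x in A & y in B].

(* The index is shifted: lower_central H 0 = H is the first term. *)
Fixpoint lower_central (G : groupType) (H : set G) (c : nat) : set G :=
  if c is c'.+1 then commutator_subgroup (lower_central H c') H else H.

Definition nilpotent_class_le (G : groupType) (c : nat) (H : set G) : Prop :=
  lower_central H c = [set 1].

(* The exponent is a least positive integer, so the trivial group has exponent 1
   and does not have exponent p for a prime p. *)
Definition has_exponent (G : groupType) (n : nat) (H : set G) : Prop :=
  [/\ (0 < n)%N, forall x, H x -> x ^+ n = 1
    & forall m, (0 < m)%N -> (forall x, H x -> x ^+ m = 1) -> (n <= m)%N].

(* sigma-algebras are kept as set systems, since measurableType would exclude
   the empty space. *)
Definition borel (T : topologicalType) : set_system T := <<s @open T >>.
Arguments borel T : clear implicits.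

Definition sub_algebra (X : Type) (SX : set_system X) (A : set X) :
    set_system A :=
  preimage_set_system setT (@set_val X A) SX.
Arguments sub_algebra {X} SX A.

Definition prod_algebra (X Y : Type) (SX : set_system X) (SY : set_system Y) :
    set_system (X * Y) :=
  <<s [set A `*` B | A in SX & B in SY] >>.

Definition borel_map (X Y : Type) (SX : set_system X) (SY : set_system Y)
    (f : X -> Y) : Prop :=
  forall B, SY B -> SX (f @^-1` B).

Definition borel_reducible (X Y : Type) (SX : set_system X) (SY : set_system Y)
    (E : X -> X -> Prop) (F : Y -> Y -> Prop) : Prop :=
  exists f : X -> Y,
    borel_map SX SY f /\ forall x x', E x x' <-> F (f x) (f x').

Definition polish_space (R : realType) (T : topologicalType) : Prop :=
  (exists2 D : set T, countable D & dense D) /\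
  exists (M : metricType R) (f : T -> M) (g : M -> T),
    [/\ cancel f g, cancel g f, continuous f, continuous g
      & forall F : set_system M, ProperFilter F -> cauchy F ->
          exists x : M, F --> x].

Definition standard_borel (R : realType) (X : Type) (SX : set_system X) : Prop :=
  exists (T : topologicalType) (f : X -> T),
    [/\ polish_space R T, bijective f
      & SX = preimage_set_system setT f (borel T)].

Definition is_action (G : groupType) (X : Type) (a : G -> X -> X) : Prop :=
  (forall x, a 1 x = x) /\ (forall g h x, a (g * h) x = a g (a h x)).

Definition orbit_relation (G X : Type) (a : G -> X -> X) (x y : X) : Prop :=
  exists g, a g x = y.

Definition closed_subgroup (G : topologicalGroupType) : Type :=
  {H : set G | closed H /\ is_subgroup H}.

(* The trace on the closed subgroups of the Effros Borel structure on the space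
   of closed subsets of G. *)
Definition effros (G : topologicalGroupType) :
    set_system (closed_subgroup G) :=
  <<s [set [set H : closed_subgroup G | sval H `&` U !=set0] | U in open] >>.
Arguments effros G : clear implicits.

Definition nil2_exp_class (p : nat) : set (closed_subgroup Sinf) :=
  [set H | [/\ procountable (sval H), nilpotent_class_le 2 (sval H)
             & has_exponent p (sval H)]].

Definition nil2_exp_borel (p : nat) : set_system (nil2_exp_class p) :=
  sub_algebra (effros Sinf) (nil2_exp_class p).

Definition nil2_exp_iso (p : nat) (H K : nil2_exp_class p) : Prop :=
  top_isomorphic (sval (set_val H)) (sval (set_val K)).

Definition ell_infty (R : realType) (x y : {ptws nat -> R}) : Prop :=
  exists M : R, forall n, (`|x n - y n| < M)%R.

(* A binary relation on nat is uncurried, so that the Borel structure is that of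
   a closed subspace of the Cantor space 2^(N x N). *)
Definition graphs : set {ptws nat * nat -> bool} :=
  [set r | (forall i j, r (i, j) = r (j, i)) /\ (forall i, ~~ r (i, i))].

Definition GI (r r' : graphs) : Prop :=
  exists2 s : nat -> nat, bijective s &
    forall i j, set_val r (i, j) = set_val r' (s i, s j).

(* Main.v *)
Require Import Defs.
From HB Require Import structures.
From mathcomp Require Import all_boot all_order all_algebra.
From mathcomp Require Import all_classical all_reals all_analysis.
From mathcomp Require finfield.
From mathcomp Require Import zify ring lra.
Import numFieldNormedType.Exports.

(* For x in R^N let A_n(x) = {(k, i) in N x Z | i <= x_k + n}. Then x - y is
   bounded iff every A_n(x) is contained in some A_m(y) and conversely. To each
   label j = (k, i) attach the Heisenberg group H_j over the field with p^e_j
   elements, the e_j being distinct primes: since a nontrivial value on a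
   commutator would produce a field embedding, every morphism H_i -> H_j with
   i <> j kills commutators. Let G_x be the group of all g in the product of the
   H_j whose restrictions to each A_n(x) have finite support, topologized by the
   subgroups of the g that are trivial on A_n(x). An isomorphism G_y -> G_x maps
   the elements trivial on some A_m(y) to elements trivial on A_n(x); if j were
   in A_n(x) but not in A_m(y), then H_j would embed into a product of groups
   H_i with i <> j, which is impossible. So G_x and G_y are isomorphic iff x - y
   is bounded.

   l_infty does not reduce to an orbit relation because E_1, eventual equality
   of sequences in Cantor space, reduces to l_infty, and a reduction theta of
   E_1 is impossible: from a generic x one changes the coordinates one by one,
   such that each change moves theta by a group element close to 1. The products
   g_k of these elements converge to some g and the modified sequences to some z,
   and theta(z) = g theta(x) although z differs from x at every coordinate. As
   the action is only Borel, the last equation is verified after translation by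
   an element u of the group that is generic over everything else. Small moves
   exist since the analytic set of pairs at small distance has the Baire
   property and the group is second countable. *)

Set Implicit Arguments.
Unset Strict Implicit.
Unset Printing Implicit Defensive.
Local Open Scope classical_set_scope.

(** Homomorphisms between abelian groups of exponent [p] are plentiful, so only commutators can mark
    the labels; this is why class 2 appears. Exponent [p] forces all fields to have characteristic
    [p], so only their degrees can tell them apart, and one field embeds into another as soon as its
    degree divides the other degree. Finite support on each A_n(x) makes the quotient by the
    subgroup of elements trivial on A_n(x) countable; this makes G_x procountable and lets it act
    faithfully on a countable set.

    Procountability is defined by a quantifier over inverse systems, from which no Borel description
    of the class can be read off. It is replaced by [conj_small], which says that the normal core of
    every point stabilizer is open and which becomes a countable combination of closed
    conditions. *)

(** * Generated sigma-algebras and countable logical operations *)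

Section generated_sigma_algebra.
Variables (T : Type) (G : set_system T).

Lemma sigma_ind (P : set T -> Prop) :
    P set0 -> (forall A, G A -> P A) -> (forall A, P A -> P (~` A)) ->
    (forall F : (set T)^nat, (forall n, P (F n)) -> P (\bigcup_n F n)) ->
  forall A, <<s G >> A -> P A.
Proof.
move=> P0 PG PC PU; have := @smallest_sub _ (@sigma_algebra T setT) G P.
apply => //; split=> // A PA.
by rewrite setTD; exact: PC.
Qed.

Lemma sigma_setC A : <<s G >> A -> <<s G >> (~` A).
Proof. by move=> AG; rewrite -setTD; exact: sigma_algebraCD. Qed.

Lemma sigma_not (P : T -> Prop) :
  <<s G >> [set x | P x] -> <<s G >> [set x | ~ P x].
Proof. by move=> PG; exact: (sigma_setC PG). Qed.

Lemma sigma_exists (I : countType) (P : I -> T -> Prop) :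
  (forall i, <<s G >> [set x | P i x]) -> <<s G >> [set x | exists i, P i x].
Proof.
move=> PG; have -> : [set x | exists i, P i x] =
    \bigcup_n (if unpickle n is Some i then [set x | P i x] else set0).
  apply/seteqP; split=> [x [i Pix]|x [n _]].
    by exists (pickle i) => //; rewrite pickleK.
  by case: unpickle => // i Pix; exists i.
apply: sigma_algebra_bigcup => n; case: unpickle => [i|]; first exact: PG.
exact: sigma_algebra0.
Qed.

Lemma sigma_forall (I : countType) (P : I -> T -> Prop) :
  (forall i, <<s G >> [set x | P i x]) -> <<s G >> [set x | forall i, P i x].
Proof.
move=> PG; have -> : [set x | forall i, P i x] = [set x | ~ exists i, ~ P i x].
  by apply/funext => x; apply/propext => /=; rewrite -forallNP; split=> Px i;
    [move=> nP; exact: nP (Px i)|apply: contrapT; exact: Px].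
by apply: sigma_not; apply: sigma_exists => i; exact: sigma_not.
Qed.

Lemma sigma_prop (P : Prop) : <<s G >> [set _ | P].
Proof.
have [p|np] := pselect P.
  have -> : [set _ : T | P] = ~` set0.
    by apply/funext => x; apply/propext; split=> // _ [].
  by apply: sigma_setC; exact: sigma_algebra0.
have -> : [set _ : T | P] = set0.
  by apply/funext => x; apply/propext; split.
exact: sigma_algebra0.
Qed.

Lemma sigma_and (P Q : T -> Prop) : <<s G >> [set x | P x] ->
  <<s G >> [set x | Q x] -> <<s G >> [set x | P x /\ Q x].
Proof.
move=> PG QG; rewrite [X in <<s G >> X](_ : _ =
  [set x | forall b : bool, (if b then P else Q) x]).
  by apply: sigma_forall => -[].
by apply/seteqP; split=> [x [Px Qx] []|x PQ] //; split; [apply: (PQ true)|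
  apply: (PQ false)].
Qed.

Lemma sigma_or (P Q : T -> Prop) : <<s G >> [set x | P x] ->
  <<s G >> [set x | Q x] -> <<s G >> [set x | P x \/ Q x].
Proof.
move=> PG QG; rewrite [X in <<s G >> X](_ : _ =
  [set x | exists b : bool, (if b then P else Q) x]).
  by apply: sigma_exists => -[].
apply/seteqP; split=> [x [Px|Qx]|x [[] PQ]]; first by exists true.
- by exists false.
- by left.
- by right.
Qed.

Lemma sigma_imp (P Q : T -> Prop) : <<s G >> [set x | P x] ->
  <<s G >> [set x | Q x] -> <<s G >> [set x | P x -> Q x].
Proof.
move=> PG QG; rewrite [X in <<s G >> X](_ : _ = [set x | ~ P x \/ Q x]).
  by apply: sigma_or => //; exact: sigma_not.
by apply/funext => x; apply: implyE.
Qed.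

Lemma sigma_iff (P Q : T -> Prop) : <<s G >> [set x | P x] ->
  <<s G >> [set x | Q x] -> <<s G >> [set x | P x <-> Q x].
Proof. by move=> PG QG; apply: sigma_and; exact: sigma_imp. Qed.

End generated_sigma_algebra.

Lemma sigma_preimage (T U : Type) (G : set_system T) (H : set_system U)
    (f : T -> U) : (forall A, H A -> <<s G >> (f @^-1` A)) ->
  forall A, <<s H >> A -> <<s G >> (f @^-1` A).
Proof.
move=> fH; apply: sigma_ind => //.
- by rewrite preimage_set0; exact: sigma_algebra0.
- by move=> A; rewrite preimage_setC; exact: sigma_setC.
- by move=> F FG; rewrite preimage_bigcup; exact: sigma_algebra_bigcup.
Qed.

(** * Countable bases and Baire category *)

(* Second countable spaces are handled through a fixed countable base, indexed
   by a countType; base sets may be empty. *)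
Record base_space := BaseSpace {
  bs_pt :> Type;
  bs_ix : countType;
  bs_set : bs_ix -> set bs_pt;
  bs_cover : forall x, exists i, bs_set i x;
  bs_inter : forall i j x, bs_set i x -> bs_set j x ->
    exists k, [/\ bs_set k x, bs_set k `<=` bs_set i & bs_set k `<=` bs_set j]
}.
Arguments bs_ix : clear implicits.
Arguments bs_set {b} i.

Program Definition prod_base (S T : base_space) : base_space :=
  @BaseSpace (S * T) (bs_ix S * bs_ix T)%type
    (fun ij => [set z | bs_set ij.1 z.1 /\ bs_set ij.2 z.2]) _ _.
Next Obligation.
move=> S T [x y]; have [i xi] := bs_cover x; have [j yj] := bs_cover y.
by exists (i, j).
Qed.
Next Obligation.
move=> S T [i j] [i' j'] [x y] /= [ix jy] [i'x j'y].
have [k [kx ki ki']] := bs_inter ix i'x.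
have [l [ly lj lj']] := bs_inter jy j'y.
by exists (k, l); split=> // -[u v] /= [ku lv]; split; auto.
Qed.

Section category.
Variable T : base_space.
Implicit Types (A M N : set T) (i j k : bs_ix T).

(** Nonemptiness is built in because base sets may be empty, and an empty set would witness nowhere
    density of anything. *)
Definition sub_base j i := bs_set j !=set0 /\ bs_set j `<=` bs_set i.

Lemma sub_base_refl i x : bs_set i x -> sub_base i i.
Proof. by split=> //; exists x. Qed.

Lemma sub_base_trans i j k : sub_base k j -> sub_base j i -> sub_base k i.
Proof. by move=> [k0 kj] [j0 ji]; split=> // x /kj/ji. Qed.

Lemma sub_base_inter i j x : bs_set i x -> bs_set j x ->
  exists k, [/\ bs_set k x, sub_base k i & sub_base k j].
Proof.
move=> ix jx; have [k [kx ki kj]] := bs_inter ix jx.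
by exists k; split=> //; split=> //; exists x.
Qed.

Definition nowhere_dense N := forall i, bs_set i !=set0 ->
  exists2 j, sub_base j i & forall x, bs_set j x -> ~ N x.

Definition meager M := exists2 N : nat -> set T,
  forall n, nowhere_dense (N n) & M `<=` \bigcup_n N n.

Definition comeager A := meager (~` A).

Definition baire := forall i, bs_set i !=set0 -> ~ meager (bs_set i).

Lemma nowhere_dense_meager N : nowhere_dense N -> meager N.
Proof. by move=> Nn; exists (fun=> N) => // x Nx; exists 0%N. Qed.

Lemma meager_sub M M' : M' `<=` M -> meager M -> meager M'.
Proof. by move=> M'M [N Nn MN]; exists N => //; exact: subset_trans MN. Qed.

Lemma meager0 : meager set0.
Proof.
apply: nowhere_dense_meager => i [x ix].
by exists i; [exact: sub_base_refl ix|move=> y _ []].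
Qed.

Lemma meager_exists (I : countType) (M : I -> T -> Prop) :
  (forall a, meager [set x | M a x]) -> meager [set x | exists a, M a x].
Proof.
move=> Mm; have /choice [N NP] : forall a, exists N : nat -> set T,
    (forall n, nowhere_dense (N n)) /\ M a `<=` \bigcup_n N n.
  by move=> a; have [N Nn MN] := Mm a; exists N.
exists (fun m => if unpickle m is Some (a, n) then N a n else set0).
  move=> m; case: unpickle => [[a n]|]; first by case: (NP a).
  by move=> i [x ix]; exists i; [exact: sub_base_refl ix|move=> y _ []].
move=> x [a Max]; have [_ /(_ _ Max) [n _ Nx]] := NP a.
by exists (pickle (a, n)) => //; rewrite pickleK.
Qed.

Lemma meager_or (P Q : T -> Prop) : meager [set x | P x] ->
  meager [set x | Q x] -> meager [set x | P x \/ Q x].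
Proof.
move=> Pm Qm; apply: (@meager_sub [set x | exists b : bool, (if b then P else Q) x]).
  by move=> x [Px|Qx]; [exists true|exists false].
by apply: meager_exists => -[].
Qed.

Lemma comeager_forall (I : countType) (P : I -> T -> Prop) :
  (forall a, comeager [set x | P a x]) -> comeager [set x | forall a, P a x].
Proof.
move=> Pc; apply: meager_sub (meager_exists Pc).
by move=> x /= /existsNP.
Qed.

Lemma comeager_and (P Q : T -> Prop) : comeager [set x | P x] ->
  comeager [set x | Q x] -> comeager [set x | P x /\ Q x].
Proof.
move=> Pc Qc; apply: meager_sub (meager_or Pc Qc).
by move=> x /= /not_andP.
Qed.

Lemma comeager_sub A A' : A `<=` A' -> comeager A -> comeager A'.
Proof. by move=> AA'; apply: meager_sub => x nA'x /AA'. Qed.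

Lemma baire_comeager A i : baire -> bs_set i !=set0 -> comeager A ->
  exists2 x, bs_set i x & A x.
Proof.
move=> bT i0 Am; apply: contrapT => nA; apply: (bT _ i0).
by apply: meager_sub Am => x ix Ax; apply: nA; exists x.
Qed.

(** Otherwise the base sets in which [A] is meager are dense in [i]. Countably many of them cover
    [i] up to a nowhere dense set, so [A] would be meager in [i]. *)
Lemma nonmeager_local A i : ~ meager (A `&` bs_set i) ->
  exists2 j, sub_base j i & forall k, sub_base k j -> ~ meager (A `&` bs_set k).
Proof.
move=> Anm; apply: contrapT => nloc; apply: Anm.
have loc j : sub_base j i -> exists2 k, sub_base k j & meager (A `&` bs_set k).
  move=> ji; apply: contrapT => nk; apply: nloc; exists j => // k kj Ak.
  by apply: nk; exists k.
pose small k := meager (A `&` bs_set k).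
apply: (@meager_sub [set x | (exists k, small k /\ (A `&` bs_set k) x) \/
    (bs_set i x /\ forall k, small k -> ~ bs_set k x)]).
  move=> x [Ax ix].
  have [[k [ks kx]]|nk] := pselect (exists k, small k /\ bs_set k x).
    by left; exists k.
  by right; split=> // k ks kx; apply: nk; exists k.
apply: meager_or.
  apply: meager_exists => k; have [ks|nks] := pselect (small k).
    by apply: meager_sub ks => x [].
  by apply: meager_sub meager0 => x [].
apply: nowhere_dense_meager => l [x lx].
have [[y [ly iy]]|nli] := pselect (exists y, bs_set l y /\ bs_set i y).
  have [j [jy jl ji]] := sub_base_inter ly iy.
  have [k kj ks] := loc j ji; exists k; first exact: sub_base_trans kj jl.
  by move=> z kz [_ /(_ _ ks)].
exists l; first exact: sub_base_refl lx.
by move=> z lz [iz _]; apply: nli; exists z.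
Qed.

Definition baire_property A := exists K : set (bs_ix T),
  meager [set x | ~ (A x <-> exists2 k, K k & bs_set k x)].

Definition Borel : set_system T := <<s range (@bs_set T) >>.

Lemma Borel_base i : Borel (bs_set i).
Proof. by apply: sub_sigma_algebra; exists i. Qed.

Lemma Borel_baire_property A : Borel A -> baire_property A.
Proof.
move: A; apply: sigma_ind.
- exists set0; apply: meager_sub meager0 => x; apply => /=.
  by split=> // -[].
- move=> _ [i _ <-]; exists [set i]; apply: meager_sub meager0 => x; apply => /=.
  by split=> [ix|[k -> //]]; exists i.
(* The complement is matched with the interior of the complement of the open set coded by [K]; the
   error is the boundary of that open set, which is nowhere dense. *)
- move=> A [K Km]; exists [set l | forall k x, K k -> bs_set k x -> ~ bs_set l x].
  apply: (@meager_sub [set x | ~ (A x <-> exists2 k, K k & bs_set k x) \/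
      (~ (exists2 k, K k & bs_set k x) /\
       forall l, bs_set l x -> exists k y, [/\ K k, bs_set k y & bs_set l y])]).
    move=> x /= nE; apply: contrapT => /not_orP[/contrapT AK nb]; apply: nE.
    rewrite AK; split=> [nK|[l lK lx] [k Kk kx]]; last exact: (lK k x).
    apply: contrapT => nl; apply: nb; split=> // l lx.
    apply: contrapT => nk; apply: nl; exists l => // k y Kk ky ly.
    by apply: nk; exists k, y.
  apply: meager_or => //; apply: nowhere_dense_meager => l [x lx].
  have [[k [y [Kk ky ly]]]|nk] :=
      pselect (exists k y, [/\ K k, bs_set k y & bs_set l y]).
    have [j [jy jk jl]] := sub_base_inter ky ly.
    by exists j => // z jz [nz _]; apply: nz; exists k => //; exact: jk.2.
  exists l; first exact: sub_base_refl lx.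
  by move=> z lz [_ /(_ _ lz)].
- move=> F FP; have /choice [K KP] := FP.
  exists [set k | exists n, K n k]; apply: meager_sub (meager_exists KP).
  move=> x /= nE; apply: contrapT => /forallNP nn; apply: nE.
  split=> [[n _ Fnx]|[k [n Kk] kx]].
    have /contrapT[+ _] := nn n; move=> /(_ Fnx) [k Kk kx].
    by exists k => //; exists n.
  by exists n => //; have /contrapT[_] := nn n; apply; exists k.
Qed.

End category.
Arguments Borel : clear implicits.
Arguments baire : clear implicits.

(** The closure of [bs_set j] lies in [bs_set i], expressed through base sets. *)
Definition inner (T : base_space) (j i : bs_ix T) := forall x : T,
  bs_set i x \/ exists2 m, bs_set m x & forall y, bs_set m y -> ~ bs_set j y.

Definition regular_base (T : base_space) := forall i (x : T),
  bs_set i x -> exists2 j, bs_set j x & inner j i.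

Lemma inner_sub (T : base_space) (j i : bs_ix T) : inner j i ->
  bs_set j `<=` bs_set i.
Proof. by move=> ji x jx; case: (ji x) => // -[m mx /(_ x mx)]. Qed.

Lemma regular_prod (S T : base_space) : regular_base S -> regular_base T ->
  regular_base (prod_base S T).
Proof.
move=> rS rT [i i'] [x x'] [/= ix i'x']; have [j jx ji] := rS _ _ ix.
have [j' j'x' j'i'] := rT _ _ i'x'; exists (j, j') => //= -[y y'].
have [iy|[m my mj]] := ji y; last first.
  have [m' m'y'] := bs_cover y'; right; exists (m, m') => // -[z z'] /= [mz _].
  by move=> [jz _]; exact: mj mz jz.
have [iy'|[m' my' mj']] := j'i' y'; first by left.
have [m my] := bs_cover y; right; exists (m, m') => // -[z z'] /= [_ mz].
by move=> [_ jz]; exact: mj' mz jz.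
Qed.

(* Analytic sets are the projections of closed subsets of the product with Baire
   space; [closed_rel] says that the complement of the relation is open. *)
Definition closed_rel (T : base_space) (F : T -> (nat -> nat) -> Prop) :=
  forall x s, ~ F x s -> exists i n, bs_set i x /\
    forall x' s', bs_set i x' -> (forall m, (m < n)%N -> s' m = s m) -> ~ F x' s'.

Definition analytic (T : base_space) (A : set T) :=
  exists2 F, closed_rel F & forall x, A x <-> exists s, F x s.

Section analytic.
Variable T : base_space.
Implicit Types A : set T.

Lemma analytic_bigcup (A : nat -> set T) :
  (forall n, analytic (A n)) -> analytic (\bigcup_n A n).
Proof.
move=> An; have /choice [F FP] : forall n, exists F, closed_rel F /\
    forall x, A n x <-> exists s, F x s by move=> n; have [F] := An n; exists F.
exists (fun x s => F (s 0%N) x (fun m => s m.+1)).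
  move=> x s nF; have [Fc _] := FP (s 0%N); have [i [n [ix iF]]] := Fc _ _ nF.
  exists i, n.+1; split=> // x' s' ix' ss'.
  by rewrite ss' //; apply: iF => // m mn; exact: ss'.
move=> x; split=> [[n _ /(FP n).2 [s Fs]]|[s Fs]].
  by exists (fun m => if m is m'.+1 then s m' else n).
by exists (s 0%N) => //; apply/(FP (s 0%N)).2; exists (fun m => s m.+1).
Qed.

Lemma analytic_bigcap (A : nat -> set T) :
  (forall n, analytic (A n)) -> analytic (\bigcap_n A n).
Proof.
move=> An; have /choice [F FP] : forall n, exists F, closed_rel F /\
    forall x, A n x <-> exists s, F x s by move=> n; have [F] := An n; exists F.
pose col (n : nat) (s : nat -> nat) := fun m : nat => s (pickle (n, m)).
exists (fun x s => forall n, F n x (col n s)).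
  move=> x s /existsNP [n nF]; have [Fc _] := FP n.
  have [i [N [ix iF]]] := Fc _ _ nF.
  (* This bound covers the places that hold the first [N] entries of column [n]. *)
  exists i, (\max_(m < N) (pickle (n, nat_of_ord m))).+1; split=> // x' s' ix' ss' Fx'.
  apply: (iF x' (col n s') ix' _ (Fx' n)) => m mN; apply: ss'; rewrite ltnS.
  exact: (leq_bigmax (Ordinal mN)).
move=> x; split=> [Ax|[s Fs] n _]; last by apply/(FP n).2; exists (col n s).
have /choice [s sP] : forall n, exists s, F n x s.
  by move=> n; apply/(FP n).2; exact: Ax.
pose t m := if @unpickle (nat * nat)%type m is Some (n, l) then s n l else 0%N.
exists t => n; suff -> : col n t = s n by exact: sP.
by apply/funext => m; rewrite /col /t pickleK.
Qed.

(** By regularity a base set is the union of the closures of the base sets well inside it; [s 0]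
    names one of these. *)
Lemma analytic_base i : regular_base T -> analytic (@bs_set T i).
Proof.
move=> rT; exists (fun x s => exists j : bs_ix T, [/\ unpickle (s 0%N) = Some j, inner j i &
    forall m, bs_set m x -> exists y, bs_set m y /\ bs_set j y]).
  move=> x s nF.
  have [[j [sj ji]]|nj] := pselect (exists j, unpickle (s 0%N) = Some j /\ inner j i); last first.
    have [k kx] := bs_cover x; exists k, 1%N; split=> // x' s' _ ss' [j [s'j ji _]].
    by apply: nj; exists j; rewrite -ss'.
  have /existsNP [m /not_implyP [mx mj]] :
      ~ forall m, bs_set m x -> exists y, bs_set m y /\ bs_set j y.
    by move=> xj; apply: nF; exists j.
  exists m, 1%N; split=> // x' s' mx' ss' [j' []]; rewrite ss' // sj => -[<-] _.
  by move=> /(_ _ mx')/mj.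
move=> x; split=> [ix|[s [j [_ ji xj]]]].
  have [j jx ji] := rT _ _ ix; exists (fun=> pickle j), j; split=> //.
    exact: pickleK.
  by move=> m mx; exists x.
by case: (ji x) => // -[m mx mj]; have [y [my jy]] := xj _ mx; case: (mj y my).
Qed.

Lemma analytic_baseC i : analytic (~` @bs_set T i).
Proof.
exists (fun x _ => ~ bs_set i x); last by move=> x; split=> [|[]//]; exists id.
by move=> x s /contrapT ix; exists i, 0%N; split=> // x' s' ix' _; exact.
Qed.

(** The induction carries the complement along, because analytic sets are closed under countable
    unions and intersections but not under complements. *)
Lemma Borel_analytic A : regular_base T -> Borel T A ->
  analytic A /\ analytic (~` A).
Proof.
move=> rT; move: A; apply: sigma_ind.
- split.
    exists (fun _ _ => False); last by move=> x; split=> [[]|[s []]].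
    by move=> x s _; have [i ix] := bs_cover x; exists i, 0%N; split=> // *; exact.
  exists (fun _ _ => True); first by move=> x s /(_ I).
  by move=> x; split=> [_|_ []]; exists id.
- by move=> _ [i _ <-]; split; [exact: analytic_base|exact: analytic_baseC].
- by move=> A [Aa nAa]; rewrite setCK.
- move=> F FP; split; first by apply: analytic_bigcup => n; case: (FP n).
  by rewrite setC_bigcup; apply: analytic_bigcap => n; case: (FP n).
Qed.

End analytic.

(** * The Baire property of analytic sets *)

Section analytic_dichotomy.
Variables (T : base_space) (F : T -> (nat -> nat) -> Prop).
Hypothesis F_closed : closed_rel F.

Let piece (l : seq nat) : set T :=
  [set x | exists s, F x s /\ forall m, (m < size l)%N -> s m = nth 0%N l m].

(** The closed set where [piece l] is locally nonmeager. Off a meager set, a point of [hull l] lies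
    in some [hull (rcons l n)], so a branch can be built one entry at a time. *)
Let hull l : set T := [set x | forall i, bs_set i x -> ~ meager (piece l `&` bs_set i)].

Let piece_rcons l : piece l `<=` \bigcup_n piece (rcons l n).
Proof.
move=> x [s [Fs sl]]; exists (s (size l)) => //; exists s; split=> // m.
rewrite size_rcons ltnS leq_eqVlt nth_rcons => /orP[/eqP ->|ml].
  by rewrite ltnn eqxx.
by rewrite ml sl.
Qed.

(** If [piece l] is nonmeager in [i], so is one of its countably many extensions, and
    [nonmeager_local] finds a base subset of [i] inside the hull of that extension. *)
Let hull_gap l : meager (hull l `\` \bigcup_n hull (rcons l n)).
Proof.
apply: nowhere_dense_meager => i [x ix].
have [li|nli] := pselect (meager (piece l `&` bs_set i)).
  by exists i; [exact: sub_base_refl ix|move=> y iy [/(_ _ iy)]].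
have [n nln] : exists n, ~ meager (piece (rcons l n) `&` bs_set i).
  apply: contrapT => /forallNP lnm; apply: nli.
  apply: (@meager_sub _ [set x | exists n, (piece (rcons l n) `&` bs_set i) x]).
    by move=> y [/piece_rcons[n _ yn] iy]; exists n.
  by apply: meager_exists => n; apply: contrapT; exact: lnm.
have [j ji jP] := nonmeager_local nln; exists j => // y jy [_]; apply.
exists n => // k ky; have [m [my mk mj]] := sub_base_inter ky jy.
move=> km; apply: (jP m mj); apply: meager_sub km => z [zp zm].
by split=> //; exact: mk.2.
Qed.

Let hull_branch x : hull [::] x ->
  (forall l, hull l x -> exists n, hull (rcons l n) x) -> exists s, F x s.
Proof.
move=> x0 xS; have /choice [next nextP] : forall l, exists n, hull l x -> hull (rcons l n) x.
  by move=> l; have [/xS [n]|nl] := pselect (hull l x); [exists n|exists 0%N].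
pose b := fix b n := if n is n'.+1 then rcons (b n') (next (b n')) else [::].
have bx n : hull (b n) x by elim: n => //= n IH; exact: nextP.
have sb n : size (b n) = n by elim: n => //= n IH; rewrite size_rcons IH.
pose s n := next (b n).
have bs n m : (m < n)%N -> nth 0%N (b n) m = s m.
  elim: n => // n IH; rewrite ltnS leq_eqVlt /= nth_rcons sb => /orP[/eqP ->|mn].
    by rewrite ltnn eqxx.
  by rewrite mn IH.
exists s; apply: contrapT => /F_closed [i [n [ix iF]]].
(* Witnesses for [piece (b n)] share the first [n] entries of [s], so this piece misses [i],
   although [x] is in its hull. *)
apply: (bx n _ ix); apply: meager_sub (@meager0 T) => y [[s' [Fs' s'b]] iy].
by apply: (iF y s' iy) Fs' => m mn; rewrite s'b ?sb // bs.
Qed.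

Lemma closed_rel_dichotomy i : ~ meager ([set x | exists s, F x s] `&` bs_set i) ->
  exists2 j, sub_base j i & meager (bs_set j `\` [set x | exists s, F x s]).
Proof.
have p0 : [set x | exists s, F x s] = piece [::].
  by apply/seteqP; split=> x [s]; [exists s|case=> Fs _; exists s].
rewrite {1}p0 => /nonmeager_local [j ji jP]; exists j => //.
apply: meager_sub (meager_exists hull_gap) => x [jx nF].
apply: contrapT => /forallNP ngap; apply: nF; apply: hull_branch.
  move=> k kx km; have [m [mx mk mj]] := sub_base_inter kx jx.
  by apply: (jP m mj); apply: meager_sub km => y [py my]; split=> //; exact: mk.2.
move=> l lx; apply: contrapT => nn; apply: (ngap l); split=> // -[n _ nx].
by apply: nn; exists n.
Qed.

End analytic_dichotomy.

Lemma analytic_dichotomy (T : base_space) (A : set T) i : analytic A ->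
  ~ meager (A `&` bs_set i) -> exists2 j, sub_base j i & meager (bs_set j `\` A).
Proof.
move=> [F Fc AF]; have -> : A = [set x | exists s, F x s].
  by apply/funext => x; apply/propext; exact: AF.
exact: closed_rel_dichotomy.
Qed.

(* [r n j i] reads: the base set [j] is well inside [i] and [n]-small. *)
Record complete_base (T : base_space) (r : nat -> bs_ix T -> bs_ix T -> Prop) := {
  cb_ex : forall n i x, bs_set i x -> exists2 j, bs_set j x & r n j i;
  cb_sub : forall n i j, r n j i -> inner j i;
  cb_trans : forall n i j k, r n k j -> bs_set j `<=` bs_set i -> r n k i;
  cb_lim : forall s, (forall n, r n (s n.+1) (s n)) ->
    (forall n, bs_set (s n) !=set0) -> exists x, (forall n, bs_set (s n) x) /\
      forall k, bs_set k x -> exists n, bs_set (s n) `<=` bs_set k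
}.

Section complete.
Variables (T : base_space) (r : nat -> bs_ix T -> bs_ix T -> Prop).
Hypothesis rP : complete_base r.

Lemma complete_regular : regular_base T.
Proof.
by move=> i x /(cb_ex rP 0) [j jx /(cb_sub rP) ji]; exists j.
Qed.

Lemma complete_baire : baire T.
Proof.
move=> i i0 [N Nn iN].
have step n j : exists k, bs_set j !=set0 ->
    [/\ bs_set k !=set0, r n k j & forall x, bs_set k x -> ~ N n x].
  have [j0|nj0] := pselect (bs_set j !=set0); last by exists j.
  have [k [[x kx] kj] kN] := Nn n j j0; have [l lx lk] := cb_ex rP n kx.
  exists l => _; split; first by exists x.
    exact: cb_trans lk kj.
  by move=> y ly; apply: kN; exact: inner_sub (cb_sub rP lk) _ ly.
have /choice [next nextP] : forall nj, exists k, bs_set nj.2 !=set0 ->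
    [/\ bs_set k !=set0, r nj.1 k nj.2 & forall x, bs_set k x -> ~ N nj.1 x].
  by move=> [n j]; exact: step.
pose s := fix s n := if n is n'.+1 then next (n', s n') else i.
have s0 n : bs_set (s n) !=set0 by elim: n => //= n /(nextP (n, s n)) [].
have sr n : r n (s n.+1) (s n) by have [] := nextP (n, s n) (s0 n).
have [x [xs _]] := cb_lim rP sr s0; have [n _] := iN x (xs 0%N).
by have [_ _ /(_ x (xs n.+1))] := nextP (n, s n) (s0 n).
Qed.

Lemma complete_chain (x : T) :
  exists s, (forall n, bs_set (s n) x) /\ (forall n, r n (s n.+1) (s n)).
Proof.
have /choice [next nextP] : forall nj, exists k, bs_set nj.2 x ->
    bs_set k x /\ r nj.1 k nj.2.
  move=> [n j]; have [jx|nj] := pselect (bs_set j x); last by exists j.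
  by have [k kx kj] := cb_ex rP n jx; exists k.
have [i ix] := bs_cover x.
pose s := fix s n := if n is n'.+1 then next (n', s n') else i.
have sx n : bs_set (s n) x by elim: n => //= n /(nextP (n, s n)) [].
by exists s; split=> // n; have [] := nextP (n, s n) (sx n).
Qed.

(* A point of [T] is coded in Baire space by a chain of shrinking base sets
   around it, stored at the even places. *)
Lemma analytic_projection (S : base_space) (A : set (prod_base S T)) :
  analytic A -> analytic [set x : S | exists w : T, A (x, w)].
Proof.
move=> [F Fc AF].
pose code (s : nat -> nat) (c : nat -> bs_ix T) :=
  (forall n, unpickle (s n.*2) = Some (c n)) /\ forall n, r n (c n.+1) (c n).
pose rest (s : nat -> nat) n := s n.*2.+1.
exists (fun x s => exists c w, [/\ code s c, forall n, bs_set (c n) w & F (x, w) (rest s)]).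
  move=> x s nF; have [i0 i0x] := bs_cover x.
  (* Failure has three causes: the even entries code no chain, some set of the chain is empty, or
     [F] fails at the limit of the chain. Each is visible in finitely many entries. *)
  have [[c [sc cr]]|nc] := pselect (exists c, code s c); last first.
    have [n nn] : exists n, forall c : nat -> bs_ix T, unpickle (s n.*2) = Some (c n) ->
        unpickle (s n.+1.*2) = Some (c n.+1) -> ~ r n (c n.+1) (c n).
      apply: contrapT => /forallNP nn; apply: nc.
      have {}nn n : exists c : bs_ix T * bs_ix T, [/\ unpickle (s n.*2) = Some c.1,
          unpickle (s n.+1.*2) = Some c.2 & r n c.2 c.1].
        have /existsNP [c] := nn n.
        by move=> /not_implyP[c1 /not_implyP[c2 /contrapT c3]]; exists (c n, c n.+1).
      have /choice [c cP] := nn; exists (fun n => (c n).1); split=> n.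
        by case: (cP n).
      have [_ c2 c3] := cP n; have [c4 _ _] := cP n.+1.
      by suff <- : (c n).2 = (c n.+1).1 by []; apply: Some_inj; rewrite -c2 c4.
    exists i0, n.+1.*2.+1; split=> // x' s' _ ss' [c [w [[s'c cr] _ _]]].
    apply: (nn c) => //; rewrite -ss' //.
      by rewrite doubleS ltnS; lia.
  have [cn0|nc0] := pselect (forall n, bs_set (c n) !=set0); last first.
    have /existsNP [n nn] := nc0; exists i0, n.*2.+1; split=> //.
    move=> x' s' _ ss' [c' [w [[s'c' _] c'w _]]]; apply: nn; exists w.
    by have := s'c' n; rewrite ss' // sc => -[->].
  have [w [cw wk]] := cb_lim rP cr cn0.
  have /Fc [[i j] [n [[/= ix jw] iF]]] : ~ F (x, w) (rest s).
    by move=> Fw; apply: nF; exists c, w.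
  have [m mj] := wk _ jw; exists i, (maxn n m).*2.+2; split=> //.
  move=> x' s' ix' ss' [c' [w' [[s'c' _] c'w' Fw']]].
  apply: (iF (x', w') (rest s')) Fw' => /=.
    split=> //; apply: mj; have := s'c' m; rewrite ss' ?sc; last by lia.
    by move=> [->].
  by move=> l ln; rewrite /rest ss' //; lia.
move=> x; split=> [[w /AF [s Fs]]|[s [c [w [_ _ Fw]]]]]; last first.
  by exists w; apply/AF; exists (rest s).
have [c [cw cr]] := complete_chain w.
exists (fun n => if odd n then s n./2 else pickle (c n./2)), c, w; split=> //.
  by split=> // n; rewrite odd_double doubleK pickleK.
suff -> : rest (fun n => if odd n then s n./2 else pickle (c n./2)) = s by [].
by apply/funext => n; rewrite /rest /= odd_double /= uphalf_double.
Qed.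

End complete.

(** For a nowhere dense set and a fixed base set [j], the points whose section avoids some base
    subset of [j] contain a dense open set; only countably many pairs [(n, j)] occur. *)
Lemma kuratowski_ulam (S T : base_space) (M : set (prod_base S T)) : meager M ->
  comeager [set x : S | meager [set y : T | M (x, y)]].
Proof.
move=> [N Nn MN].
pose good n j (x : S) := bs_set j !=set0 -> exists2 j', sub_base j' j &
  forall y : T, bs_set j' y -> ~ N n (x, y).
apply: (@comeager_sub _ [set x | forall nj : nat * bs_ix T, good nj.1 nj.2 x]).
  move=> x gx; exists (fun n => [set y | N n (x, y)]); last by move=> y /MN.
  by move=> n j; exact: gx (n, j).
apply: comeager_forall => -[n j]; apply: nowhere_dense_meager => i [x ix] /=.
have [[y jy]|nj] := pselect (bs_set j !=set0); last first.
  by exists i; [exact: sub_base_refl ix|move=> z _; apply => /nj].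
have [|[i' j'] [[[x' y'] [/= ix' jy']] sij] ijN] := Nn n (i, j).
  by exists (x, y).
exists i'.
  by split=> [|z iz]; [exists x'|have [] := sij (z, y') (conj iz jy')].
move=> z iz; apply => _; exists j'.
  by split=> [|u ju]; [exists y'|have [] := sij (x', u) (conj ix' ju)].
by move=> u ju; apply: ijN; split.
Qed.

Definition base_continuous (S T : base_space) (f : S -> T) :=
  forall x j, bs_set j (f x) -> exists2 i, bs_set i x &
    forall y, bs_set i y -> bs_set j (f y).

Definition base_open (S T : base_space) (f : S -> T) :=
  forall x i, bs_set i x -> exists2 j, bs_set j (f x) &
    forall y, bs_set j y -> exists2 x', bs_set i x' & f x' = y.

(** This transports genericity along right translations of the group and along the replacement of a
    row by [upd]. *)
Lemma meager_preimage (S T : base_space) (f : S -> T) (M : set T) :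
  base_continuous f -> base_open f -> meager M -> meager (f @^-1` M).
Proof.
move=> fc fo [N Nn MN]; exists (fun n => f @^-1` N n); last by move=> x /MN.
move=> n i [x ix]; have [j jx ij] := fo x i ix.
have [|k [[y ky] kj] kN] := Nn n j; first by exists (f x).
have [x' ix' fx'] := ij _ (kj _ ky); rewrite -fx' in ky.
have [l lx' lk] := fc _ _ ky; have [m [mx' mi ml]] := sub_base_inter ix' lx'.
by exists m => // z /ml.2 /lk /kN.
Qed.

Definition Borel_fun (S T : base_space) (f : S -> T) :=
  forall A, Borel T A -> Borel S (f @^-1` A).

Lemma Borel_fun_base (S T : base_space) (f : S -> T) :
  (forall j, Borel S [set x | bs_set j (f x)]) -> Borel_fun f.
Proof. by move=> fB; apply: sigma_preimage => _ [j _ <-]; exact: fB. Qed.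

Lemma Borel_base_open (T : base_space) (A : set T) :
  (forall x, A x -> exists2 i, bs_set i x & bs_set i `<=` A) -> Borel T A.
Proof.
move=> Ao; have -> : A = [set x | exists i, bs_set i `<=` A /\ bs_set i x].
  apply/seteqP; split=> [x /Ao [i ix iA]|x [i [iA /iA]]] //.
  by exists i.
apply: sigma_exists => i; apply: sigma_and; first exact: sigma_prop.
exact: Borel_base.
Qed.

Lemma continuous_Borel_fun (S T : base_space) (f : S -> T) :
  base_continuous f -> Borel_fun f.
Proof.
move=> fc; apply: Borel_fun_base => j; apply: Borel_base_open => x /fc [i ix ij].
by exists i.
Qed.

Lemma continuous_fst (S T : base_space) :
  base_continuous (fst : prod_base S T -> S).
Proof.
by move=> [x y] i /= ix; have [j jy] := bs_cover y; exists (i, j) => // z [].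
Qed.

Lemma continuous_snd (S T : base_space) :
  base_continuous (snd : prod_base S T -> T).
Proof.
by move=> [x y] i /= ix; have [j jy] := bs_cover x; exists (j, i) => // z [].
Qed.

Lemma Borel_fun_pair (S T U : base_space) (f : S -> T) (g : S -> U) :
  Borel_fun f -> Borel_fun g -> Borel_fun (fun x => (f x, g x) : prod_base T U).
Proof.
move=> fB gB; apply: Borel_fun_base => -[i j] /=.
exact: (sigma_and (fB _ (Borel_base i)) (gB _ (Borel_base j))).
Qed.

Lemma Borel_fun_comp (S T U : base_space) (f : S -> T) (g : T -> U) :
  Borel_fun f -> Borel_fun g -> Borel_fun (fun x => g (f x)).
Proof. by move=> fB gB A /gB/fB. Qed.

(* When [F] lists the preimages of a separating family under a Borel map, this
   is continuity of that map on a comeager set. *)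
Lemma generic_continuity (T : base_space) (I : countType) (F : I -> set T) :
  (forall n, Borel T (F n)) -> exists (E : set T) (K : I -> set (bs_ix T)),
    comeager E /\ forall x n, E x -> (F n x <-> exists2 k, K n k & bs_set k x).
Proof.
move=> FB; have /choice [K KP] := fun n => Borel_baire_property (FB n).
exists [set x | forall n, F n x <-> exists2 k, K n k & bs_set k x], K; split=> //.
exact: comeager_forall KP.
Qed.

Program Definition cantor (I : countType) : base_space :=
  @BaseSpace (I -> bool) (seq (I * bool))
    (fun l => [set y | forall a b, (a, b) \in l -> y a = b]) _ _.
Next Obligation. by move=> I x; exists [::]. Qed.
Next Obligation.
move=> I l l' x lx l'x; exists (l ++ l'); split=> y.
- by move=> b; rewrite mem_cat => /orP[/lx|/l'x].
- by move=> yP a b al; apply: yP; rewrite mem_cat al.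
- by move=> yP a b al; apply: yP; rewrite mem_cat al orbT.
Qed.

Definition cantor_inner (I : countType) (n : nat) (j i : bs_ix (cantor I)) :=
  bs_set j `<=` bs_set i /\
  forall a : I, (pickle a < n)%N -> exists b, (a, b) \in (j : seq (I * bool)).

Lemma cantor_complete (I : countType) : complete_base (@cantor_inner I).
Proof.
split.
- move=> n i x ix.
  pose l := [seq (a, x a) | a <- pmap (@unpickle I) (iota 0 n)].
  have lx : bs_set (l : bs_ix (cantor I)) x by move=> a b /mapP[c _ [-> ->]].
  have [k [kx ki kl]] := bs_inter ix lx.
  exists ((i : seq _) ++ l).
    by move=> a b; rewrite mem_cat => /orP[/ix|/lx].
  split=> [y yP a b al|a an]; first by apply: yP; rewrite mem_cat al.
  exists (x a); rewrite mem_cat; apply/orP; right; apply: map_f.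
  by rewrite mem_pmap; apply/mapP; exists (pickle a); rewrite ?pickleK // mem_iota.
- move=> n i j [ji _] x; have [ix|nix] := pselect (bs_set i x); first by left.
  have nj : ~ bs_set j x by move=> /ji.
  have /existsNP [a /existsNP [b /not_implyP [abj xab]]] := nj.
  right; exists [:: (a, x a)].
    by move=> c d; rewrite inE => /eqP[-> ->].
  move=> y ya /(_ a b abj) yab; apply: xab; rewrite -yab; apply/esym.
  by apply: ya; rewrite inE.
- by move=> n i j k [kj kn] ji; split=> // x /kj/ji.
- move=> s sr s0; have /choice [y yP] := s0.
  have mono m n : (m <= n)%N -> bs_set (s n) `<=` bs_set (s m).
    elim: n => [|n IH]; first by rewrite leqn0 => /eqP ->.
    rewrite leq_eqVlt ltnS => /orP[/eqP -> //|/IH mn] z /(sr n).1; exact: mn.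
  have fix_at (a : I) n (u v : cantor I) : (pickle a < n)%N -> bs_set (s n.+1) u ->
      bs_set (s n.+1) v -> u a = v a.
    by move=> an su sv; have [b ab] := (sr n).2 a an; rewrite (su _ _ ab) (sv _ _ ab).
  (* [s n.+1] decides the coordinates of code below [n], so coordinate [a] is decided from stage
     [(pickle a).+2] on. *)
  pose x (a : I) := y (pickle a).+2 a.
  have xs n : bs_set (s n) x.
    move=> a b abs; rewrite /x.
    have sy : bs_set (s n) (y (maxn n (pickle a).+2)).
      by apply: mono (yP _); exact: leq_maxl.
    rewrite -(sy a b abs); apply: (fix_at a (pickle a).+1) => //.
    by apply: mono (yP _); exact: leq_maxr.
  exists x; split=> // k kx.
  exists (\max_(ab <- (k : seq (I * bool))) (pickle ab.1)).+2 => z sz a b abk.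
  rewrite -(kx a b abk); apply: fix_at sz (xs _); rewrite ltnS.
  exact: (@leq_bigmax_seq _ _ xpredT (fun ab : I * bool => pickle ab.1) (a, b) abk isT).
Qed.

(** * Eventual equality and orbit relations *)

Definition upd (k : nat) (y : cantor (nat * nat)%type) (t : cantor nat) :
  cantor (nat * nat)%type := fun c => if c.1 == k then t c.2 else y c.

Definition slice (k : nat) (y : cantor (nat * nat)%type) : cantor nat :=
  fun n => y (k, n).

Lemma upd_slice k y : upd k y (slice k y) = y.
Proof. by apply/funext => -[m n]; rewrite /upd /=; case: eqP => // ->. Qed.

Lemma slice_upd k y t : slice k (upd k y t) = t.
Proof. by apply/funext => n; rewrite /slice /upd eqxx. Qed.

Lemma upd_upd k y s t : upd k (upd k y s) t = upd k y t.
Proof. by apply/funext => -[m n]; rewrite /upd /=; case: eqP. Qed.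

Definition slice_ix (k : nat) (l : seq ((nat * nat) * bool)) : seq (nat * bool) :=
  [seq (c.1.2, c.2) | c <- l & c.1.1 == k].

Lemma mem_slice_ix k l n b : ((n, b) \in slice_ix k l) = (((k, n), b) \in l).
Proof.
apply/mapP/idP => [[[[m n'] b']]|kl].
  by rewrite mem_filter /= => /andP[/eqP -> ml] [-> ->].
by exists ((k, n), b) => //; rewrite mem_filter /= eqxx.
Qed.

Definition off_ix (k : nat) (l : seq ((nat * nat) * bool)) :
  seq ((nat * nat) * bool) := [seq c <- l | c.1.1 != k].

Lemma upd_in_base k (l : bs_ix (cantor (nat * nat)%type)) y t :
  bs_set l (upd k y t) <->
  bs_set (off_ix k l : bs_ix (cantor (nat * nat)%type)) y /\
  bs_set (slice_ix k l : bs_ix (cantor nat)) t.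
Proof.
split=> [lu|[ly lt] [m n] b mnl]; last first.
  rewrite /upd /=; case: eqP mnl => [->|/eqP mk mnl].
    by rewrite -mem_slice_ix; exact: lt.
  by apply: ly; rewrite mem_filter mk.
split=> [[m n] b|n b].
  rewrite mem_filter /= => /andP[mk /lu <-].
  by rewrite /upd /= (negbTE mk).
by rewrite mem_slice_ix => /lu <-; rewrite /upd eqxx.
Qed.

Lemma off_base k (l : bs_ix (cantor (nat * nat)%type)) : bs_set l `<=`
  bs_set (off_ix k l : bs_ix (cantor (nat * nat)%type)).
Proof. by move=> y ly c b; rewrite mem_filter => /andP[_ /ly]. Qed.

Lemma slice_base k (l : bs_ix (cantor (nat * nat)%type)) y : bs_set l y ->
  bs_set (slice_ix k l : bs_ix (cantor nat)) (slice k y).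
Proof. by move=> ly n b; rewrite mem_slice_ix; exact: ly. Qed.

Lemma upd_continuous k :
  base_continuous (fun z : prod_base (cantor (nat * nat)%type) (cantor nat) =>
    upd k z.1 z.2).
Proof.
move=> [y t] l /= /upd_in_base lyt; exists (off_ix k l, slice_ix k l) => //.
by move=> [y' t'] /= lyt'; apply/upd_in_base.
Qed.

Lemma upd_open k :
  base_open (fun z : prod_base (cantor (nat * nat)%type) (cantor nat) =>
    upd k z.1 z.2).
Proof.
move=> [y t] [l l'] /= [ly lt].
pose l1 := [seq ((k, c.1), c.2) | c <- (l' : seq (nat * bool))].
exists (off_ix k l ++ l1).
  move=> c b; rewrite mem_cat => /orP[|/mapP[[n b'] nl' [-> ->]]]; last first.
    by rewrite /upd /= eqxx; exact: lt.
  rewrite mem_filter => /andP[ck cl]; rewrite /upd (negbTE ck); exact: ly.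
(* The preimage of [y'] gets back the old row [k] of [y] in its first component, since the
   constraints of [l] on that row say nothing about [y']. *)
move=> y' y'l; exists (upd k y' (slice k y), slice k y'); last first.
  by rewrite /= upd_upd upd_slice.
split=> /=.
  apply/upd_in_base; split; last exact: slice_base.
  by move=> c b cl; apply: y'l; rewrite mem_cat cl.
move=> n b nl; apply: y'l; rewrite mem_cat; apply/orP; right.
by apply/mapP; exists (n, b).
Qed.

Lemma slice_continuous k : base_continuous (slice k).
Proof.
move=> y l ly; exists [seq ((k, c.1), c.2) | c <- (l : seq (nat * bool))].
  by move=> c b /mapP[[n b'] nl [-> ->]]; exact: ly.
by move=> y' y'l n b nl; apply: y'l; apply/mapP; exists (n, b).
Qed.

Lemma cantor_point_nowhere_dense (t : cantor nat) : nowhere_dense [set t].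
Proof.
move=> l [x lx]; pose N := (\max_(c <- (l : seq (nat * bool))) c.1).+1.
have lN : forall b, (N, b) \notin (l : seq (nat * bool)).
  move=> b; apply/negP => Nl.
  have := @leq_bigmax_seq _ _ xpredT (fun c : nat * bool => c.1) (N, b) Nl isT.
  by rewrite ltnn.
exists ((N, ~~ t N) :: (l : seq _)).
  split=> [|y yl n b nl]; last by apply: yl; rewrite inE nl orbT.
  exists (fun n => if n == N then ~~ t N else x n) => n b; rewrite inE.
  case: (eqVneq n N) => [->|nN]; last by rewrite xpair_eqE (negbTE nN) => /lx.
  by rewrite (negbTE (lN b)) orbF => /eqP[->].
move=> y yl yt; have : y N = ~~ t N by apply: yl; rewrite inE eqxx.
by rewrite yt; case: (t N).
Qed.

Definition E1 (y y' : cantor (nat * nat)%type) :=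
  exists N, forall n j, (N <= n)%N -> y (n, j) = y' (n, j).

Lemma E1_upd k y t : E1 y (upd k y t).
Proof. by exists k.+1 => n j kn; rewrite /upd /=; case: eqP kn => // ->; rewrite ltnn. Qed.

(** Generic changes of a row must stay generic through infinitely many rounds. [V n.+1] guarantees
    one more change than [V n], by [kuratowski_ulam], and the intersection guarantees all of
    them. *)
Lemma hereditarily_comeager (P : set (cantor (nat * nat)%type)) : comeager P ->
  exists V, [/\ comeager V, V `<=` P &
    forall y k, V y -> comeager [set t | V (upd k y t)]].
Proof.
move=> Pc; pose V := fix V n := if n is n'.+1 then
  [set y | V n' y /\ forall k, comeager [set t | V n' (upd k y t)]] else P.
have Vc n : comeager (V n).
  elim: n => //= n IH; apply: comeager_and => //; apply: comeager_forall => k.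
  have := kuratowski_ulam (meager_preimage (@upd_continuous k) (@upd_open k) IH).
  exact: comeager_sub.
exists [set y | forall n, V n y]; split.
- exact: comeager_forall.
- by move=> y /(_ 0%N).
- by move=> y k Vy; apply: comeager_forall => n; have [_] := Vy n.+1; apply.
Qed.

Section topological_base.
Variables (T : topologicalType) (I : countType) (B : I -> set T).
Hypothesis B_open : forall i, open (B i).
Hypothesis B_nbhs : forall x A, nbhs x A -> exists2 i, B i x & B i `<=` A.

Program Definition topological_base : base_space := @BaseSpace T I B _ _.
Next Obligation. by move=> x; have [i] := B_nbhs (@filterT _ (nbhs x) _); exists i. Qed.
Next Obligation.
move=> i j x ix jx.
have [|k kx kij] := @B_nbhs x (B i `&` B j).
  by apply: filterI; apply: open_nbhs_nbhs.
by exists k; split=> // y /kij [].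
Qed.

Lemma borel_Borel A : borel T A -> Borel topological_base A.
Proof.
move: A; apply: sigma_ind.
- exact: sigma_algebra0.
- move=> A Ao; apply: (@Borel_base_open topological_base) => x Ax.
  by have [|i ix iA] := @B_nbhs x A; [exact: open_nbhs_nbhs|exists i].
- by move=> A; exact: sigma_setC.
- by move=> F; exact: sigma_algebra_bigcup.
Qed.

End topological_base.

Section group_base.
Local Open Scope group_scope.
Variables (G : topologicalGroupType) (I : countType) (B : I -> set G).
Hypothesis B_open : forall i, open (B i).
Hypothesis B_nbhs : forall x A, nbhs x A -> exists2 i, B i x & B i `<=` A.
Let Gb := topological_base B_open B_nbhs.

Lemma mulg_base (x y : G) m : B m (x * y) -> exists i j, [/\ B i x, B j y &
  forall x' y', B i x' -> B j y' -> B m (x' * y')].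
Proof.
move=> mxy; have [|[U V] /= [Ux Vy] UV] := mulg_continuous (x, y) (B m).
  exact: open_nbhs_nbhs.
have [i ix iU] := B_nbhs Ux; have [j jy jV] := B_nbhs Vy.
by exists i, j; split=> // x' y' /iU Ux' /jV Vy'; exact: (UV (x', y')).
Qed.

Lemma invg_base (x : G) m : B m x^-1 ->
  exists2 i, B i x & forall x', B i x' -> B m x'^-1.
Proof.
move=> mx; have [|i ix iP] := @B_nbhs x [set x' | B m x'^-1]; last by exists i.
by apply: invg_continuous; exact: open_nbhs_nbhs.
Qed.

Lemma divg_base (x : G) w : B w 1 -> exists2 i, B i x &
  forall x' y', B i x' -> B i y' -> B w (x' * y'^-1).
Proof.
rewrite -(mulgV x) => /mulg_base [i [j [ix jx ijw]]].
have [j' j'x j'P] := invg_base jx.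
have [k [kx ki kj]] := @bs_inter Gb _ _ _ ix j'x.
by exists k => // x' y' /ki ix' /kj j'y'; apply: ijw => //; exact: j'P.
Qed.

Lemma mulg_continuous_base (g : G) : base_continuous ((fun u => u * g) : Gb -> Gb).
Proof.
by move=> u m /mulg_base [i [j [iu jg ijm]]]; exists i => // v iv; exact: ijm.
Qed.

Lemma mulg_open_base (g : G) : base_open ((fun u => u * g) : Gb -> Gb).
Proof.
move=> u i iu; have : B i (u * g * g^-1) by rewrite mulgK.
move=> /mulg_base [j [j' [jug j'g jj'i]]]; exists j => // v jv.
by exists (v * g^-1); [exact: jj'i|rewrite -mulgA mulVg mulg1].
Qed.

End group_base.

Section E1_orbit.
Local Open Scope group_scope.
Variables (G : topologicalGroupType) (I : countType) (B : I -> set G).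
Hypothesis B_open : forall i, open (B i).
Hypothesis B_nbhs : forall x A, nbhs x A -> exists2 i, B i x & B i `<=` A.
Let Gb := topological_base B_open B_nbhs.
Variable r : nat -> bs_ix Gb -> bs_ix Gb -> Prop.
Hypothesis r_complete : complete_base r.
Variables (X : Type) (SX : set_system X) (O : nat -> set X) (a : G -> X -> X).
Hypothesis O_sep : forall x x', (forall n, O n x <-> O n x') -> x = x'.
Hypothesis a_action : is_action a.
Hypothesis a_borel : forall n,
  prod_algebra (borel G) SX [set gx | O n (a gx.1 gx.2)].
Let Y := cantor (nat * nat)%type.
Let S := cantor nat.
Variable theta : Y -> X.
Hypothesis theta_borel : forall A, SX A -> Borel Y (theta @^-1` A).
Hypothesis theta_red : forall y y', E1 y y' <-> orbit_relation a (theta y) (theta y').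

Let YG := prod_base Y Gb.
(** By [O_sep], the truth values of all [F n] at [(y, u)] determine the point [a u (theta y)]. *)
Let F n : set YG := [set z | O n (a z.2 (theta z.1))].

Let F_Borel n : Borel YG (F n).
Proof.
apply: (sigma_preimage (f := fun z : YG => (z.2, theta z.1)) _ (a_borel n)).
move=> _ [A bA [C SC <-]].
have := continuous_Borel_fun (@continuous_snd Y Gb) (@borel_Borel _ _ _ B_open B_nbhs _ bA).
have := continuous_Borel_fun (@continuous_fst Y Gb) (theta_borel SC).
by move=> h1 h2; exact: (sigma_and h2 h1).
Qed.

Let near w k : set (prod_base Y S) :=
  [set yt | exists h : Gb, B w h /\ a h (theta yt.1) = theta (upd k yt.1 yt.2)].

(** Equality in [X] becomes agreement of all [F n], with the unit of the group inserted on the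
    right-hand side, so [near w k] is the projection along the group of a Borel set. *)
Let near_analytic w k : analytic (near w k).
Proof.
pose YS := prod_base Y S.
pose f (z : prod_base YS Gb) : YG := (z.1.1, z.2).
pose g (z : prod_base YS Gb) : YG := (upd k z.1.1 z.1.2, 1).
have fst_B : Borel_fun (fun z : prod_base YS Gb => z.1).
  exact: continuous_Borel_fun (@continuous_fst _ _).
have snd_B : Borel_fun (fun z : prod_base YS Gb => z.2).
  exact: continuous_Borel_fun (@continuous_snd _ _).
have fB : Borel_fun f.
  have fst2_B := continuous_Borel_fun (@continuous_fst Y S).
  exact: (Borel_fun_pair (Borel_fun_comp fst_B fst2_B) snd_B).
have gB : Borel_fun g.
  have upd_B := continuous_Borel_fun (@upd_continuous k).
  have one_B : Borel_fun (fun=> 1 : Gb) by move=> z A _; exact: sigma_prop.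
  exact: (Borel_fun_pair (Borel_fun_comp fst_B upd_B) (one_B _)).
have -> : near w k = [set yt | exists h : Gb,
    [set z : prod_base YS Gb | B w z.2 /\ forall n, F n (f z) <-> F n (g z)] (yt, h)].
  apply/seteqP; split=> -[y t] [h [wh]] /= hE; exists h; split=> //.
    by move=> n; rewrite /F /= hE a_action.1.
  by apply: O_sep => n; have := hE n; rewrite /F /= a_action.1.
apply: (analytic_projection r_complete).
have rYS : regular_base YS.
  by apply: regular_prod; exact: complete_regular (@cantor_complete _).
have rG := complete_regular r_complete.
apply: (Borel_analytic (regular_prod rYS rG) _).1.
apply: sigma_and; first exact: (snd_B _ (@Borel_base Gb w)).
by apply: sigma_forall => n; apply: sigma_iff; [exact: fB|exact: gB].
Qed.

(** At a good point the new row can be chosen in any prescribed neighbourhood of the old one,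
    generically in an open set, while [theta] is moved by an element of [B w]. *)
Let good w k (y : Y) := forall U : bs_ix S, bs_set U (slice k y) ->
  exists2 U', sub_base U' U & meager [set t : S | bs_set U' t /\ ~ near w k (y, t)].

(* If [near w k] were meager in a box [i] x [slice_ix k i], a generic [y] in [i]
   would have pairwise far translations [h t] of [theta y] to
   [theta (upd k y t)] for generic [t], but [t] ranges over a nonmeager set and
   [h t] over a second countable group. *)
Let near_nonmeager w k (i : bs_ix Y) y0 : B w 1 -> bs_set i y0 ->
  ~ meager (near w k `&` bs_set ((i, slice_ix k i) : bs_ix (prod_base Y S))).
Proof.
move=> w1 iy0 /kuratowski_ulam nm.
set i' : bs_ix S := slice_ix k i in nm *.
pose P (y : Y) := meager [set t : S | near w k (y, t) /\ bs_set i y /\ bs_set i' t].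
have {}nm : comeager P by exact: nm.
have Sb : baire S := complete_baire (@cantor_complete _).
have Yb : baire Y := complete_baire (@cantor_complete _).
have [|y iy Py] := baire_comeager (i := i) Yb _
    (kuratowski_ulam (meager_preimage (@upd_continuous k) (@upd_open k) nm)).
  by exists y0.
have /choice [h hP] t : exists h, a h (theta y) = theta (upd k y t).
  exact/theta_red/E1_upd.
pose fine j := forall x' y', B j x' -> B j y' -> B w (x' * y'^-1).
have i'0 : bs_set i' !=set0 by exists (slice k y); exact: slice_base.
have [j [jf]] : exists j, fine j /\ ~ meager [set t : S | bs_set i' t /\ B j (h t)].
  apply: contrapT => /forallNP nj; apply: (Sb _ i'0).
  apply: (@meager_sub _ [set t : S | exists j, fine j /\ bs_set i' t /\ B j (h t)]).
    by move=> t i't; have [j jt jf] := divg_base B_open B_nbhs (h t) w1; exists j.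
  apply: meager_exists => j; have [jf|njf] := pselect (fine j); last first.
    by apply: meager_sub (@meager0 S) => t [].
  by have /not_andP[//|/contrapT] := nj j; apply: meager_sub => t [].
(* [upd k y s] is a second generic point that differs from [y] only in row [k]. Its section of
   [near] contains every [t] in [i'] with [h t] in [B j], and these [t] form a nonmeager set. *)
move=> jnm; have [s [i's js] Ps] : exists2 s : S, bs_set i' s /\ B j (h s) & P (upd k y s).
  apply: contrapT => nP; apply: jnm; apply: meager_sub Py => s sP Ps.
  by apply: nP; exists s.
apply: jnm; apply: meager_sub Ps => t [i't jt]; split; last first.
  by split=> //; apply/upd_in_base; split=> //; exact: off_base.
exists (h t * (h s)^-1); split; first exact: jf.
by rewrite /= upd_upd -!hP -a_action.2 -mulgA mulVg mulg1.
Qed.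

(** By [near_nonmeager] and [analytic_dichotomy], boxes in which [near w k] is comeager exist close
    to any point paired with its own row [k]; [kuratowski_ulam] passes from such a box to the
    sections over generic [y]. *)
Let good_comeager w k : B w 1 -> comeager (good w k).
Proof.
move=> w1; pose full (ij : bs_ix Y * bs_ix S) :=
  meager (bs_set (ij : bs_ix (prod_base Y S)) `\` near w k).
apply: (@comeager_sub _ [set y |
    (forall ij, full ij -> bs_set ij.1 y ->
       meager [set t : S | bs_set ij.2 t /\ ~ near w k (y, t)]) /\
    (forall U, bs_set U (slice k y) ->
       exists ij, [/\ full ij, bs_set ij.1 y & sub_base ij.2 U])]).
  move=> y [y1 y2] U /y2 [ij [ijf iy jU]]; exists ij.2 => //; exact: y1.
apply: comeager_and; apply: comeager_forall.
  move=> [i j]; have [ijf|nf] := pselect (full (i, j)); last first.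
    by apply: meager_sub (@meager0 Y) => y /= /not_implyP[].
  apply: comeager_sub (kuratowski_ulam ijf) => y ym _ iy.
  by apply: meager_sub ym => t [jt nt].
move=> U; apply: nowhere_dense_meager => i0 i00.
have [[y0 [iy0 Uy0]]|nU] :=
    pselect (exists y0 : Y, bs_set i0 y0 /\ bs_set U (slice k y0)); last first.
  exists i0; first by case: i00 => y iy; exact: sub_base_refl iy.
  by move=> y iy; apply => Uy; case: nU; exists y.
have [i1 i1y0 i1U] := slice_continuous Uy0.
have [i [iy ii0 ii1]] := sub_base_inter iy0 i1y0.
have [[i2 j] [[[y1 t1] [/= i2y jt]] sij] ijf] :=
  analytic_dichotomy (near_analytic w k) (near_nonmeager w1 iy).
exists i2.
  by apply: sub_base_trans ii0; split=> [|z iz]; [exists y1|have [] := sij (z, t1) (conj iz jt)].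
move=> y i2y'; apply => _; exists (i2, j); split=> //; split; first by exists t1.
move=> t j't; have [_ it] := sij (y1, t) (conj i2y j't).
rewrite -(slice_upd k y0 t); apply: i1U; apply: ii1.2.
by apply/upd_in_base; split=> //; exact: off_base.
Qed.

Theorem E1_not_reducible_to_orbit : False.
Proof.
have Sb : baire S := complete_baire (@cantor_complete _).
have Yb : baire Y := complete_baire (@cantor_complete _).
have Gbb : baire Gb := complete_baire r_complete.
(* Both truth values are listed, so that on [E] each of them is decided by open boxes. *)
pose F' (nb : nat * bool) := [set z : YG | F nb.1 z <-> nb.2].
have F'B nb : Borel YG (F' nb).
  by apply: sigma_iff; [exact: F_Borel|exact: sigma_prop].
have [E [K [Ec EK]]] := generic_continuity F'B.
pose C : set Y := [set y | meager [set u : Gb | ~ E (y, u)]].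
have Cc : comeager C := kuratowski_ulam Ec.
have [N Nn CN] := Cc.
(* The limit [z] need not lie in [V]. The last clause lets step [k] enter a base set disjoint from
   [N k], which puts [z] into [C]. *)
pose P := [set y : Y | (forall wk : I * nat, B wk.1 1 -> good wk.1 wk.2 y) /\
  (C y /\ forall n, exists2 i, bs_set i y & forall z, bs_set i z -> ~ N n z)].
have Pc : comeager P.
  apply: comeager_and; last apply: comeager_and => //; apply: comeager_forall.
    move=> [w k]; have [w1|nw1] := pselect (B w 1).
      by apply: comeager_sub (good_comeager k w1) => y gy _.
    by apply: meager_sub (@meager0 Y) => y /= /not_implyP[].
  move=> n; apply: nowhere_dense_meager => i i0; have [j ji jN] := Nn n i i0.
  by exists j => // y jy; apply; exists j.
have [V [Vc VP VV]] := hereditarily_comeager Pc.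
have nil0 : @bs_set Y [::] !=set0 by exists (fun=> true).
have [x _ Vx] := baire_comeager Yb nil0 Vc.
(* A state holds the current point, the accumulated group element, and base sets that confine all
   later points and group elements. *)
pose state := (Y * G * bs_ix Y * bs_ix Gb)%type.
pose pt (s : state) := s.1.1.1; pose el (s : state) := s.1.1.2.
pose cy (s : state) := s.1.2; pose cg (s : state) := s.2.
pose valid (s : state) := [/\ V (pt s), bs_set (cy s) (pt s), bs_set (cg s) (el s) &
  a (el s) (theta x) = theta (pt s)].
pose step k (s s' : state) := [/\ exists2 t, t <> slice k (pt s) & pt s' = upd k (pt s) t,
  bs_set (cy s') `<=` bs_set (cy s), forall z, bs_set (cy s') z -> ~ N k z & r k (cg s') (cg s)].
have next k s : valid s -> exists s', valid s' /\ step k s s'.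
  case: s => [[[y g] L] j] [Vy Ly jg gx]; rewrite /pt /el /cy /cg in Vy Ly jg gx *.
  have {}Ly : bs_set L y := Ly; have {}jg : @bs_set Gb j g := jg; rewrite /= in Vy gx.
  have [j' j'g j'j] := cb_ex r_complete k jg.
  (* Any further factor from [B w] keeps the accumulated element in [j'], which is well inside
     [j]. *)
  have [w [w1 wj']] : exists w, B w 1 /\ forall h, B w h -> B j' (h * g).
    have : B j' (1 * g) by rewrite mul1g.
    by move=> /(mulg_base B_open B_nbhs) [w [m [w1 mg wm]]]; exists w; split=> // h wh; exact: wm.
  have [gy [Cy /(_ k) [i iy iN]]] := VP _ Vy.
  have [L' [L'y L'L L'i]] := bs_inter Ly iy.
  have L'y' := slice_base (k := k) L'y.
  have [U' [[t0 U't0] U'U] U'm] := gy (w, k) w1 _ L'y'.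
  have tc : comeager [set t : S | t <> slice k y].
    apply: meager_sub (nowhere_dense_meager (cantor_point_nowhere_dense (slice k y))).
    by move=> t /contrapT.
  have nc : comeager [set t : S | ~ (bs_set U' t /\ ~ near w k (y, t))].
    by apply: meager_sub U'm => t /contrapT.
  have [t U't [[Vt tn] nt]] := baire_comeager Sb (ex_intro _ t0 U't0)
    (comeager_and (comeager_and (VV y k Vy) tc) nc).
  have [h [wh hy]] : near w k (y, t) by apply: contrapT => nn; apply: nt.
  have L't : bs_set L' (upd k y t).
    by apply/upd_in_base; split; [exact: off_base|exact: U'U].
  exists (upd k y t, h * g, L', j'); split; split=> //=.
  - exact: wj'.
  - by rewrite a_action.2 gx hy.
  - by exists t.
  - by move=> z /L'i /iN.
have /choice [nxt nxtP] : forall ks, exists s', valid ks.2 -> valid s' /\ step ks.1 ks.2 s'.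
  move=> [k s]; have [vs|nv] := pselect (valid s); last by exists s.
  by have [s'] := next k s vs; exists s'.
have [j0 j01] := @bs_cover Gb 1.
pose st := fix st k := if k is k'.+1 then nxt (k', st k') else (x, 1, [::], j0) : state.
have vst k : valid (st k).
  elim: k => [|k IH] /=; last by case: (nxtP (k, st k) IH).
  by split=> //; rewrite a_action.1.
have sst k : step k (st k) (st k.+1) by case: (nxtP (k, st k) (vst k)).
have pt_ge k c : (k <= c.1)%N -> pt (st k) c = x c.
  elim: k => // k IH kc; have [[t _ ->] _ _ _] := sst k.
  by rewrite /upd gtn_eqF // IH // ltnW.
have pt_lt k m c : (c.1 < k)%N -> (k <= m)%N -> pt (st m) c = pt (st k) c.
  move=> ck; elim: m => [|m IH]; first by rewrite leqn0 => /eqP ->.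
  rewrite leq_eqVlt => /orP[/eqP <- //|km]; have [[t _ ->] _ _ _] := sst m.
  by rewrite /upd ltn_eqF ?IH //; exact: leq_trans ck km.
(* Row [c.1] changes only at step [c.1], so it is final from stage [c.1.+1] on. *)
pose z : Y := fun c => pt (st c.1.+1) c.
have zP m c : (c.1 < m)%N -> pt (st m) c = z c by move=> cm; exact: pt_lt.
have cy_mono k m : (k <= m)%N -> bs_set (cy (st m)) `<=` bs_set (cy (st k)).
  elim: m => [|m IH]; first by rewrite leqn0 => /eqP ->.
  rewrite leq_eqVlt => /orP[/eqP <- //|km] y; have [_ + _ _] := sst m.
  by move=> /[apply]; exact: IH.
have z_lim (l : bs_ix Y) : bs_set l z ->
    exists M, forall m, (M <= m)%N -> bs_set l (pt (st m)).
  move=> lz; exists (\max_(c <- (l : seq ((nat * nat) * bool))) c.1.1).+1 => m mM c b cl.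
  have cm : (c.1 < m)%N.
    apply: leq_trans mM; rewrite ltnS.
    exact: (@leq_bigmax_seq _ _ xpredT (fun c : (nat * nat) * bool => c.1.1) (c, b) cl isT).
  by rewrite zP //; exact: lz.
have cyz k : bs_set (cy (st k)) z.
  move=> c b ck; rewrite -(zP (maxn k c.1.+1)) ?leq_maxr //.
  have [_ + _ _] := vst (maxn k c.1.+1).
  by move=> /(cy_mono k _ (leq_maxl _ _)); apply.
have Cz : C z.
  apply: contrapT => /CN [k _]; have [_ _ + _] := sst k; apply; exact: cyz.
have cg_r k : r k (cg (st k.+1)) (cg (st k)) by case: (sst k).
have cg_el k : bs_set (cg (st k)) (el (st k)) by case: (vst k).
have [g [cgg gk]] := cb_lim r_complete cg_r (fun k => ex_intro _ _ (cg_el k)).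
have cg_mono k m : (k <= m)%N -> bs_set (cg (st m)) `<=` bs_set (cg (st k)).
  elim: m => [|m IH]; first by rewrite leqn0 => /eqP ->.
  rewrite leq_eqVlt => /orP[/eqP <- //|km] y; have [_ _ _ rm] := sst m.
  by move=> /(inner_sub (cb_sub r_complete rm)); exact: IH.
have g_lim j : B j g -> exists M, forall m, (M <= m)%N -> B j (el (st m)).
  move=> /gk [M Mj]; exists M => m Mm; apply: Mj; apply: cg_mono Mm _ _.
  by have [] := vst m.
have Ctr h : comeager [set u : Gb | E (x, u * h)].
  have Cx : C x by have [_ []] := VP _ Vx.
  have := meager_preimage (@mulg_continuous_base _ _ _ B_open B_nbhs h)
    (@mulg_open_base _ _ _ B_open B_nbhs h) Cx.
  by apply: meager_sub => u.
have CE k : comeager [set u : Gb | E (pt (st k), u)].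
  by have [/VP [_ []]] := vst k.
(* One [u] is generic over the two limits [z] and [g] and over all stages, so [EK] applies at each
   pair needed below. *)
have [u _ [[uz ug] uk]] := baire_comeager Gbb (ex_intro _ (1 : Gb) j01)
  (comeager_and (comeager_and (Cz : comeager [set u : Gb | E (z, u)]) (Ctr g))
    (comeager_forall (fun k => comeager_and (CE k) (Ctr (el (st k)))))).
have uzg : a u (theta z) = a u (a g (theta x)).
  apply: O_sep => n; rewrite -a_action.2; apply: contrapT => nn.
  pose b : bool := `[< O n (a u (theta z)) >].
  have zb : F' (n, b) (z, u) by rewrite /F' /F /= /b; split=> /asboolP.
  have gb : F' (n, ~~ b) (x, u * g).
    rewrite /F' /F /= /b; split=> [Og|/asboolPn nO]; last first.
      by apply: contrapT => nOg; apply: nn; split.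
    by apply/asboolPn => Oz; apply: nn; split.
  (* Opposite truth values hold on boxes around [(z, u)] and [(x, u * g)]. A late stage provides a
     point in each box, and the action sends both to the same point of [X], a contradiction. *)
  have [[i m] Ki [/= iz mu]] := (EK _ _ uz).1 zb.
  have [[i' m'] Ki' [/= i'x m'ug]] := (EK _ _ ug).1 gb.
  have [p pP] := z_lim _ iz.
  have [p1 [p2 [p1u p2g p12]]] := mulg_base B_open B_nbhs m'ug.
  have [q qP] := g_lim _ p2g.
  have [uk1 uk2] := uk (maxn p q).
  have [_ _ _ e] := vst (maxn p q).
  have : F' (n, b) (pt (st (maxn p q)), u).
    by apply/(EK _ _ uk1).2; exists (i, m) => //; split=> //; apply: pP; exact: leq_maxl.
  have : F' (n, ~~ b) (x, u * el (st (maxn p q))).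
    apply/(EK _ _ uk2).2; exists (i', m') => //; split=> //; apply: p12 => //.
    by apply: qP; exact: leq_maxr.
  rewrite /F' /F /= a_action.2 e => h1 h2; case: (boolP b) => bb.
    by have := h1.1 (h2.2 bb); rewrite bb.
  by have := h2.1 (h1.2 bb); rewrite (negbTE bb).
have : E1 x z.
  apply/theta_red; exists g.
  by rewrite -[RHS]a_action.1 -[LHS]a_action.1 -(mulVg u) !a_action.2 uzg.
move=> [k kP]; have [[t tk ptk] _ _ _] := sst k; apply: tk; apply/funext => n.
have := kP k n (leqnn k); rewrite /z /= ptk {1}/upd eqxx /slice.
by rewrite pt_ge.
Qed.

End E1_orbit.

(** * Complete bases of Polish spaces and of the infinite symmetric group *)

Lemma prod_nbhs_agree (K : nat -> topologicalType) (x : prod_topology K) A :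
  nbhs x A -> exists N, forall x' : prod_topology K,
    (forall n, (n < N)%N -> x' n = x n) -> A x'.
Proof.
pose agree N := [set x' : prod_topology K | forall n, (n < N)%N -> x' n = x n].
have aF : Filter (filter_from setT agree).
  apply: filter_from_filter; first by exists 0%N.
  move=> M N _ _; exists (maxn M N) => // x' x'P; split=> n nN; apply: x'P.
    by rewrite leq_max nN.
  by rewrite leq_max nN orbT.
have ax : filter_from setT agree --> x.
  apply/cvg_sup => n U [?/= [[W oW <-]] /= Wx WU].
  by exists n.+1 => // x' x'P; apply: WU; rewrite /= x'P.
by move=> /ax [N _ NA]; exists N.
Qed.

Lemma ptws_nbhs_agree (K : topologicalType) (x : {ptws nat -> K}) A : nbhs x A ->
  exists N, forall x' : {ptws nat -> K}, (forall n, (n < N)%N -> x' n = x n) -> A x'.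
Proof. exact: (@prod_nbhs_agree (fun=> K)). Qed.

Lemma Sinf_nbhs_agree (s : Sinf) A : nbhs s A -> exists N, forall t : Sinf,
  (forall n, (n < N)%N -> Sinf_fun t n = Sinf_fun s n) -> A t.
Proof.
move=> [?/= [[W oW <-]] /= Ws WA].
have [N NW] := ptws_nbhs_agree (open_nbhs_nbhs (conj oW Ws)).
by exists N => t tN; apply: WA; exact: NW.
Qed.

Definition Sinf_base (l : seq (nat * nat)) : set Sinf :=
  [set s | forall i j, (i, j) \in l -> Sinf_fun s i = j].

Lemma Sinf_base_open l : open (Sinf_base l).
Proof.
rewrite openE => s; elim: l => [_|[i j] l IH sl]; first by apply: filterS filterT.
have : nbhs s (Sinf_base l) by apply: IH => a b ab; apply: sl; rewrite inE ab orbT.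
have := Sinf_near s i; apply: filterS2 => t tsi tl a b; rewrite inE.
by move=> /orP[/eqP[-> ->]|/tl //]; rewrite tsi; apply: sl; rewrite inE eqxx.
Qed.

Lemma Sinf_base_nbhs (s : Sinf) A : nbhs s A ->
  exists2 l, Sinf_base l s & Sinf_base l `<=` A.
Proof.
move=> /Sinf_nbhs_agree [N NA].
exists [seq (n, Sinf_fun s n) | n <- iota 0 N].
  by move=> i j /mapP[n _ [-> ->]].
move=> t tP; apply: NA => n nN; apply: tP; apply/mapP; exists n => //.
by rewrite mem_iota.
Qed.

Definition Sinf_space := topological_base Sinf_base_open Sinf_base_nbhs.

(** Both the image and the preimage of each [m] are decided, because a pointwise limit of
    permutations need not be surjective. *)
Definition Sinf_inner (n : nat) (j i : bs_ix Sinf_space) :=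
  bs_set j `<=` bs_set i /\ forall m, (m < n)%N ->
    exists b c, (m, b) \in (j : seq (nat * nat)) /\ (c, m) \in (j : seq (nat * nat)).

Lemma Sinf_complete : complete_base Sinf_inner.
Proof.
split.
- move=> n i s is'.
  pose l := [seq (m, Sinf_fun s m) | m <- iota 0 n] ++
            [seq (Sinf_invfun s m, m) | m <- iota 0 n].
  have ls : Sinf_base l s.
    move=> a b; rewrite mem_cat => /orP[] /mapP[m _ [-> ->]] //.
    exact: Sinf_funK.
  exists ((i : seq _) ++ l).
    by move=> a b; rewrite mem_cat => /orP[/is'|/ls].
  split=> [t tP a b al|m mn]; first by apply: tP; rewrite mem_cat al.
  exists (Sinf_fun s m), (Sinf_invfun s m); rewrite !mem_cat; split.
    by rewrite (map_f (fun m => (m, Sinf_fun s m))) ?orbT // mem_iota.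
  by rewrite (map_f (fun m => (Sinf_invfun s m, m))) ?orbT // mem_iota.
- move=> n i j [ji _] s; have [|nis] := pselect (bs_set i s); first by left.
  have njs : ~ Sinf_base j s by move=> /ji.
  have /existsNP [a /existsNP [b /not_implyP [abj sab]]] := njs.
  right; exists [:: (a, Sinf_fun s a)].
    by move=> c d; rewrite inE => /eqP[-> ->].
  move=> t ta /(_ a b abj) tab; apply: sab; rewrite -tab; apply/esym.
  by apply: ta; rewrite inE.
- by move=> n i j k [kj kn] ji; split=> // s /kj/ji.
- move=> s sr s0; have /choice [y yP] := s0.
  have mono m n : (m <= n)%N -> bs_set (s n) `<=` bs_set (s m).
    elim: n => [|n IH]; first by rewrite leqn0 => /eqP ->.
    rewrite leq_eqVlt ltnS => /orP[/eqP -> //|/IH mn] z /(sr n).1; exact: mn.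
  have fix_at a n (u v : Sinf) : (a < n)%N -> bs_set (s n.+1) u ->
      bs_set (s n.+1) v ->
      Sinf_fun u a = Sinf_fun v a /\ Sinf_invfun u a = Sinf_invfun v a.
    move=> an su sv; have [b [c [ab ca]]] := (sr n).2 a an.
    rewrite (su _ _ ab) (sv _ _ ab); split=> //.
    by rewrite -{1}(su _ _ ca) -(sv _ _ ca) !Sinf_invfunK.
  have yy a n : (a.+2 <= n)%N ->
      Sinf_fun (y n) a = Sinf_fun (y a.+2) a /\
      Sinf_invfun (y n) a = Sinf_invfun (y a.+2) a.
    move=> an; apply: (fix_at a a.+1) => //; exact: mono (yP _).
  pose f a := Sinf_fun (y a.+2) a; pose g a := Sinf_invfun (y a.+2) a.
  have fg : bijective f.
    exists g => a.
      have [e _] := yy a (maxn a.+2 (f a).+2) (leq_maxl _ _).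
      have [_ e'] := yy (f a) (maxn a.+2 (f a).+2) (leq_maxr _ _).
      by rewrite -[g _]e' -[X in Sinf_invfun _ X]e Sinf_invfunK.
    have [_ e] := yy a (maxn a.+2 (g a).+2) (leq_maxl _ _).
    have [e' _] := yy (g a) (maxn a.+2 (g a).+2) (leq_maxr _ _).
    by rewrite -[f _]e' -[X in Sinf_fun _ X]e Sinf_funK.
  have xs n : bs_set (s n) (Sinf_mk fg).
    move=> a b abs; rewrite -[LHS]/(f a) /f.
    have [<- _] := yy a (maxn n a.+2) (leq_maxr _ _).
    by apply: (mono n _ (leq_maxl _ _)) abs; exact: yP.
  exists (Sinf_mk fg); split=> // k kx.
  exists (\max_(ab <- (k : seq (nat * nat))) ab.1).+2 => z sz a b abk.
  rewrite -(kx a b abk).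
  have ak : (a < (\max_(ab <- (k : seq (nat * nat))) ab.1).+1)%N.
    rewrite ltnS.
    exact: (@leq_bigmax_seq _ _ xpredT (fun ab : nat * nat => ab.1) (a, b) abk isT).
  by case: (fix_at a _ z (Sinf_mk fg) ak sz (xs _)).
Qed.

Section polish.
Local Open Scope ring_scope.
Import Order.TTheory GRing.Theory Num.Theory.
Variables (R : realType) (T : topologicalType).

Lemma polish_complete_base : polish_space R T ->
  exists (B : nat * nat -> set T) (Bo : forall i, open (B i))
    (Bn : forall x A, nbhs x A -> exists2 i, B i x & B i `<=` A)
    (r : nat -> bs_ix (topological_base Bo Bn) -> bs_ix (topological_base Bo Bn) -> Prop),
    complete_base r /\ forall x x', (forall i, B i x <-> B i x') -> x = x'.
Proof.
move=> [[D /countable_injP [c c_inj] D_dense] [M [f [g [fK gK fc gc M_complete]]]]].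
pose d (x y : T) : R := mdist (f x) (f y).
have d_sym x y : d x y = d y x by exact: metric_sym.
have d_tri x y z : d x z <= d x y + d y z by exact: metric_triangle.
have dxx x : d x x = 0 by exact: mdistxx.
have d_nbhs x A : nbhs x A <-> exists2 e, 0 < e & forall y, d x y < e -> A y.
  split=> [xA|[e e0 eA]].
    have : nbhs (f x) (g @^-1` A) by have := gc (f x) A; rewrite fK; apply.
    rewrite -nbhs_ballE; move=> [e /= e0 eA]; exists e => // y xy.
    by rewrite -(fK y); apply: eA; rewrite ballEmdist.
  have : nbhs (f x) (ball (f x) e) by exact: nbhsx_ballx.
  move=> /fc fe; have {}fe : nbhs x (f @^-1` ball (f x) e) by [].
  by apply: filterS fe => y; rewrite /preimage /= ballEmdist; exact: eA.
have near_D x e : 0 < e -> exists2 y, D y & d x y < e.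
  move=> e0; have : nbhs x [set y | d x y < e] by apply/d_nbhs; exists e.
  rewrite nbhsE => -[U [Uo Ux] Ue].
  by have [|y [Uy Dy]] := D_dense U _ Uo; [exists x|exists y => //; exact: Ue].
have small (e : R) : 0 < e -> exists n : nat, n.+1%:R^-1 < e.
  move=> e0; have [n _ nP] := near_infty_natSinv_lt (PosNum e0).
  by exists n; exact: (nP n (leqnn n)).
have inv0 (n : nat) : 0 < n.+1%:R^-1 :> R by rewrite invr_gt0 ltr0n.
(* The index [(c y, n)] names the ball of radius 1/(n+1) about [y] in [D]; an index whose first
   component codes no point gives the empty set. *)
pose B (i : nat * nat) := [set x | exists y, [/\ D y, c y = i.1 & d x y < i.2.+1%:R^-1]].
have B_center y n x : D y -> B (c y, n) x <-> d x y < n.+1%:R^-1.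
  move=> Dy; split=> [[z [Dz]]|xy]; last by exists y.
  by move=> /c_inj; rewrite !inE => /(_ Dz Dy) ->.
have Bo i : open (B i).
  rewrite openE => x [y [Dy yi xy]]; apply/d_nbhs.
  exists (i.2.+1%:R^-1 - d x y); first by rewrite subr_gt0.
  move=> z xz; exists y; split=> //; rewrite (le_lt_trans (d_tri z x y)) //.
  by rewrite d_sym -ltrBrDr.
have Bn x A : nbhs x A -> exists2 i, B i x & B i `<=` A.
  move=> /d_nbhs [e e0 eA]; have [n ne] := small (e / 2) (divr_gt0 e0 (ltr0n _ 2)).
  have [y Dy xy] := near_D x n.+1%:R^-1 (inv0 n); exists (c y, n).
    by exists y.
  move=> z /(B_center _ _ _ Dy) zy; apply: eA.
  rewrite (le_lt_trans (d_tri x y z)) // (splitr e) ltrD //.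
    exact: lt_trans ne.
  by rewrite d_sym; exact: lt_trans ne.
have inv_le (m n : nat) : (m <= n)%N -> n.+1%:R^-1 <= m.+1%:R^-1 :> R.
  by move=> mn; rewrite lef_pV2 ?posrE ?ltr0n // ler_nat ltnS.
pose Tb := topological_base Bo Bn.
exists B, Bo, Bn, (fun n j i => @inner Tb j i /\ (n <= (j : nat * nat).2)%N); split; last first.
  move=> x x' xx'; apply: (can_inj fK); apply: mdist_positivity; apply/eqP.
  rewrite eq_le mdist_ge0 andbT leNgt; apply/negP => xx'0.
  have [|i ix iP] := Bn x [set y | d x y < d x x'].
    by apply/d_nbhs; exists (d x x').
  by have := iP x' ((xx' i).1 ix); rewrite /= ltxx.
split.
- move=> n i x ix; have [e e0 eA] := (d_nbhs _ _).1 (open_nbhs_nbhs (conj (Bo i) ix)).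
  have [N0 N0e] : exists n, n.+1%:R^-1 < e / 4 by apply: small; rewrite divr_gt0.
  pose N := maxn n N0; pose rho : R := N.+1%:R^-1.
  have rho_e : rho < e / 4 by apply: le_lt_trans N0e; apply: inv_le; exact: leq_maxr.
  have [y Dy xy] := near_D x rho (inv0 N).
  exists (c y, N); first by exists y.
  split=> [z|]; last exact: leq_maxl.
  (* Points within [2 * rho] of [y] are within [3 * rho < e] of [x]. Any other point has a base ball
     of radius below [rho / 2] around it that misses the ball of radius [rho] about [y]. *)
  have [zy|yz] := ltP (d z y) (2 * rho).
    by left; apply: eA; have := d_tri x y z; rewrite (d_sym y z); lra.
  have [n' n'P] : exists n, n.+1%:R^-1 < rho / 2 by apply: small; rewrite divr_gt0 // inv0.
  have [y' Dy' zy'] := near_D z n'.+1%:R^-1 (inv0 n').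
  right; exists (c y', n'); first by exists y'.
  move=> w /(B_center _ _ _ Dy') wy' /(B_center _ _ _ Dy) wy.
  have {}wy : d w y < rho by [].
  have := d_tri z y' y; have := d_tri y' w y; rewrite (d_sym y' w) => h1 h2.
  have {}zy' : d z y' < rho / 2 by exact: lt_trans n'P.
  have {}wy' : d w y' < rho / 2 by exact: lt_trans n'P.
  lra.
- by move=> n i j [].
- move=> n i j k [kj nk] ji; split=> // x; case: (kj x) => [/ji|]; first by left.
  by right.
- move=> s sr s0; have /choice [y yP] := s0.
  have mono m n : (m <= n)%N -> B (s n) `<=` B (s m).
    elim: n => [|n IH]; first by rewrite leqn0 => /eqP ->.
    rewrite leq_eqVlt ltnS => /orP[/eqP -> //|/IH mn] z.
    by move=> /(inner_sub (sr n).1); exact: mn.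
  have diam n u v : B (s n.+1) u -> B (s n.+1) v -> d u v < 2 * n.+1%:R^-1.
    move=> [w [Dw sw uw]] /= [w' [Dw' sw' vw]].
    have ww' : w = w' by apply: c_inj; rewrite ?inE // sw sw'.
    have {}uw : d u w < n.+1%:R^-1 := lt_le_trans uw (inv_le _ _ (sr n).2).
    have {}vw : d v w < n.+1%:R^-1 by rewrite ww'; exact: lt_le_trans vw (inv_le _ _ (sr n).2).
    have := d_tri u w v; rewrite (d_sym w v) => uv.
    by set q : R := n.+1%:R^-1 in uw vw *; lra.
  have small2 (e : R) : 0 < e -> exists n : nat, 2 * n.+1%:R^-1 < e.
    move=> e0; have [n] := small (e / 2) (divr_gt0 e0 (ltr0n _ 2)); move=> p; exists n.
    by set q : R := n.+1%:R^-1 in p *; lra.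
  have [|p yp] := M_complete ((fun n => f (y n)) @ \oo) _.
    apply: cauchy_exP => e /small2 [n ne]; exists (f (y n.+1)), n.+1 => // m nm /=.
    rewrite ballEmdist /=; apply: lt_trans ne; apply: diam; first exact: yP.
    exact: mono nm _ (yP m).
  pose x := g p.
  have yx e : 0 < e -> exists N, forall n, (N <= n)%N -> d x (y n) < e.
    move=> e0; have [N _ NP] := yp _ (nbhsx_ballx p e e0); exists N => n /NP /=.
    by rewrite ballEmdist /d /x gK.
  exists x; split=> [n|k kx].
    (* [x] is a limit of points of [B (s n.+1)], whose closure lies in [B (s n)]. *)
    case: ((sr n).1 x) => // -[m mx mP].
    have [e e0 em] := (d_nbhs _ _).1 (open_nbhs_nbhs (conj (Bo m) mx)).
    have [N NP] := yx e e0; have := mP (y (maxn N n.+1)); case.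
      by apply: em; apply: NP; exact: leq_maxl.
    by apply: (mono _ _ (leq_maxr _ _)); exact: yP.
  have [e e0 em] := (d_nbhs _ _).1 (open_nbhs_nbhs (conj (Bo k) kx)).
  have [n ne] := small2 (e / 2) (divr_gt0 e0 (ltr0n _ 2)).
  have [N NP] := yx (e / 2) (divr_gt0 e0 (ltr0n _ 2)).
  exists n.+1 => z zn; apply: em; rewrite (splitr e).
  rewrite (le_lt_trans (d_tri x (y (maxn N n.+1)) z)) // ltrD ?NP ?leq_maxl //.
  apply: lt_trans ne; apply: diam => //.
  by apply: (mono _ _ (leq_maxr _ _)); exact: yP.
Qed.

End polish.

(** * Eventual equality as bounded distance *)

Section E1_ell_infty.
Local Open Scope ring_scope.
Import Order.TTheory GRing.Theory Num.Theory.
Variable R : realType.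

(* Scaling the n-th row by n turns equality from some row on into bounded
   distance. *)
Definition scaled_rows (y : cantor (nat * nat)%type) : {ptws nat -> R} :=
  fun m => if @unpickle (nat * nat)%type m is Some c then
    (if y c then c.1%:R else 0) else 0.

Lemma scaled_rows_Borel A : borel {ptws nat -> R} A ->
  Borel (cantor (nat * nat)%type) (scaled_rows @^-1` A).
Proof.
apply: sigma_preimage => U Uo; apply: Borel_base_open => y Uy.
have [N NU] := ptws_nbhs_agree (open_nbhs_nbhs (conj Uo Uy)).
exists [seq (c, y c) | c <- pmap (@unpickle (nat * nat)%type) (iota 0 N)].
  by move=> c b /mapP[c' _ [-> ->]].
move=> y' y'P; apply: NU => n nN; rewrite /scaled_rows.
case E: unpickle => [c|//]; rewrite (y'P c (y c)) //.
apply: (map_f (fun c => (c, y c))); rewrite mem_pmap; apply/mapP; exists n => //.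
by rewrite mem_iota.
Qed.

Lemma scaled_rows_E1 y y' :
  E1 y y' <-> ell_infty (scaled_rows y) (scaled_rows y').
Proof.
split=> [[N NP]|[M MP]].
  exists N.+1%:R => m; rewrite /scaled_rows.
  case: unpickle => [[n j]|] /=; last by rewrite subrr normr0 ltr0n.
  have [Nn|nN] := leqP N n; first by rewrite NP // subrr normr0 ltr0n.
  have nN' : n%:R < N.+1%:R :> R by rewrite ltr_nat ltnS ltnW.
  by case: (y _) (y' _) => [] []; rewrite ?subrr ?subr0 ?sub0r ?normrN ?normr0
    ?ger0_norm ?ltr0n.
have [N MN] : exists N : nat, M < N%:R.
  by exists (Num.bound `|M|); apply: le_lt_trans (ler_norm M) (archi_boundP (normr_ge0 M)).
exists N => n j Nn; apply: contrapT => yy.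
have := MP (pickle (n, j)); rewrite /scaled_rows pickleK /=.
have Mn : M < n%:R by apply: lt_le_trans MN _; rewrite ler_nat.
by case: (y _) (y' _) yy => [] [] //= _;
  rewrite ?subr0 ?sub0r ?normrN ger0_norm // ltNge (ltW Mn).
Qed.

End E1_ell_infty.

Lemma borel_reducible_trans (X Y Z : Type) (SX : set_system X) (SY : set_system Y)
    (SZ : set_system Z) E F H : borel_reducible SX SY E F ->
  borel_reducible SY SZ F H -> borel_reducible SX SZ E H.
Proof.
move=> [f [fB fP]] [g [gB gP]]; exists (g \o f); split=> [B ZB|x x'].
  by apply: (fB (g @^-1` B)); exact: gB.
exact: iff_trans (fP x x') (gP _ _).
Qed.

Theorem ell_infty_not_reducible_to_orbit (R : realType) (G : topologicalGroupType)
    (I : countType) (B : I -> set G) (B_open : forall i, open (B i))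
    (B_nbhs : forall x A, nbhs x A -> exists2 i, B i x & B i `<=` A)
    (r : nat -> bs_ix (topological_base B_open B_nbhs) ->
      bs_ix (topological_base B_open B_nbhs) -> Prop)
    (X : Type) (SX : set_system X) (O : nat -> set X) (a : G -> X -> X) :
  complete_base r -> (forall x x', (forall n, O n x <-> O n x') -> x = x') ->
  is_action a ->
  (forall n, prod_algebra (borel G) SX [set gx | O n (a gx.1 gx.2)]) ->
  ~ borel_reducible (borel {ptws nat -> R}) SX (@ell_infty R) (orbit_relation a).
Proof.
move=> rP Osep aA aB [f [fB fP]].
apply: (E1_not_reducible_to_orbit rP Osep aA aB (theta := f \o @scaled_rows R)).
  by move=> A SA; exact: scaled_rows_Borel (fB _ SA).
by move=> y y'; exact: iff_trans (scaled_rows_E1 R y y') (fP _ _).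
Qed.

Lemma standard_borel_separated (R : realType) (X : Type) (SX : set_system X) :
  standard_borel R SX -> exists O : nat -> set X, (forall n, SX (O n)) /\
    forall x x', (forall n, O n x <-> O n x') -> x = x'.
Proof.
move=> [T [f [/polish_complete_base [B [Bo [_ [_ [_ Bsep]]]]] [g fK _] ->]]].
pose O n := if unpickle n is Some i then f @^-1` B i else set0.
exists O; split=> [n|x x' xx'].
  rewrite /O; case: unpickle => [i|].
    by exists (B i); [exact: sub_sigma_algebra|rewrite setTI].
  by exists set0; [exact: sigma_algebra0|rewrite preimage_set0 setI0].
apply: (can_inj fK); apply: Bsep => i.
by have := xx' (pickle i); rewrite /O pickleK.
Qed.

Theorem ell_infty_not_reducible_to_polish_orbit (R : realType)
    (G : topologicalGroupType) (X : Type) (SX : set_system X) (a : G -> X -> X) :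
  polish_space R G -> standard_borel R SX -> is_action a ->
  borel_map (prod_algebra (borel G) SX) SX (fun gx => a gx.1 gx.2) ->
  ~ borel_reducible (borel {ptws nat -> R}) SX (@ell_infty R) (orbit_relation a).
Proof.
move=> /polish_complete_base [B [Bo [Bn [r [rP _]]]]].
move=> /standard_borel_separated [U [SU Usep]] aA aB.
apply: (ell_infty_not_reducible_to_orbit rP Usep aA) => n.
exact: aB _ (SU n).
Qed.

(** * Graph isomorphism as an orbit relation *)

Section graph_isomorphism.
Local Open Scope group_scope.

(** The inverse turns precomposition into a left action. *)
Definition relabel (s : Sinf) (r : {ptws nat * nat -> bool}) :
  {ptws nat * nat -> bool} := fun ij => r (Sinf_invfun s ij.1, Sinf_invfun s ij.2).

Lemma relabel_graph s (r : graphs) : relabel s (set_val r) \in graphs.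
Proof.
case: r => r rP; apply/mem_set; rewrite /set_val /=.
by have [rC rI] := set_mem rP; split=> *; [exact: rC|exact: rI].
Qed.

Definition graph_act (s : Sinf) (r : graphs) : graphs :=
  exist _ (relabel s (set_val r)) (relabel_graph s r).

Lemma graph_actE s r i j : set_val (graph_act s r) (i, j) =
  set_val r (Sinf_invfun s i, Sinf_invfun s j).
Proof. by []. Qed.

Lemma Sinf_invfun_one n : Sinf_invfun 1 n = n.
Proof. exact: (Sinf_funK 1). Qed.

Lemma Sinf_invfun_mul s t n :
  Sinf_invfun (s * t) n = Sinf_invfun t (Sinf_invfun s n).
Proof.
apply: (can_inj (Sinf_invfunK (s * t))); rewrite Sinf_funK.
by rewrite -[RHS]/(Sinf_fun s (Sinf_fun t _)) !Sinf_funK.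
Qed.

Lemma graph_act_action : is_action graph_act.
Proof.
split=> [r|g h r]; apply: val_inj; apply/funext => -[i j] /=; rewrite /relabel /=.
  by rewrite !Sinf_invfun_one.
by rewrite !Sinf_invfun_mul.
Qed.

Lemma GI_orbit r r' : GI r r' <-> orbit_relation graph_act r r'.
Proof.
split=> [[s sb sP]|[s <-]]; last first.
  by exists (Sinf_fun s); [exact: Sinf_funP|move=> i j; rewrite graph_actE !Sinf_invfunK].
exists (Sinf_mk sb); apply: val_inj; apply/funext => -[i j].
rewrite -[LHS]/(set_val _ _) graph_actE sP.
congr (set_val r' (_, _)); exact: (Sinf_funK (Sinf_mk sb)).
Qed.

Definition edge (ij : nat * nat) (r : graphs) : bool := set_val r ij.

Lemma edge_borel ij : borel graphs [set r | edge ij r].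
Proof.
apply: sub_sigma_algebra; have ec : continuous (edge ij).
  move=> r; apply: (@continuous_comp _ {ptws nat * nat -> bool} bool
    (@set_val _ graphs) (fun g => g ij)); first exact: initial_continuous.
  exact: (@proj_continuous (nat * nat)%type (fun=> bool) ij).
rewrite openE => r re; apply: (ec r [set b | b]).
by rewrite nbhs_principalE; apply/principal_filterP.
Qed.

Theorem ell_infty_not_reducible_to_GI (R : realType) :
  ~ borel_reducible (borel {ptws nat -> R}) (borel graphs) (@ell_infty R) GI.
Proof.
move=> [f [fB fP]].
pose U n : set graphs := if @unpickle (nat * nat)%type n is Some ij then
  [set r | edge ij r] else set0.
apply: (ell_infty_not_reducible_to_orbit (R := R) (SX := borel graphs) (O := U)
    Sinf_complete _ graph_act_action).
- move=> x x' xx'; apply: val_inj; apply/funext => ij.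
  have := xx' (pickle ij); rewrite /U pickleK.
  by move=> h; apply/idP/idP => /h.
- move=> n; rewrite /U; case: unpickle => [[i j]|]; last exact: sigma_prop.
  (* Guessing the preimages [kl] of [i] and [j] writes the set as a countable union of
     rectangles. *)
  have -> : [set gx : Sinf * graphs | [set r | edge (i, j) r] (graph_act gx.1 gx.2)] =
      [set gx | exists kl : nat * nat, (Sinf_fun gx.1 kl.1 = i /\ Sinf_fun gx.1 kl.2 = j)
        /\ edge kl gx.2].
    apply/seteqP; split=> -[s r]; rewrite /edge /=.
      rewrite graph_actE => rij.
      by exists (Sinf_invfun s i, Sinf_invfun s j); rewrite !Sinf_funK.
    by move=> [[k l] [[<- <-] rkl]]; rewrite graph_actE !Sinf_invfunK.
  apply: sigma_exists => -[k l]; apply: sub_sigma_algebra.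
  exists [set s | Sinf_fun s k = i /\ Sinf_fun s l = j].
    apply: sub_sigma_algebra.
    have -> : [set s : Sinf | Sinf_fun s k = i /\ Sinf_fun s l = j] =
        Sinf_base [:: (k, i); (l, j)].
      apply/seteqP; split=> s /=; last first.
        by move=> sP; split; apply: sP; rewrite !inE eqxx ?orbT.
      by move=> [sk sl] a b; rewrite !inE => /orP[] /eqP[-> ->].
    exact: Sinf_base_open.
  exists [set r | edge (k, l) r]; first exact: edge_borel.
  by apply/seteqP; split=> -[].
- by exists f; split=> // x x'; exact: iff_trans (fP x x') (GI_orbit _ _).
Qed.

End graph_isomorphism.

(** * Procountable subgroups and the Effros Borel structure *)

Section continuity_into_Sinf.
Variables (T : topologicalType) (A : set T) (f : T -> Sinf).

Lemma Sinf_within_continuous :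
  (forall x k, A x ->
    \forall y \near x, A y -> Sinf_fun (f y) k = Sinf_fun (f x) k) ->
  {within A, continuous f}.
Proof.
move=> fP; apply/subspace_continuousP => x Ax U /Sinf_nbhs_agree [N NU].
suff : \forall y \near x, A y -> forall k, (k < N)%N -> Sinf_fun (f y) k = Sinf_fun (f x) k.
  by apply: filterS => y yP Ay; apply: NU => k; exact: yP.
elim: N {NU} => [|N IH]; first by near=> y.
have := fP x N Ax; move: IH; apply: filterS2 => y y1 y2 Ay k.
by rewrite ltnS leq_eqVlt => /orP[/eqP ->|]; [exact: y2|exact: y1].
Unshelve. all: by end_near.
Qed.

Lemma within_continuous_Sinf x k : {within A, continuous f} -> A x ->
  \forall y \near x, A y -> Sinf_fun (f y) k = Sinf_fun (f x) k.
Proof.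
move=> /subspace_continuousP fc Ax; exact: (fc x Ax _ (Sinf_near (f x) k)).
Qed.

End continuity_into_Sinf.

Section subgroup_type.
Local Open Scope group_scope.
Variables (G : groupType) (H : set G) (HG : is_subgroup H).

Definition subgroup_type of is_subgroup H : Type := set_type H.
Local Notation sG := (subgroup_type HG).

HB.instance Definition _ := Choice.copy sG (set_type H).

Definition sub_el (x : sG) : G := set_val x.

Lemma sub_elP (x : sG) : H (sub_el x).
Proof. by case: x => x xH; exact: set_mem xH. Qed.

Definition sub_mk (x : G) (Hx : H x) : sG := exist _ x (mem_set Hx).

Lemma sub_eq (x y : sG) : sub_el x = sub_el y -> x = y.
Proof. exact: val_inj. Qed.

Definition sub_one : sG := sub_mk (let: And3 H1 _ _ := HG in H1).
Definition sub_mul (x y : sG) : sG :=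
  sub_mk (let: And3 _ HM _ := HG in HM _ _ (sub_elP x) (sub_elP y)).
Definition sub_inv (x : sG) : sG :=
  sub_mk (let: And3 _ _ HV := HG in HV _ (sub_elP x)).

Lemma sub_mulA : associative sub_mul.
Proof. by move=> x y z; apply: sub_eq; exact: mulgA. Qed.
Lemma sub_mul1g : left_id sub_one sub_mul.
Proof. by move=> x; apply: sub_eq; exact: mul1g. Qed.
Lemma sub_mulg1 : right_id sub_one sub_mul.
Proof. by move=> x; apply: sub_eq; exact: mulg1. Qed.
Lemma sub_mulVg : left_inverse sub_one sub_inv sub_mul.
Proof. by move=> x; apply: sub_eq; exact: mulVg. Qed.
Lemma sub_mulgV : right_inverse sub_one sub_inv sub_mul.
Proof. by move=> x; apply: sub_eq; exact: mulgV. Qed.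

HB.instance Definition _ := isGroup.Build sG
  sub_mulA sub_mul1g sub_mulg1 sub_mulVg sub_mulgV.

End subgroup_type.

Section procountable.
Local Open Scope group_scope.

(** Equivalently, [h^-1 * g * h] fixes [i] for all [h]: the normal core of the stabilizer of [i] in
    [H] contains the pointwise stabilizer of the numbers below [m], so it is open. Thus [H] has a
    neighbourhood base at 1 of open normal subgroups. *)
Definition conj_small (H : set Sinf) := forall i, exists m, forall g h, H g -> H h ->
  (forall j, (j < m)%N -> Sinf_fun g j = j) ->
  Sinf_fun g (Sinf_fun h i) = Sinf_fun h i.

(** The kernels of the projections to the [A N] are open normal subgroups forming a base at 1.
    Continuity of [g] chooses [N], continuity of [f] chooses [m], and normality takes care of the
    conjugation by [h]. *)
Lemma procountable_conj_small (H : set Sinf) :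
  is_subgroup H -> procountable H -> conj_small H.
Proof.
move=> [H1 HM HV] [A [p [_ pM _ [f [g [[fL gH] [fK gK] fM fc gc]]]]]] i.
have f1 : f 1 = 1.
  apply: prod_group_eq => n; have := fM 1 1 H1 H1; rewrite mulg1.
  move=> /(congr1 (fun x : prod_group _ => x n)) e.
  by apply: (mulgI (f 1 n)); rewrite mulg1 {3}e.
have p1 n : p n 1 = 1.
  by apply: (mulgI (p n 1)); rewrite -pM !mulg1.
have g1 : g 1 = 1 by rewrite -f1 fK.
have L1 : inverse_limit p 1 by move=> n; exact: p1.
have L_triv y N n : inverse_limit p y -> y N = 1 -> (n <= N)%N -> y n = 1.
  move=> yL; elim: N => [|N IH] yN; first by rewrite leqn0 => /eqP ->.
  rewrite leq_eqVlt => /orP[/eqP -> //|]; apply: IH.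
  by rewrite -(yL N) yN p1.
have [N NP] : exists N, forall y, inverse_limit p y -> y N = 1 -> Sinf_fun (g y) i = i.
  have /prod_nbhs_agree [N NP] := within_continuous_Sinf i gc L1.
  exists N => y yL yN; rewrite (NP y _ yL) ?g1 // => n nN.
  exact: L_triv yL yN (ltnW nN).
have : \forall s \near (1 : Sinf), H s -> f s N = f 1 N.
  have /subspace_continuousP /(_ 1 H1) fc1 := fc.
  apply: (fc1 [set y | y N = f 1 N]); apply: (@proj_continuous nat
    (fun n => discrete_group (A n)) N (f 1) [set f 1 N]).
  exact/principal_filterP.
move=> /Sinf_nbhs_agree [m mP]; exists m => s h Hs Hh sm.
have sN : f s N = 1 by rewrite mP // f1.
have Hhs : H (h^-1 * s * h) := HM _ _ (HM _ _ (HV _ Hh) Hs) Hh.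
have cN : f (h^-1 * s * h) N = 1.
  apply: (mulgI (f h N)); rewrite mulg1.
  have e : f s * f h = f h * f (h^-1 * s * h).
    by rewrite -!fM // !mulgA mulgV mul1g.
  have {}e : f s N * f h N = f h N * f (h^-1 * s * h) N :=
    congr1 (fun x : prod_group _ => x N) e.
  by rewrite -e sN mul1g.
have /(NP _ (fL _ Hhs)) := cN; rewrite fK // => e.
rewrite -[in RHS]e -[RHS]/(Sinf_fun (h * (h^-1 * s * h)) i).
by rewrite !mulgA mulgV mul1g.
Qed.

Section inverse_system.
Variable H : set Sinf.
Hypothesis H_closed : closed H.
Hypothesis H_sub : is_subgroup H.
Hypothesis H_small : conj_small H.
Implicit Types (s t h : Sinf).

Let H1 : H 1. Proof. by case: H_sub. Qed.
Let HM s t : H s -> H t -> H (s * t). Proof. by case: H_sub => _ + _; exact. Qed.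
Let HV s : H s -> H s^-1. Proof. by case: H_sub => _ _; exact. Qed.

Let SfunM s t k : Sinf_fun (s * t) k = Sinf_fun s (Sinf_fun t k).
Proof. by []. Qed.

Let SfunKV s k : Sinf_fun s (Sinf_fun s^-1 k) = k.
Proof. exact: Sinf_funK. Qed.

Let SfunVK s k : Sinf_fun s^-1 (Sinf_fun s k) = k.
Proof. exact: Sinf_invfunK. Qed.

Let Orb n : set nat := [set k | exists h i, [/\ H h, (i < n)%N & k = Sinf_fun h i]].

Let Orb_lt n k : (k < n)%N -> Orb n k. Proof. by exists 1, k. Qed.

Let Orb_le m n : (m <= n)%N -> Orb m `<=` Orb n.
Proof.
by move=> mn _ [h [i [Hh im ->]]]; exists h, i; split=> //; exact: leq_trans mn.
Qed.

Let Orb_H n h k : H h -> Orb n k -> Orb n (Sinf_fun h k).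
Proof.
move=> Hh [h' [i [Hh' lt_in ->]]]; exists (h * h'), i; split=> //; exact: HM.
Qed.

Let agree n s h := (forall k, Orb n k -> Sinf_fun s k = Sinf_fun h k) /\
  (forall k, ~ Orb n k -> Sinf_fun s k = k).

Let agree_ex n h : H h -> exists s, agree n s h.
Proof.
move=> Hh; pose F (g : Sinf) k := if `[< Orb n k >] then Sinf_fun g k else k.
have FK g : H g -> cancel (F g) (F g^-1).
  move=> Hg k; rewrite /F; case: (asboolP (Orb n k)) => kn.
    by rewrite (asboolT (Orb_H Hg kn)) SfunVK.
  by rewrite (asboolF kn).
have FK' : cancel (F h^-1) (F h) by have := FK _ (HV Hh); rewrite invgK.
exists (Sinf_mk (Bijective (FK _ Hh) FK')).
by split=> k kn; rewrite -[LHS]/(F h k) /F ?(asboolT kn) ?(asboolF kn).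
Qed.

Let agree_mul n s t h h' : H h' -> agree n s h -> agree n t h' -> agree n (s * t) (h * h').
Proof.
move=> Hh' [sh sn] [th tn]; split=> k kn; rewrite !SfunM.
  by rewrite th // sh //; exact: Orb_H.
by rewrite tn // sn.
Qed.

Let agree_inv n s h : H h -> agree n s h -> agree n s^-1 h^-1.
Proof.
move=> Hh [sh sn]; split=> k kn; apply: (can_inj (SfunVK s)); rewrite SfunKV.
  by rewrite sh ?SfunKV //; exact: Orb_H (HV Hh) kn.
by rewrite sn.
Qed.

Let K n : set Sinf := [set s | exists2 h, H h & agree n s h].

Let K_sub n : is_subgroup (K n).
Proof.
split=> [|s t [h Hh sh] [h' Hh' th']|s [h Hh sh]].
- by exists 1.
- by exists (h * h'); [exact: HM|exact: agree_mul].
- by exists h^-1; [exact: HV|exact: agree_inv].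
Qed.

(* [A n] consists of the permutations induced by [H] on [Orb n], extended by the
   identity. *)
Let A n : groupType := subgroup_type (K_sub n).

Let A_fun n (x : A n) k := Sinf_fun (sub_el x) k.

Let A_eq n (x y : A n) : (forall k, Orb n k -> A_fun x k = A_fun y k) -> x = y.
Proof.
move=> xy; apply: sub_eq; apply: Sinf_eq => k.
have [/xy//|kn] := pselect (Orb n k).
have [h _ [_ xn]] := sub_elP x; have [h' _ [_ yn]] := sub_elP y.
by rewrite xn // yn.
Qed.

Let A_Orb n (x : A n) k : Orb n k -> Orb n (A_fun x k).
Proof.
by move=> kn; have [h Hh [xh _]] := sub_elP x; rewrite /A_fun xh //; exact: Orb_H.
Qed.

Let A_of n h : H h -> exists x : A n, forall k, Orb n k -> A_fun x k = Sinf_fun h k.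
Proof.
move=> Hh; have [s sh] := agree_ex n Hh.
have sK : K n s by exists h.
by exists (sub_mk (K_sub n) sK) => k kn; rewrite /A_fun /=; case: sh => + _; apply.
Qed.

Let p_ex n (x : A n.+1) : exists y : A n, forall k, Orb n k -> A_fun y k = A_fun x k.
Proof.
have [h Hh [xh _]] := sub_elP x; have [y yP] := A_of n Hh.
by exists y => k kn; rewrite yP // /A_fun xh //; exact: Orb_le (leqnSn n) _ kn.
Qed.

Let p n (x : A n.+1) : A n := projT1 (cid (p_ex x)).

Let pP n (x : A n.+1) k : Orb n k -> A_fun (p x) k = A_fun x k.
Proof. by rewrite /p; case: cid => y; apply. Qed.

Let rho_ex n h : exists x : A n, H h -> forall k, Orb n k -> A_fun x k = Sinf_fun h k.
Proof.
by have [/(A_of n) [x xh]|nh] := pselect (H h); [exists x|exists 1].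
Qed.

Let rho (h : Sinf) : prod_group (fun n => discrete_group (A n)) :=
  fun n => projT1 (cid (rho_ex n h)).

Let rhoP h n k : H h -> Orb n k -> A_fun (rho h n : A n) k = Sinf_fun h k.
Proof. by rewrite /rho; case: cid => x xh /xh; apply. Qed.

Let orb_bound n : exists m, forall i, (i < n)%N -> forall g h, H g -> H h ->
  (forall j, (j < m)%N -> Sinf_fun g j = j) ->
  Sinf_fun g (Sinf_fun h i) = Sinf_fun h i.
Proof.
elim: n => [|n [m mP]]; first by exists 0%N.
have [m' m'P] := H_small n; exists (maxn m m') => i; rewrite ltnS leq_eqVlt.
move=> /orP[/eqP ->|lt_in] g h Hg Hh gj.
  by apply: m'P => // j jm; apply: gj; rewrite leq_max jm orbT.
by apply: mP => // j jm; apply: gj; rewrite leq_max jm.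
Qed.

(** If lifts of two elements agree below [m], their quotient fixes all numbers below [m], hence all
    of [Orb n] by [orb_bound]. So [m] values determine an element. *)
Let A_countable n : countable [set: A n].
Proof.
have [m mP] := orb_bound n.
have /choice [lift liftP] : forall x : A n, exists h, H h /\ agree n (sub_el x) h.
  by move=> x; have [h] := sub_elP x; exists h.
apply/countable_injP; exists (fun x => pickle (mkseq (Sinf_fun (lift x)) m)).
move=> x y _ _ /(pcan_inj pickleK) xy.
have [Hx [xP _]] := liftP x; have [Hy [yP _]] := liftP y.
apply: A_eq => k kn; rewrite /A_fun xP // yP //.
have [h [i [Hh lt_in ->]]] := kn.
apply: (can_inj (SfunVK (lift x)^-1)); rewrite SfunVK -SfunM; apply/esym.
apply: (mP i lt_in) => //; first by apply: HM => //; exact: HV.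
move=> j jm; rewrite SfunM; have := congr1 (fun l => nth 0%N l j) xy.
by rewrite !nth_mkseq // => <-; rewrite SfunVK.
Qed.

Let limit_coherent (x : prod_group (fun n => discrete_group (A n))) m n k :
  inverse_limit p x -> (m <= n)%N -> Orb m k ->
  A_fun (x n : A n) k = A_fun (x m : A m) k.
Proof.
move=> xL mn km; elim: n mn => [|n IH]; first by rewrite leqn0 => /eqP <-.
rewrite leq_eqVlt => /orP[/eqP <- //|mn]; rewrite -IH // -(xL n).
by rewrite pP //; exact: Orb_le km.
Qed.

(** A coherent sequence glues to a function on the numbers, the inverse sequence glues to its
    inverse, and closedness of [H] puts the resulting permutation into [H]. *)
Let limit_ex (x : prod_group (fun n => discrete_group (A n))) : exists h,
  inverse_limit p x -> H h /\ forall n k, Orb n k -> A_fun (x n : A n) k = Sinf_fun h k.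
Proof.
have [xL|] := pselect (inverse_limit p x); last by exists 1.
have xL' : inverse_limit p (x^-1).
  move=> n; apply: A_eq => k kn; rewrite pP //.
  have km := Orb_le (leqnSn n) kn.
  apply: (can_inj (SfunVK (sub_el (x n.+1 : A n.+1)))).
  rewrite -[X in X = _]/(Sinf_fun (sub_el _) (Sinf_fun (sub_el (x n.+1 : A n.+1))^-1 k)) SfunKV.
  have kn' : Orb n (A_fun ((x n : A n)^-1) k) by exact: A_Orb.
  rewrite -[X in _ = X]/(A_fun (x n.+1 : A n.+1) (A_fun ((x n : A n)^-1) k)).
  rewrite (limit_coherent xL (leqnSn n) kn').
  by rewrite -[RHS]/(Sinf_fun (sub_el (x n : A n)) (Sinf_fun (sub_el (x n : A n))^-1 k)) SfunKV.
(* Stage [k.+1] is the first at which [k] is certain to belong to [Orb]. *)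
pose F (y : prod_group (fun n => discrete_group (A n))) k := A_fun (y k.+1 : A k.+1) k.
have FE y n k : inverse_limit p y -> (k < n)%N -> F y k = A_fun (y n : A n) k.
  by move=> yL kn; rewrite /F -(limit_coherent yL kn) //; exact: Orb_lt.
have FK y : inverse_limit p y -> inverse_limit p (y^-1) -> cancel (F y) (F y^-1).
  move=> yL yL' k; have [N [kN FN]] : exists N, (k < N)%N /\ (F y k < N)%N.
    by exists (maxn k (F y k)).+1; rewrite !ltnS leq_maxl leq_maxr.
  rewrite (FE _ N _ yL' FN) (FE _ N _ yL kN); exact: SfunVK.
have xFK : cancel (F x^-1) (F x) by have := FK _ xL'; rewrite invgK; apply.
have hE n k : Orb n k -> A_fun (x n : A n) k = F x k.
  move=> kn; rewrite (FE x (maxn n k).+1) ?ltnS ?leq_maxr //.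
  by rewrite (limit_coherent xL _ kn) // (leq_trans (leq_maxl n k)).
exists (Sinf_mk (Bijective (FK _ xL xL') xFK)) => _; split=> // .
apply: H_closed => U /Sinf_nbhs_agree [N NU].
have [h Hh [hN _]] := sub_elP (x N : A N); exists h; split=> //.
apply: NU => k /Orb_lt kN; rewrite -[RHS]/(F x k) -(hE N k kN).
by apply/esym; exact: hN.
Qed.

Let lim x := projT1 (cid (limit_ex x)).

Let limP x : inverse_limit p x ->
  H (lim x) /\ forall n k, Orb n k -> A_fun (x n : A n) k = Sinf_fun (lim x) k.
Proof. by rewrite /lim; case: cid. Qed.

(** [H] is the limit of its actions on the increasing invariant sets [Orb n]. The bound in
    [orb_bound] yields both the countability of the stages and the continuity of [rho]. *)
Lemma conj_small_procountable : procountable H.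
Proof.
exists A, p; split=> [|n x y|n|].
- exact: A_countable.
- apply: A_eq => k kn; rewrite pP //.
  rewrite -[LHS]/(A_fun x (A_fun y k)) -[RHS]/(A_fun (p x) (A_fun (p y) k)).
  by rewrite (pP x (A_Orb (p y) kn)) (pP y kn).
- apply/seteqP; split=> // x _; have [h Hh [xh _]] := sub_elP x.
  have [y yh] := A_of n.+1 Hh; exists y => //; apply: A_eq => k kn.
  by rewrite pP // yh ?/A_fun ?xh //; exact: Orb_le kn.
exists rho, lim.
have rhoL s : H s -> inverse_limit p (rho s).
  move=> Hs n; apply: A_eq => k kn; rewrite pP // !rhoP //.
  exact: Orb_le kn.
split.
- by split=> // x /limP [].
- split=> [s Hs|x xL].
    have [_ sP] := limP (rhoL _ Hs); apply: Sinf_eq => k.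
    by rewrite -(sP k.+1) ?rhoP //; exact: Orb_lt.
  have [Hx xP] := limP xL; apply: prod_group_eq => n; apply: A_eq => k kn.
  by rewrite rhoP // xP.
- move=> s t Hs Ht; apply: prod_group_eq => n; apply: A_eq => k kn.
  rewrite rhoP //; last exact: HM.
  rewrite -[RHS]/(A_fun (rho s n : A n) (A_fun (rho t n : A n) k)).
  by rewrite !rhoP //; exact: Orb_H.
- apply: prod_continuous => n; apply/subspace_continuousP => s Hs U Us.
  have {}Us : U (rho s n) by exact: nbhs_singleton Us.
  have [m mP] := orb_bound n.
  apply: filterS (open_nbhs_nbhs (conj (Sinf_base_open
    [seq (j, Sinf_fun s j) | j <- iota 0 m]) _)); last first.
    by move=> i j /mapP[c _ [-> ->]].
  move=> t tP Ht; suff e : rho t n = rho s n by rewrite -e in Us.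
  apply: A_eq => _ [h [i [Hh lt_in ->]]].
  have ki : Orb n (Sinf_fun h i) by exists h, i.
  rewrite !rhoP //; apply: (can_inj (SfunVK s^-1)); rewrite SfunVK -SfunM.
  apply: (mP i lt_in) => //; first by apply: HM => //; exact: HV.
  move=> j jm; rewrite SfunM (tP j (Sinf_fun s j)) ?SfunVK //.
  by apply: (map_f (fun j => (j, Sinf_fun s j))); rewrite mem_iota.
- apply: Sinf_within_continuous => x k xL; have [Hx xP] := limP xL.
  have : \forall y \near x, y k.+1 = x k.+1.
    apply: (@proj_continuous nat (fun n => discrete_group (A n)) k.+1 x [set x k.+1]).
    exact/principal_filterP.
  apply: filterS => y yx yL; have [_ yP] := limP yL.
  have kk := Orb_lt (ltnSn k).
  exact: etrans (esym (yP _ _ kk)) (etrans (congr1 (fun z : A k.+1 => A_fun z k) yx) (xP _ _ kk)).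
Qed.

End inverse_system.

End procountable.

Lemma procountableP (H : closed_subgroup Sinf) :
  procountable (sval H) <-> conj_small (sval H).
Proof.
case: H => H [Hc Hs]; split=> /=; first exact: procountable_conj_small.
exact: conj_small_procountable.
Qed.

Section nilpotent.
Local Open Scope group_scope.
Variables (G : groupType) (H : set G).

Lemma generated_subgroup_trivial (A : set G) :
  generated_subgroup A = [set 1] <-> (forall x, A x -> x = 1).
Proof.
split=> [A1 x Ax|A1].
  have : generated_subgroup A x by move=> K [_]; apply.
  by rewrite A1.
apply/seteqP; split=> [x|_ ->]; last by move=> K [[]].
move=> /(_ [set 1]); apply; split; last exact: A1.
by split=> // [_ _ -> ->|_ ->]; rewrite /= ?mulg1 ?invg1.
Qed.

Lemma nilpotent_class_le2P : is_subgroup H ->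
  nilpotent_class_le 2 H <->
  (forall x y z, H x -> H y -> H z -> [~ [~ x, y], z] = 1).
Proof.
move=> [H1 HM HV]; apply: (iff_trans (generated_subgroup_trivial _)).
split=> [nil x y z Hx Hy Hz|nil _ [c Hc [z Hz <-]]].
  apply: nil; exists [~ x, y]; last by exists z.
  by move=> K [_]; apply; exists x => //; exists y.
(* The centralizer of [z] is a subgroup containing all commutators, hence the subgroup they
   generate. *)
apply/eqP/commgP; apply: (Hc [set c | commute c z]); split.
  split=> /= [|u v uz vz|u uz]; first exact/commute_sym/commute1.
    by apply/commute_sym/commuteM; exact/commute_sym.
  by apply/commute_sym/commuteV; exact/commute_sym.
by move=> _ [x Hx [y Hy <-]]; apply/commgP/eqP; exact: nil.
Qed.

End nilpotent.

(** * The class is measurable in the Effros structure *)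

Section effros_class.
Local Open Scope group_scope.

(** A closed [C] contains all triples from [H] iff no basic box disjoint from [C] has all three
    sides meeting [H]; there are countably many such boxes. *)
Lemma effros_forall3 (C : set (Sinf * Sinf * Sinf)) : closed C ->
  effros Sinf [set H | forall x y z, sval H x -> sval H y -> sval H z -> C (x, y, z)].
Proof.
move=> Cc; pose bad (ijk : seq (nat * nat) * seq (nat * nat) * seq (nat * nat)) :=
  forall x y z, Sinf_base ijk.1.1 x -> Sinf_base ijk.1.2 y -> Sinf_base ijk.2 z ->
    ~ C (x, y, z).
pose meets i : set (closed_subgroup Sinf) := [set H | sval H `&` Sinf_base i !=set0].
have meetsE i : effros Sinf (meets i).
  by apply: sub_sigma_algebra; exists (Sinf_base i) => //; exact: Sinf_base_open.
have -> : [set H : closed_subgroup Sinf |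
      forall x y z, sval H x -> sval H y -> sval H z -> C (x, y, z)] =
    [set H | forall ijk, bad ijk -> ~ (meets ijk.1.1 H /\ (meets ijk.1.2 H /\ meets ijk.2 H))].
  apply/seteqP; split=> H HP.
    move=> ijk ijkb [[x [Hx ix]] [[y [Hy iy]] [z [Hz iz]]]].
    by apply: (ijkb x y z) => //; exact: HP.
  move=> x y z Hx Hy Hz; apply: contrapT => nC.
  have oC : open (~` C) by rewrite openC.
  have : nbhs ((x, y, z) : Sinf * Sinf * Sinf) (~` C) := open_nbhs_nbhs (conj oC nC).
  move=> [[UV W] /= [[[U V] /= [Ux Vy] UVs] Wz] UVW].
  have [i ix iU] := Sinf_base_nbhs Ux; have [j jy jV] := Sinf_base_nbhs Vy.
  have [k kz kW] := Sinf_base_nbhs Wz.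
  apply: (HP (i, j, k)) => /=; last by split; [exists x|split; [exists y|exists z]].
  move=> x' y' z' ix' jy' kz' /=; apply: (UVW (x', y', z')); split=> /=.
    by apply: (UVs (x', y')); split; [exact: iU|exact: jV].
  exact: kW.
apply: sigma_forall => ijk; apply: sigma_imp; first exact: sigma_prop.
exact: (sigma_not (sigma_and (meetsE _) (sigma_and (meetsE _) (meetsE _)))).
Qed.

Lemma mulg_continuous_fun (T : topologicalType) (f g : T -> Sinf) :
  continuous f -> continuous g -> continuous (fun x => f x * g x).
Proof.
move=> fc gc x; apply: (@continuous_comp _ (Sinf * Sinf)%type _
  (fun x => (f x, g x)) (fun y => y.1 * y.2)); last exact: mulg_continuous.
exact: (cvg_pair (fc x) (gc x)).
Qed.

Lemma invg_continuous_fun (T : topologicalType) (f : T -> Sinf) :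
  continuous f -> continuous (fun x => (f x)^-1).
Proof.
move=> fc x; apply: (@continuous_comp _ Sinf _ f (fun y => y^-1)); first exact: fc.
exact: invg_continuous.
Qed.

Lemma commg_continuous_fun (T : topologicalType) (f g : T -> Sinf) :
  continuous f -> continuous g -> continuous (fun x => [~ f x, g x]).
Proof.
move=> fc gc; apply: mulg_continuous_fun; first exact: invg_continuous_fun.
apply: mulg_continuous_fun; first exact: invg_continuous_fun.
exact: mulg_continuous_fun.
Qed.

Lemma expg_continuous_fun (T : topologicalType) (f : T -> Sinf) n :
  continuous f -> continuous (fun x => f x ^+ n).
Proof.
move=> fc; elim: n => [|n IH]; first by move=> x; exact: cvg_cst.
by under eq_fun do rewrite expgS; exact: mulg_continuous_fun.
Qed.

Lemma Sinf_eval_near (T : topologicalType) (f : T -> Sinf) x n : continuous f ->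
  \forall y \near x, Sinf_fun (f y) n = Sinf_fun (f x) n.
Proof. by move=> fc; exact: (fc x _ (Sinf_near (f x) n)). Qed.

Lemma Sinf_closed_eq1 (T : topologicalType) (f : T -> Sinf) : continuous f ->
  closed [set x | f x = 1].
Proof.
move=> fc; rewrite -openC openE => x /= fx.
have [n fn] : exists n, Sinf_fun (f x) n <> n.
  by apply: contrapT => /forallNP fn; apply: fx; apply: Sinf_eq => n; exact: contrapT.
have := Sinf_eval_near x n fc; apply: filterS => y yx /= f1.
by apply: fn; rewrite -yx f1.
Qed.

Let c1 : continuous (fun t : Sinf * Sinf * Sinf => t.1.1).
Proof.
by move=> t; apply: (@continuous_comp _ _ _ fst fst); exact: cvg_fst.
Qed.

Let c2 : continuous (fun t : Sinf * Sinf * Sinf => t.1.2).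
Proof.
by move=> t; apply: (@continuous_comp _ _ _ fst snd); [exact: cvg_fst|exact: cvg_snd].
Qed.

Let c3 : continuous (fun t : Sinf * Sinf * Sinf => t.2).
Proof. by move=> t; exact: cvg_snd. Qed.

Let effros_exponent m : effros Sinf [set H | forall x, sval H x -> x ^+ m = 1].
Proof.
have := effros_forall3 (Sinf_closed_eq1 (expg_continuous_fun (n := m) c1)).
congr (effros Sinf _); apply/seteqP; split=> H HP x => [Hx|y z Hx _ _].
  exact: (HP x x x Hx Hx Hx).
exact: HP.
Qed.

(** After [procountableP] and [nilpotent_class_le2P] every clause is a countable combination of
    closed conditions on triples from [H]. *)
Theorem nil2_exp_class_effros p : effros Sinf (nil2_exp_class p).
Proof.
have -> : nil2_exp_class p = [set H | conj_small (sval H) /\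
    ((forall x y z, sval H x -> sval H y -> sval H z -> [~ [~ x, y], z] = 1) /\
     ((0 < p)%N /\ ((forall x, sval H x -> x ^+ p = 1) /\
      forall m, ((0 < m)%N /\ forall x, sval H x -> x ^+ m = 1) -> (p <= m)%N)))].
  apply/seteqP; split=> H.
    move=> [/procountableP Hc Hn [p0 Hp pm]]; split=> //; split.
      by apply/nilpotent_class_le2P => //; case: (svalP H).
    by split=> //; split=> // m [m0]; exact: pm.
  move=> [/procountableP Hc [Hn [p0 [Hp pm]]]]; split=> //.
    by apply/nilpotent_class_le2P => //; case: (svalP H).
  by split=> // m m0 Hm; exact: pm.
apply: sigma_and; last (apply: sigma_and; last (apply: sigma_and;
  last (apply: sigma_and; last (apply: sigma_forall => m; apply: sigma_imp)))).
- apply: sigma_forall => i; apply: sigma_exists => m.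
  pose C := [set t : Sinf * Sinf * Sinf | (forall j, (j < m)%N -> Sinf_fun t.1.1 j = j) ->
    Sinf_fun t.1.1 (Sinf_fun t.1.2 i) = Sinf_fun t.1.2 i].
  have Cc : closed C.
    rewrite -openC openE => t /= /not_implyP [tm ti].
    have near_m : \forall u \near t, forall j, (j < m)%N -> Sinf_fun u.1.1 j = j.
      elim: m tm {C ti} => [|m IH] tm; first by apply: filterS filterT.
      have := IH (fun j jm => tm j (ltnW jm)).
      have := Sinf_eval_near t m c1; apply: filterS2 => u um uj j.
      by rewrite ltnS leq_eqVlt => /orP[/eqP ->|/uj //]; rewrite um tm.
    move: near_m; have := Sinf_eval_near t i c2.
    have := Sinf_eval_near t (Sinf_fun t.1.2 i) c1.
    apply: filterS3 => u u1 u2 um /(_ um); rewrite u2 u1; exact: ti.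
  have := effros_forall3 Cc; congr (effros Sinf _).
  apply/seteqP; split=> H HP g h => [Hg Hh|z Hg Hh _]; last exact: HP.
  exact: (HP g h g Hg Hh Hg).
- apply: (effros_forall3 (C := [set t | [~ [~ t.1.1, t.1.2], t.2] = 1])).
  apply: Sinf_closed_eq1; apply: commg_continuous_fun => //.
  exact: commg_continuous_fun.
- exact: sigma_prop.
- exact: effros_exponent.
- by apply: sigma_and; [exact: sigma_prop|exact: effros_exponent].
- exact: sigma_prop.
Qed.

End effros_class.

(** * Heisenberg groups *)

(* Upper unitriangular 3x3 matrices: (a, b, c) has a and b above the diagonal
   and c in the corner. *)
Definition heis (K : comNzRingType) : Type := (K * K * K)%type.

HB.instance Definition _ (K : comNzRingType) := Choice.copy (heis K) (K * K * K)%type.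

Section heisenberg.
Import GRing.Theory.
Local Open Scope ring_scope.
Variable K : comNzRingType.
Implicit Types x y : heis K.

Definition heis_one : heis K := (0, 0, 0).
Definition heis_mul x y : heis K :=
  (x.1.1 + y.1.1, x.1.2 + y.1.2, x.2 + y.2 + x.1.1 * y.1.2).
Definition heis_inv x : heis K := (- x.1.1, - x.1.2, - x.2 + x.1.1 * x.1.2).

Lemma heis_mulA : associative heis_mul.
Proof.
move=> [[a b] c] [[a' b'] c'] [[a'' b''] c''].
by rewrite /heis_mul /=; congr (_, _, _); ring.
Qed.
Lemma heis_mul1g : left_id heis_one heis_mul.
Proof. by move=> [[a b] c]; rewrite /heis_mul /=; congr (_, _, _); ring. Qed.
Lemma heis_mulg1 : right_id heis_one heis_mul.
Proof. by move=> [[a b] c]; rewrite /heis_mul /=; congr (_, _, _); ring. Qed.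
Lemma heis_mulVg : left_inverse heis_one heis_inv heis_mul.
Proof. by move=> [[a b] c]; rewrite /heis_mul /heis_one /=; congr (_, _, _); ring. Qed.
Lemma heis_mulgV : right_inverse heis_one heis_inv heis_mul.
Proof. by move=> [[a b] c]; rewrite /heis_mul /heis_one /=; congr (_, _, _); ring. Qed.

HB.instance Definition _ := isGroup.Build (heis K)
  heis_mulA heis_mul1g heis_mulg1 heis_mulVg heis_mulgV.

Lemma heis_mulE x y : (x * y)%g =
  (x.1.1 + y.1.1, x.1.2 + y.1.2, x.2 + y.2 + x.1.1 * y.1.2) :> heis K.
Proof. by []. Qed.

Lemma heis_commg x y : [~ x, y]%g =
  (0, 0, x.1.1 * y.1.2 - y.1.1 * x.1.2) :> heis K.
Proof.
apply: (@mulgI _ (y * x)%g); rewrite -commgC.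
case: x y => [[a b] c] [[a' b'] c']; rewrite !heis_mulE /=.
by congr (_, _, _); ring.
Qed.

Lemma heis_commg_corner a b :
  [~ ((a, 0, 0) : heis K), ((0, b, 0) : heis K)]%g = (0, 0, a * b).
Proof. by rewrite heis_commg /= mul0r subr0. Qed.

Lemma heis_nil2 x y z : [~ [~ x, y], z]%g = 1%g.
Proof. by rewrite !heis_commg /= mul0r mulr0 subr0. Qed.

Lemma heis_expg x n : (x ^+ n)%g =
  (x.1.1 *+ n, x.1.2 *+ n, x.2 *+ n + (x.1.1 * x.1.2) *+ 'C(n, 2)) :> heis K.
Proof.
elim: n => [|n IH].
  by rewrite bin0n /= !mulr0n addr0.
rewrite expgS IH heis_mulE /= -!mulrS; congr (_, _, _).
rewrite binS bin1 mulrnDr mulrnAr mulrS; ring.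
Qed.

(** For odd [p] the binomial coefficient 'C(p, 2) is divisible by [p], which kills the corner entry;
    for [p = 2] it equals 1. *)
Lemma heis_exponent p x : prime p -> odd p -> p \in [pchar K] -> (x ^+ p)%g = 1%g.
Proof.
move=> p_prime p_odd pK; rewrite heis_expg !(mulrn_pchar pK) add0r.
suff /dvdnP [q ->] : (p %| 'C(p, 2))%N by rewrite mulrnA (mulrn_pchar pK).
by apply: prime_dvd_bin => //=; case: p p_prime p_odd {pK} => [|[|[|]]].
Qed.

End heisenberg.

Section heisenberg_morphism.
Import GRing.Theory.
Local Open Scope ring_scope.
Variables (K L : finFieldType) (p e f : nat).
Hypotheses (p_prime : prime p) (Kp : #|K| = (p ^ e)%N) (Lp : #|L| = (p ^ f)%N).
Hypotheses (e_gt1 : (1 < e)%N) (ef : coprime e f).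

(* All elements of K would be fixed by the Frobenius powers e and f, hence by
   the Frobenius map itself. *)
Lemma no_field_morphism (mu : K -> L) :
  {morph mu : x y / x + y} -> {morph mu : x y / x * y} -> mu 1 != 0 -> False.
Proof.
move=> muD muM mu1.
have mu0 : mu 0 = 0 by apply: (addrI (mu 0)); rewrite -muD !addr0.
have mu_eq0 x : mu x = 0 -> x = 0.
  move=> mux; apply/eqP; apply: contraNT mu1 => x0.
  by rewrite -(mulfV x0) muM mux mul0r.
have mu_inj : injective mu.
  move=> x y xy; apply/eqP; rewrite -subr_eq0; apply/eqP/mu_eq0.
  apply: (addIr (mu y)); rewrite -muD subrK add0r.
  exact: xy.
have mu1E : mu 1 = 1.
  by apply: (mulfI mu1); rewrite -muM !mulr1.
have muX x n : mu (x ^+ n) = mu x ^+ n.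
  by elim: n => [|n IH]; rewrite ?expr0 // !exprS muM IH.
have xf (x : K) : x ^+ (p ^ f) = x by apply: mu_inj; rewrite muX -Lp finfield.expf_card.
have xe (x : K) : x ^+ (p ^ e) = x by rewrite -Kp finfield.expf_card.
have iterX g : (forall x : K, x ^+ (p ^ g) = x) ->
    forall n x, x ^+ (p ^ (n * g)) = x :> K.
  by move=> xg; elim=> [|n IH] x; rewrite ?mul0n // mulSn expnD exprM xg IH.
have xp (x : K) : x ^+ p = x.
  have e_gt0 : (0 < e)%N by exact: ltnW.
  (* With [u * e = v * f + 1], applying the [e]-th Frobenius power [u] times is the same as applying
     the [f]-th one [v] times and then Frobenius once. *)
  have [u v uv _] := egcdnP f e_gt0.
  move: uv; rewrite (eqP ef) => uv.
  by rewrite -[RHS](iterX _ xe u) uv addn1 expnSr exprM (iterX _ xf).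
pose q : {poly K} := 'X^p - 'X.
have p_gt1 := prime_gt1 p_prime.
have sq : size q = p.+1.
  by rewrite size_polyDl size_polyXn // size_polyN size_polyX ltnS.
have q0 : q != 0 by rewrite -size_poly_eq0 sq.
(* All p^e elements of [K] would be roots of a polynomial of degree [p], against [1 < e]. *)
have : (size (enum K) < size q)%N.
  apply: max_poly_roots => //; last exact: enum_uniq.
  by apply/allP => x _; rewrite /root !hornerE xp subrr.
rewrite -cardT Kp sq ltnS leqNgt => /negP; apply.
by rewrite -{1}(expn1 p) ltn_exp2l.
Qed.

(** Commutators go to commutators, so [phi] maps corner elements to corner elements, through an
    additive map [w]. If [w c0] is nonzero for some [c0], the map sending b to w(c0 b) / w(c0) is a
    field embedding, which [no_field_morphism] excludes. *)
Lemma heis_morphism_commg (phi : heis K -> heis L) :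
  (forall x y, phi (x * y)%g = (phi x * phi y)%g) -> forall x y, phi [~ x, y]%g = 1%g.
Proof.
move=> phiM x y.
have phi1 : phi 1%g = 1%g by apply: (@mulgI _ (phi 1%g)); rewrite -phiM !mulg1.
have phiR u v : phi [~ u, v]%g = [~ phi u, phi v]%g.
  by apply: (@mulgI _ (phi (v * u)%g)); rewrite -phiM -commgC !phiM -commgC.
pose w c := (phi (0, 0, c)).2.
have phiZ c : phi (0, 0, c) = (0, 0, w c).
  by rewrite -[c]mulr1 /w -heis_commg_corner phiR heis_commg.
rewrite heis_commg; set c0 := (_ - _); have [w0|w0] := eqVneq (w c0) 0.
  by rewrite phiZ w0.
exfalso.
pose al a := phi (a, 0, 0); pose be b := phi (0, b, 0).
have wM a b : w (a * b) = (al a).1.1 * (be b).1.2 - (be b).1.1 * (al a).1.2.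
  by rewrite /w -heis_commg_corner phiR heis_commg.
have w00 : w 0 = 0 by rewrite /w (phi1 : phi (0, 0, 0) = 1%g).
have alC a a' : (al a).1.1 * (al a').1.2 = (al a').1.1 * (al a).1.2.
  have /(congr1 snd) := phiR (a, 0, 0) (a', 0, 0).
  rewrite !heis_commg /= !mulr0 subr0 -/(w 0) w00.
  by move=> /esym/eqP; rewrite subr_eq0 => /eqP.
(* By [wM], [w (a * b)] is the determinant of the vectors [al a] and [be b] in the plane over [L].
   The vectors [al a] are pairwise parallel by [alC], so the exchange rule for determinants loses
   one term. *)
have ww a a' b b' : w (a * b) * w (a' * b') = w (a * b') * w (a' * b).
  rewrite !wM; apply/eqP; rewrite -subr_eq0; apply/eqP.
  transitivity (((al a).1.1 * (al a').1.2 - (al a').1.1 * (al a).1.2) *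
    ((be b').1.2 * (be b).1.1 - (be b).1.2 * (be b').1.1)); first by ring.
  by rewrite alC subrr mul0r.
have wD c c' : w (c + c') = w c + w c'.
  rewrite {1}/w; have -> : (0, 0, c + c') = (((0, 0, c) : heis K) * ((0, 0, c') : heis K))%g.
    by rewrite heis_mulE /= !addr0 mul0r addr0.
  by rewrite phiM !phiZ heis_mulE /= mul0r addr0.
apply: (@no_field_morphism (fun b => w (c0 * b) / w c0)) => /=.
- by move=> b b'; rewrite mulrDr wD mulrDl.
(* This instance reads w(c0 b b') w(c0) = w(c0 b') w(c0 b), which is multiplicativity after division
   by w(c0)^2. *)
- move=> b b'; have := ww (c0 * b) c0 b' 1; rewrite !mulr1 => e0.
  by rewrite mulrA mulf_div -e0 -mulf_div divff // mulr1.
- by rewrite mulr1 mulfV // oner_neq0.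
Qed.

End heisenberg_morphism.

(** * Restricted products as permutation groups *)

Lemma top_isomorphic_sym (G K : topologicalGroupType) (A : set G) (B : set K) :
  (forall x y, A x -> A y -> A (x * y)%g) -> top_isomorphic A B -> top_isomorphic B A.
Proof.
move=> AM [f [g [[fB gA] [fK gK] fM fc gc]]]; exists g, f; split=> // x y Bx By.
rewrite -[in LHS](gK x) // -[in LHS](gK y) // -fM ?fK //; try exact: gA.
by apply: AM; exact: gA.
Qed.

Section restricted_product.
Local Open Scope group_scope.
Variables (Hg : nat -> groupType) (code : forall j, Hg j -> nat).
Hypothesis code_inj : forall j, injective (@code j).

Definition full_product := prod_group (fun j => discrete_group (Hg j)).
Implicit Types (g h d : full_product).

Lemma full_eq g h : (forall j, g j = h j) -> g = h.
Proof. exact: prod_group_eq. Qed.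

Definition finsupp d := exists N, forall j, (N <= j)%N -> d j = 1.

Lemma finsupp1 : finsupp 1. Proof. by exists 0%N. Qed.

Lemma finsuppM d d' : finsupp d -> finsupp d' -> finsupp (d * d').
Proof.
move=> [N NP] [N' NP']; exists (maxn N N') => j; rewrite geq_max => /andP[Nj N'j].
by rewrite -[LHS]/(d j * d' j) NP // NP' // mulg1.
Qed.

Lemma finsuppV d : finsupp d -> finsupp d^-1.
Proof.
by move=> [N NP]; exists N => j Nj; rewrite -[LHS]/((d j)^-1) NP // invg1.
Qed.

Lemma finsupp_code_ex : exists c : full_product -> nat,
  forall d d', finsupp d -> finsupp d' -> c d = c d' -> d = d'.
Proof.
have /choice [N NP] : forall d, exists N, finsupp d -> forall j, (N <= j)%N -> d j = 1.
  by move=> d; have [[N ?]|] := pselect (finsupp d); [exists N|exists 0%N].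
exists (fun d => pickle (mkseq (fun j => code (d j : Hg j)) (N d))) => d d' dF d'F.
move=> /(pcan_inj pickleK) dd'; have NN := congr1 size dd'; rewrite !size_mkseq in NN.
apply: full_eq => j; have [jN|Nj] := ltnP j (N d).
  have := congr1 (fun l => nth 0%N l j) dd'; rewrite !nth_mkseq -?NN //.
  exact: code_inj.
by rewrite NP // NP // -NN.
Qed.

Definition fcode : full_product -> nat := projT1 (cid finsupp_code_ex).

Lemma fcode_inj d d' : finsupp d -> finsupp d' -> fcode d = fcode d' -> d = d'.
Proof. by rewrite /fcode; case: cid => c; apply. Qed.

Lemma fdecode_ex c : exists d, finsupp d /\
  forall d', finsupp d' -> fcode d' = c -> d' = d.
Proof.
have [[d [dF dc]]|nd] := pselect (exists d, finsupp d /\ fcode d = c).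
  by exists d; split=> // d' d'F d'c; apply: fcode_inj => //; rewrite d'c.
by exists 1; split=> [|d' d'F d'c]; [exact: finsupp1|case: nd; exists d'].
Qed.

Definition fdecode c : full_product := projT1 (cid (fdecode_ex c)).

Lemma fdecode_finsupp c : finsupp (fdecode c).
Proof. by rewrite /fdecode; case: cid => d []. Qed.

Lemma fcodeK d : finsupp d -> fdecode (fcode d) = d.
Proof. by move=> dF; rewrite /fdecode; case: cid => d' /= [_ dP]; rewrite -(dP d). Qed.

(* The pairs (n, d) with d finitely supported are coded by natural numbers, and
   [g] acts on them by (n, d) |-> (n, res n g * d); the stabilizer of (n, 1)
   consists of the [g] that are trivial on [A n]. *)
Definition pt (n : nat) d : nat := pickle (n, fcode d).

Lemma pt_inj n n' d d' : finsupp d -> finsupp d' -> pt n d = pt n' d' ->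
  n = n' /\ d = d'.
Proof.
move=> dF d'F nd; have [nn cc] : (n, fcode d) = (n', fcode d') := pcan_inj pickleK nd.
by split=> //; exact: fcode_inj.
Qed.

(** There may be numbers that code no point, since [fcode] is only known to be injective on finitely
    supported elements; [move] fixes them. *)
Variant pt_spec i : Prop :=
  | PtSpec n d of finsupp d & i = pt n d
  | NotPtSpec of forall n d, finsupp d -> i <> pt n d.

Lemma ptP i : pt_spec i.
Proof.
have [[n [d [dF ->]]]|ni] := pselect (exists n d, finsupp d /\ i = pt n d).
  exact: PtSpec dF _.
by apply: NotPtSpec => n d dF id; apply: ni; exists n, d.
Qed.

(** A basic neighbourhood in [Sinf] prescribes values below some [N], so it concerns only stages up
    to some [M]. *)
Lemma pt_bound N : exists M, forall n d, finsupp d -> (pt n d < N)%N -> (n <= M)%N.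
Proof.
elim: N => [|N [M MP]]; first by exists 0%N.
case: (ptP N) => [n d dF Nnd|Nnd].
  exists (maxn M n) => n' d' d'F; rewrite ltnS leq_eqVlt => /orP[/eqP nd|/MP n'M].
    by have [-> _] := pt_inj d'F dF (etrans nd Nnd); exact: leq_maxr.
  by rewrite (leq_trans (n'M d'F)) // leq_maxl.
exists M => n' d' d'F; rewrite ltnS leq_eqVlt => /orP[/eqP nd|]; last exact: MP.
by case: (Nnd n' d' d'F).
Qed.

Section labelling.
Variable A : nat -> set nat.

Definition res n g : full_product := fun j => if `[< A n j >] then g j else 1.

Lemma res_in n g j : A n j -> res n g j = g j.
Proof. by move=> Anj; rewrite /res asboolT. Qed.

Lemma res_out n g j : ~ A n j -> res n g j = 1.
Proof. by move=> Anj; rewrite /res asboolF. Qed.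

Lemma resM n g h : res n (g * h) = res n g * res n h.
Proof.
apply: full_eq => j; rewrite -[RHS]/(res n g j * res n h j).
have [Aj|Aj] := pselect (A n j); first by rewrite !res_in.
by rewrite !res_out // mulg1.
Qed.

Lemma res1 n : res n 1 = 1.
Proof. by apply: full_eq => j; rewrite /res; case: ifP. Qed.

Lemma resV n g : res n g^-1 = (res n g)^-1.
Proof. by apply: (mulgI (res n g)); rewrite -resM !mulgV res1. Qed.

Lemma res_finsupp n d : finsupp d -> finsupp (res n d).
Proof. by move=> [N NP]; exists N => j /NP; rewrite /res => ->; case: ifP. Qed.

Definition restricted_product : set full_product :=
  [set g | forall n, finsupp (res n g)].

Local Notation PA := restricted_product.

Lemma restricted1 : PA 1. Proof. by move=> n; rewrite res1; exact: finsupp1. Qed.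

Lemma restrictedM g h : PA g -> PA h -> PA (g * h).
Proof. by move=> Pg Ph n; rewrite resM; exact: finsuppM. Qed.

Lemma restrictedV g : PA g -> PA g^-1.
Proof. by move=> Pg n; rewrite resV; exact: finsuppV. Qed.

Lemma finsupp_restricted d : finsupp d -> PA d.
Proof. by move=> dF n; exact: res_finsupp. Qed.

Lemma move_ex g : exists m : nat -> nat,
  (forall n d, finsupp d -> m (pt n d) = pt n (res n g * d)) /\
  forall i, (forall n d, finsupp d -> i <> pt n d) -> m i = i.
Proof.
have /choice [m mP] : forall i, exists j,
    (forall n d, finsupp d -> i = pt n d -> j = pt n (res n g * d)) /\
    ((forall n d, finsupp d -> i <> pt n d) -> j = i).
  move=> i; case: (ptP i) => [n d dF ->|ni].
    exists (pt n (res n g * d)); split=> [n' d' d'F|/(_ n d dF)//].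
    by move=> /(pt_inj dF d'F) [-> ->].
  by exists i; split=> // n d /ni nd /nd.
exists m; split=> [n d dF|i]; last by case: (mP i) => _; apply.
by case: (mP (pt n d)) => + _; apply.
Qed.

Definition move g : nat -> nat := projT1 (cid (move_ex g)).

Lemma move_pt g n d : finsupp d -> move g (pt n d) = pt n (res n g * d).
Proof. by rewrite /move; case: cid => m /= [+ _]; apply. Qed.

Lemma move_out g i : (forall n d, finsupp d -> i <> pt n d) -> move g i = i.
Proof. by rewrite /move; case: cid => m /= [_]; apply. Qed.

Lemma moveM g h i : PA h -> move (g * h) i = move g (move h i).
Proof.
move=> Ph; case: (ptP i) => [n d dF ->|ni]; last by rewrite !move_out // move_out.
rewrite !move_pt //; last by apply: finsuppM.
by rewrite resM mulgA.
Qed.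

Lemma move1 i : move 1 i = i.
Proof.
case: (ptP i) => [n d dF ->|/move_out //].
by rewrite move_pt // res1 mul1g.
Qed.

Lemma move_perm_ex g : exists s : Sinf, PA g -> Sinf_fun s =1 move g.
Proof.
have [Pg|] := pselect (PA g); last by exists 1.
have gK : cancel (move g) (move g^-1).
  by move=> i; rewrite -moveM // mulVg move1.
have gK' : cancel (move g^-1) (move g).
  by move=> i; rewrite -moveM ?mulgV ?move1 //; exact: restrictedV.
by exists (Sinf_mk (Bijective gK gK')).
Qed.

Definition perm_of g : Sinf := projT1 (cid (move_perm_ex g)).

Lemma perm_ofE g : PA g -> Sinf_fun (perm_of g) =1 move g.
Proof. by rewrite /perm_of; case: cid. Qed.

Lemma perm_ofM g h : PA g -> PA h -> perm_of (g * h) = perm_of g * perm_of h.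
Proof.
move=> Pg Ph; apply: Sinf_eq => i.
rewrite -[RHS]/(Sinf_fun (perm_of g) (Sinf_fun (perm_of h) i)).
rewrite !perm_ofE //; last exact: restrictedM.
exact: moveM.
Qed.

Lemma perm_of1 : perm_of 1 = 1.
Proof. by apply: Sinf_eq => i; rewrite perm_ofE ?move1 //; exact: restricted1. Qed.

Lemma perm_ofV g : PA g -> perm_of g^-1 = (perm_of g)^-1.
Proof.
move=> Pg; apply: (mulgI (perm_of g)).
by rewrite -perm_ofM ?mulgV ?perm_of1 //; exact: restrictedV.
Qed.

Lemma perm_ofX g n : PA g -> perm_of (g ^+ n) = perm_of g ^+ n.
Proof.
move=> Pg; suff : PA (g ^+ n) /\ perm_of (g ^+ n) = perm_of g ^+ n by case.
elim: n => [|n [Pn IH]]; first by split; [exact: restricted1|exact: perm_of1].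
by rewrite !expgS -IH; split; [exact: restrictedM|rewrite perm_ofM].
Qed.

Lemma restrictedR g h : PA g -> PA h -> PA [~ g, h].
Proof.
move=> Pg Ph; apply: restrictedM; first exact: restrictedV.
apply: restrictedM; first exact: restrictedV.
exact: restrictedM.
Qed.

Lemma perm_ofR g h : PA g -> PA h -> perm_of [~ g, h] = [~ perm_of g, perm_of h].
Proof.
move=> Pg Ph; have Pg' := restrictedV Pg; have Ph' := restrictedV Ph.
have Pgh := restrictedM Pg Ph; have Phgh := restrictedM Ph' Pgh.
by rewrite /commg /conjg !perm_ofM // !perm_ofV.
Qed.

Definition product_group : set Sinf := [set perm_of g | g in PA].

Lemma product_group_subgroup : is_subgroup product_group.
Proof.
split=> [|_ _ [g Pg <-] [h Ph <-]|_ [g Pg <-]].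
- by exists 1; [exact: restricted1|exact: perm_of1].
- by exists (g * h); [exact: restrictedM|exact: perm_ofM].
- by exists g^-1; [exact: restrictedV|exact: perm_ofV].
Qed.

Hypothesis A_mono : forall m n, (m <= n)%N -> A m `<=` A n.
Hypothesis A_cover : forall j, exists n, A n j.

Lemma res_res m n g : (m <= n)%N -> res m (res n g) = res m g.
Proof.
move=> mn; apply: full_eq => j; have [Aj|Aj] := pselect (A m j).
  by rewrite !res_in //; exact: A_mono Aj.
by rewrite !res_out.
Qed.

Lemma perm_of_pt1 g n : PA g -> Sinf_fun (perm_of g) (pt n 1) = pt n (res n g).
Proof. by move=> Pg; rewrite perm_ofE // move_pt ?mulg1 //; exact: finsupp1. Qed.

Lemma perm_of_inj g h : PA g -> PA h -> perm_of g = perm_of h -> g = h.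
Proof.
move=> Pg Ph gh; apply: full_eq => j; have [n Anj] := A_cover j.
have := congr1 (fun s => Sinf_fun s (pt n 1)) gh; rewrite /= !perm_of_pt1 //.
by move=> /(pt_inj (Pg n) (Ph n)) [_ e]; rewrite -(res_in g Anj) e res_in.
Qed.

(** The value of a limit [s] at [pt n 1] reveals the restriction [u n] of the sought element to
    stage [n]. These restrictions are coherent because approximating group elements can match [s] at
    two points at once. *)
Lemma product_group_closed : closed product_group.
Proof.
move=> s cs.
have agree (l : seq nat) : exists2 g, PA g &
    forall i, i \in l -> Sinf_fun (perm_of g) i = Sinf_fun s i.
  have : nbhs s (Sinf_base [seq (i, Sinf_fun s i) | i <- l]).
    apply: open_nbhs_nbhs; split; first exact: Sinf_base_open.
    by move=> i j /mapP[k _ [-> ->]].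
  move=> /cs [_ [[g Pg <-] gl]]; exists g => // i il; apply: gl.
  exact: (map_f (fun i => (i, Sinf_fun s i))).
have /choice [u uP] : forall n, exists u, finsupp u /\ Sinf_fun s (pt n 1) = pt n u.
  move=> n; have [g Pg gl] := agree [:: pt n 1]; exists (res n g); split=> //.
  by rewrite -gl ?inE // perm_of_pt1.
have resu m n : (m <= n)%N -> res m (u n) = u m.
  move=> mn; have [g Pg gl] := agree [:: pt m 1; pt n 1].
  have [uF un] := uP n; have [uF' um] := uP m.
  have := gl (pt m 1); rewrite !inE eqxx perm_of_pt1 // um => /(_ isT).
  move=> /(pt_inj (Pg m) uF') [_ <-].
  have := gl (pt n 1); rewrite !inE eqxx orbT perm_of_pt1 // un => /(_ isT).
  by move=> /(pt_inj (Pg n) uF) [_ <-]; rewrite res_res.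
have /choice [lev levP] := A_cover.
pose g : full_product := fun j => u (lev j) j.
have resg n : res n g = u n.
  apply: full_eq => j; rewrite -(resu n n (leqnn n)).
  have [Aj|Aj] := pselect (A n j); last by rewrite !res_out.
  rewrite !res_in // /g.
  have [ln|nl] := leqP (lev j) n.
    by rewrite -(resu _ _ ln) res_in.
  by rewrite -(resu _ _ (ltnW nl)) res_in.
have Pg : PA g by move=> n; rewrite resg; case: (uP n).
exists g => //; apply: Sinf_eq => i; rewrite perm_ofE //.
case: (ptP i) => [n d dF ->|ni].
  (* An [h] that matches [s] at [pt n 1] has restriction [u n], so it acts on [pt n d] as [g]
     does. *)
  rewrite move_pt // resg; have [h Ph hl] := agree [:: pt n 1; pt n d].
  rewrite -[RHS]hl ?inE ?eqxx ?orbT // perm_ofE // move_pt //.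
  have := hl (pt n 1); rewrite !inE eqxx perm_of_pt1 // (uP n).2 => /(_ isT).
  by move=> /(pt_inj (Ph n) (uP n).1) [_ ->].
have [h Ph hl] := agree [:: i].
by rewrite move_out // -hl ?inE // perm_ofE // move_out.
Qed.

Lemma perm_of_fix g n : PA g -> Sinf_fun (perm_of g) (pt n 1) = pt n 1 -> res n g = 1.
Proof.
move=> Pg; rewrite perm_of_pt1 // => /(pt_inj (Pg n) finsupp1); case=> _; exact.
Qed.

(** An element fixing [pt n 1] is trivial on [A n], hence fixes every point of stage [n], and each
    [h] maps stage [n] to itself. *)
Lemma product_group_conj_small : conj_small product_group.
Proof.
move=> i; case: (ptP i) => [n d dF ->|ni].
  exists (pt n 1).+1 => _ _ [g Pg <-] [h Ph <-] /(_ _ (ltnSn _)) /(perm_of_fix Pg) gn.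
  rewrite !perm_ofE // move_pt // move_pt; last exact: finsuppM.
  by rewrite gn mul1g.
exists 0%N => _ _ [g Pg <-] [h Ph <-] _.
by rewrite !perm_ofE // (move_out h ni) (move_out g ni).
Qed.

(** Restricting [g] to a late stage gives a finitely supported element that acts as [g] does on the
    numbers below [N]. The dense sequence [fdecode] does not depend on [A], which the measurability
    argument uses. *)
Lemma product_group_dense (U : set Sinf) : open U ->
  (product_group `&` U !=set0) <-> exists c, U (perm_of (fdecode c)).
Proof.
move=> Uo; split=> [[_ [[g Pg <-] Ug]]|[c Uc]]; last first.
  exists (perm_of (fdecode c)); split=> //; exists (fdecode c) => //.
  exact/finsupp_restricted/fdecode_finsupp.
have [N NU] := Sinf_nbhs_agree (open_nbhs_nbhs (conj Uo Ug)).
have [M MP] := pt_bound N; exists (fcode (res M g)); rewrite fcodeK //.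
apply: NU => i iN; have PM : PA (res M g) by exact: finsupp_restricted.
rewrite !perm_ofE //; case: (ptP i) iN => [n d dF -> nN|ni _]; last first.
  by rewrite !move_out.
by rewrite !move_pt // res_res //; exact: MP dF nN.
Qed.

End labelling.

Definition log_of (A : nat -> set nat) (s : Sinf) : full_product :=
  xget 1 [set g | restricted_product A g /\ perm_of A g = s].

Lemma log_ofP A s : product_group A s ->
  restricted_product A (log_of A s) /\ perm_of A (log_of A s) = s.
Proof.
move=> [g Pg gs]; rewrite /log_of.
by case: xgetP => [h -> //|/(_ g)] []; split.
Qed.

Lemma log_ofK (A : nat -> set nat) g : (forall j, exists n, A n j) ->
  restricted_product A g -> log_of A (perm_of A g) = g.
Proof.
move=> Ac Pg; have [|PL e] := @log_ofP A (perm_of A g); first by exists g.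
exact: perm_of_inj Ac _ _ PL Pg e.
Qed.

Section two_labellings.
Variables A B : nat -> set nat.
Hypothesis BA : forall n, exists m, B n `<=` A m.

Lemma sub_labelling_res n m g : B n `<=` A m -> res B n (res A m g) = res B n g.
Proof.
move=> BnA; apply: full_eq => j; have [Bj|Bj] := pselect (B n j).
  by rewrite !res_in //; exact: BnA.
by rewrite !res_out.
Qed.

Lemma sub_labelling_restricted g : restricted_product A g -> restricted_product B g.
Proof.
move=> Pg n; have [m BnA] := BA n; rewrite -(sub_labelling_res g BnA).
exact: res_finsupp.
Qed.

(** The action on stage [n] for [B] depends only on the restriction to a larger [A m], which is read
    off from the value at the single number [pt m 1]. *)
Lemma relabelling_continuous :
  {within product_group A, continuous (fun s => perm_of B (log_of A s))}.
Proof.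
apply: Sinf_within_continuous => s k /log_ofP [Ps sE].
case: (ptP k) => [n d dF ->|nk]; last first.
  apply: filterS filterT => t _ /log_ofP [Pt tE].
  have Ps' := sub_labelling_restricted Ps; have Pt' := sub_labelling_restricted Pt.
  by rewrite !perm_ofE // !move_out.
have [m BnA] := BA n; have := Sinf_near s (pt m 1).
apply: filterS => t ts /log_ofP [Pt tE].
have e : res A m (log_of A t) = res A m (log_of A s).
  move: ts; rewrite -{1}tE -{1}sE !perm_of_pt1 //.
  by move=> /(pt_inj (Pt m) (Ps m)) [].
have Ps' := sub_labelling_restricted Ps; have Pt' := sub_labelling_restricted Pt.
by rewrite !perm_ofE // !move_pt // -(sub_labelling_res (log_of A t) BnA) e sub_labelling_res.
Qed.

End two_labellings.

Lemma product_group_isomorphic (A B : nat -> set nat) :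
  (forall j, exists n, A n j) -> (forall j, exists n, B n j) ->
  (forall n, exists m, A n `<=` B m) -> (forall n, exists m, B n `<=` A m) ->
  top_isomorphic (product_group A) (product_group B).
Proof.
move=> Ac Bc AB BA.
have PAB g : restricted_product A g -> restricted_product B g.
  exact: sub_labelling_restricted.
have PBA g : restricted_product B g -> restricted_product A g.
  exact: sub_labelling_restricted.
exists (fun s => perm_of B (log_of A s)), (fun s => perm_of A (log_of B s)).
split; [split|split| | |].
- by move=> s /log_ofP [Ps _]; exists (log_of A s) => //; exact: PAB.
- by move=> s /log_ofP [Ps _]; exists (log_of B s) => //; exact: PBA.
- by move=> s /log_ofP [Ps sE]; rewrite log_ofK // ?sE //; exact: PAB.
- by move=> s /log_ofP [Ps sE]; rewrite log_ofK // ?sE //; exact: PBA.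
- move=> s t /log_ofP [Ps sE] /log_ofP [Pt tE].
  rewrite -{1}sE -{1}tE -perm_ofM // log_ofK //; last exact: restrictedM.
  by rewrite perm_ofM //; exact: PAB.
- exact: relabelling_continuous.
- exact: relabelling_continuous.
Qed.

Definition inj_at j (x : Hg j) : full_product :=
  dfwith (fun k => 1 : Hg k) j x.

Lemma inj_at_in j (x : Hg j) : inj_at x j = x.
Proof. exact: dfwith_in. Qed.

Lemma inj_at_out j (x : Hg j) i : j != i -> inj_at x i = 1.
Proof. exact: dfwith_out. Qed.

Lemma inj_atM j (x y : Hg j) : inj_at (x * y) = inj_at x * inj_at y.
Proof.
apply: full_eq => i; rewrite -[RHS]/(inj_at x i * inj_at y i).
have [e|ji] := eqVneq j i; last by rewrite !inj_at_out // mulg1.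
by case: i / e; rewrite !inj_at_in.
Qed.

Lemma inj_at_finsupp j (x : Hg j) : finsupp (inj_at x).
Proof. by exists j.+1 => i ji; rewrite inj_at_out // neq_ltn ji. Qed.

(* For j in A n outside B m the factor Hg j embeds, through the isomorphism, into
   the product of the other factors, where its commutators vanish. *)
Lemma isomorphic_sub_labelling (A B : nat -> set nat) :
  (forall i j, i <> j -> forall phi : Hg i -> Hg j,
     (forall x y, phi (x * y) = phi x * phi y) -> forall x y, phi [~ x, y] = 1) ->
  (forall j, exists x y : Hg j, [~ x, y] <> 1) ->
  (forall j, exists n, A n j) -> (forall j, exists n, B n j) ->
  (forall m n, (m <= n)%N -> B m `<=` B n) ->
  top_isomorphic (product_group B) (product_group A) ->
  forall n, exists m, A n `<=` B m.
Proof.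
move=> hom_triv nonab Ac Bc Bm [g [f [[gA fB] [gK fK] gM gc _]]] n.
have [B1 BM _] := product_group_subgroup B.
have g1 : g 1 = 1 by apply: (mulgI (g 1)); rewrite -gM // !mulg1.
have := within_continuous_Sinf (pt n 1) gc B1; rewrite g1 => /Sinf_nbhs_agree [N NP].
(* For [j] outside [B M], every [perm_of B (inj_at x)] fixes all numbers below [N]. Its image under
   [g] then fixes [pt n 1], so it is trivial on [A n] and in particular at [j]. *)
have [M MP] := pt_bound N; exists M => j Anj; apply: contrapT => nBj.
have Pinj x : restricted_product B (@inj_at j x).
  exact/finsupp_restricted/inj_at_finsupp.
have Binj x : product_group B (perm_of B (@inj_at j x)) by exists (inj_at x).
pose psi x := log_of A (g (perm_of B (@inj_at j x))).
have psiP x := log_ofP (gA _ (Binj x)).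
have psiM x y : psi (x * y) = psi x * psi y.
  rewrite /psi inj_atM perm_ofM // gM //.
  have [Px xE] := psiP x; have [Py yE] := psiP y.
  by rewrite -{1}xE -{1}yE -perm_ofM // log_ofK //; exact: restrictedM.
have psi_j x : psi x j = 1.
  have [Px xE] := psiP x.
  have : res A n (psi x) = 1.
    apply: (perm_of_fix Px); rewrite xE NP //.
    move=> i iN; rewrite perm_ofE //; case: (ptP i) iN => [n' d dF -> n'N|ni _]; last first.
      by rewrite move_out.
    rewrite move_pt //; suff -> : res B n' (inj_at x) = 1 by rewrite mul1g.
    apply: full_eq => k; have [e|jk] := eqVneq j k.
      case: k / e; rewrite res_out //; apply: contra_not nBj; apply: Bm.
      exact: MP dF n'N.
    by rewrite /res inj_at_out //; case: ifP.
  by move=> /(congr1 (fun h : full_product => h j)); rewrite res_in.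
have [x [y xy]] := nonab j; apply: xy.
have psi_c : psi [~ x, y] = 1.
  apply: full_eq => i; have [e|ji] := eqVneq j i; first by case: i / e; exact: psi_j.
  apply: (hom_triv j i (elimN eqP ji) (fun x => psi x i)) => u v.
  by rewrite psiM.
have [_] := psiP [~ x, y]; rewrite -/(psi _) psi_c perm_of1 => /esym gc1.
have : perm_of B (inj_at [~ x, y]) = perm_of B 1.
  by rewrite perm_of1 -(gK _ (Binj _)) gc1 -[in LHS]g1 gK.
move=> /(perm_of_inj Bc (Pinj _) (restricted1 B)).
by move=> /(congr1 (fun h : full_product => h j)); rewrite inj_at_in.
Qed.

Section product_group_class.
Variable p : nat.
Hypothesis p_gt0 : (0 < p)%N.
Hypothesis Hg_nil2 : forall j (x y z : Hg j), [~ [~ x, y], z] = 1.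
Hypothesis Hg_exponent : forall j (x : Hg j), x ^+ p = 1.
Hypothesis Hg_order : exists j (x : Hg j), forall m, (0 < m)%N -> x ^+ m = 1 -> (p <= m)%N.

Lemma full_expg g n j : (g ^+ n) j = (g j : Hg j) ^+ n.
Proof.
elim: n => // n IH; rewrite !expgS -IH; reflexivity.
Qed.

Section one_labelling.
Variable A : nat -> set nat.
Hypothesis A_mono : forall m n, (m <= n)%N -> A m `<=` A n.
Hypothesis A_cover : forall j, exists n, A n j.

Definition closed_product_group : closed_subgroup Sinf :=
  exist _ (product_group A)
    (conj (product_group_closed A_mono A_cover) (product_group_subgroup A)).

Lemma product_group_class : nil2_exp_class p closed_product_group.
Proof.
split.
- exact/procountableP/product_group_conj_small.
- apply/nilpotent_class_le2P; first exact: product_group_subgroup.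
  move=> _ _ _ [x Px <-] [y Py <-] [z Pz <-].
  rewrite -perm_ofR // -perm_ofR //; last exact: restrictedR.
  suff -> : [~ [~ x, y], z] = 1 by exact: perm_of1.
  by apply: full_eq => j; exact: (Hg_nil2 (x j) (y j) (z j)).
- split=> // [_ [x Px <-]|m m0 xm].
    rewrite -perm_ofX //; suff -> : x ^+ p = 1 by exact: perm_of1.
    by apply: full_eq => j; rewrite full_expg; exact: Hg_exponent.
  have [j [x xP]] := Hg_order; apply: xP => //.
  have Px : restricted_product A (inj_at x) by exact/finsupp_restricted/inj_at_finsupp.
  have /xm : product_group A (perm_of A (inj_at x)) by exists (inj_at x).
  rewrite -perm_ofX // -(perm_of1 A) => /(perm_of_inj A_cover) e.
  have Pxm : restricted_product A (inj_at x ^+ m).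
    by elim: (m) => [|k IH]; [exact: restricted1|rewrite expgS; exact: restrictedM].
  have := congr1 (fun h : full_product => h j) (e Pxm (restricted1 A)).
  by rewrite full_expg inj_at_in.
Qed.

End one_labelling.

Section measurability.
Variables (X : Type) (GX : set_system X) (A : X -> nat -> set nat).
Hypothesis A_mono : forall x m n, (m <= n)%N -> A x m `<=` A x n.
Hypothesis A_cover : forall x j, exists n, A x n j.
Hypothesis A_sigma : forall n j, <<s GX >> [set x | A x n j].

(** Restrictions of [d] are finitely supported, so they are among the countably many [fdecode c],
    and [Q] may be arbitrary. *)
Let res_sigma n d (Q : set full_product) : finsupp d ->
  <<s GX >> [set x | Q (res (A x) n d)].
Proof.
move=> dF; have -> : [set x | Q (res (A x) n d)] = [set x | exists c,
    Q (fdecode c) /\ forall j, (A x n j -> d j = fdecode c j) /\ (~ A x n j -> 1 = fdecode c j)].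
  apply/seteqP; split=> x.
    move=> Qx; exists (fcode (res (A x) n d)); rewrite fcodeK; last exact: res_finsupp.
    by split=> // j; split=> Aj; [rewrite res_in|rewrite res_out].
  move=> [c [Qc cP]]; suff e : res (A x) n d = fdecode c by rewrite /= e.
  apply: full_eq => j; have [c1 c2] := cP j.
  by have [Aj|Aj] := pselect (A x n j); [rewrite res_in // c1|rewrite res_out // c2].
apply: sigma_exists => c; apply: sigma_and; first exact: sigma_prop.
apply: sigma_forall => j; apply: sigma_and; apply: sigma_imp => //.
- exact: sigma_prop.
- exact: sigma_not (A_sigma n j).
- exact: sigma_prop.
Qed.

Let move_sigma d i k : finsupp d -> <<s GX >> [set x | move (A x) d i = k].
Proof.
move=> dF; case: (ptP i) => [n d' d'F ->|ni].
  have := res_sigma n (fun e => pt n (e * d') = k) dF; congr (<<s GX >> _).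
  by apply/seteqP; split=> x /=; rewrite move_pt.
rewrite (_ : [set x | _] = [set x | i = k]); first exact: sigma_prop.
by apply/seteqP; split=> x /=; rewrite move_out.
Qed.

(** Only the generators of the Effros structure matter. By [product_group_dense], meeting an open
    set is a countable disjunction over elements [fdecode c] common to all [x]; only their action on
    the numbers varies with [x]. *)
Lemma closed_product_group_measurable S : effros Sinf S ->
  <<s GX >> [set x | S (closed_product_group (@A_mono x) (@A_cover x))].
Proof.
apply: sigma_preimage => _ [U Uo <-].
rewrite (_ : _ @^-1` _ = [set x | exists c, exists l, (Sinf_base l `<=` U) /\
    forall ij : nat * nat, ij \in l -> move (A x) (fdecode c) ij.1 = ij.2]).
  apply: sigma_exists => c; apply: sigma_exists => l.
  apply: sigma_and; first exact: sigma_prop.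
  apply: sigma_forall => ij; apply: sigma_imp; first exact: sigma_prop.
  exact: move_sigma (fdecode_finsupp c).
have Pc x c : restricted_product (A x) (fdecode c).
  exact/finsupp_restricted/fdecode_finsupp.
apply/seteqP; split=> x /=.
  move=> /(product_group_dense (@A_mono x) Uo) [c Uc].
  have [l lc lU] := Sinf_base_nbhs (open_nbhs_nbhs (conj Uo Uc)).
  by exists c, l; split=> // -[i j] /lc <- /=; rewrite perm_ofE.
move=> [c [l [lU lc]]]; apply/(product_group_dense (@A_mono x) Uo).
exists c; apply: lU => i j /lc /= <-; rewrite perm_ofE //.
Qed.

End measurability.
End product_group_class.

End restricted_product.

(** Increasing primes provide what [no_field_morphism] asks for, in both directions: exponents above
    1 that are pairwise coprime. *)
Fixpoint expo (j : nat) : nat :=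
  if j is j'.+1 then s2val (prime_above (expo j')) else 2.

Lemma expo_prime j : prime (expo j).
Proof. by case: j => //= j; case: prime_above. Qed.

Lemma expo_ltn i j : (i < j)%N -> (expo i < expo j)%N.
Proof.
elim: j => // j IH; rewrite ltnS leq_eqVlt => ij.
have ej : (expo j < expo j.+1)%N by rewrite /=; case: prime_above.
by case/orP: ij => [/eqP -> //|/IH ij]; exact: ltn_trans ij ej.
Qed.

Lemma expo_coprime i j : i <> j -> coprime (expo i) (expo j).
Proof.
move=> ij; rewrite prime_coprime ?expo_prime // dvdn_prime2 ?expo_prime //.
apply/eqP => e; apply: ij; case: (ltngtP i j) => // /expo_ltn; by rewrite e ltnn.
Qed.

(** * The reduction of bounded distance to topological isomorphism *)

Section reduction.
Import Order.TTheory GRing.Theory Num.Theory.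
Local Open Scope ring_scope.
Variables (R : realType) (p : nat).
Hypotheses (p_prime : prime p) (p_odd : odd p).

Let F_ex j := finfield.pPrimePowerField p_prime (prime_gt0 (expo_prime j)).
Let F j : finFieldType := s2val (F_ex j).

Let F_pchar j : p \in [pchar F j].
Proof. exact: (s2valP (F_ex j)). Qed.

Let F_card j : #|F j| = (p ^ expo j)%N.
Proof. exact: (s2valP' (F_ex j)). Qed.

Let Hg j : groupType := heis (F j).
Let code j (x : Hg j) : nat := pickle (x : (F j * F j * F j)%type).

Let code_inj j : injective (@code j).
Proof. exact: (pcan_inj pickleK). Qed.

Let Hg_morphism i j : i <> j -> forall phi : Hg i -> Hg j,
  (forall x y, phi (x * y)%g = (phi x * phi y)%g) -> forall x y, phi [~ x, y]%g = 1%g.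
Proof.
move=> ij; apply: (heis_morphism_commg p_prime (F_card i) (F_card j)).
- exact: prime_gt1 (expo_prime i).
- exact: expo_coprime.
Qed.

Let Hg_nonabelian j : exists x y : Hg j, [~ x, y]%g <> 1%g.
Proof.
exists (1, 0, 0), (0, 1, 0); rewrite heis_commg_corner mulr1 => -[] /eqP.
by rewrite oner_eq0.
Qed.

Let Hg_order : exists j (x : Hg j), forall m, (0 < m)%N -> (x ^+ m)%g = 1%g -> (p <= m)%N.
Proof.
exists 0%N, (1, 0, 0) => m m0; rewrite heis_expg => -[/eqP].
by rewrite -(dvdn_pcharf (F_pchar 0)) => /dvdn_leq; auto.
Qed.

(* Labels are coded pairs (k, i); the other labels belong to every stage. *)
Let stage (x : {ptws nat -> R}) (n : nat) : set nat := [set j |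
  if @unpickle (nat * int)%type j is Some (k, i) then i%:~R <= x k + n%:R else true].

Let stage_mono x m n : (m <= n)%N -> stage x m `<=` stage x n.
Proof.
move=> mn j; rewrite /stage /=; case: unpickle => // -[k i] /le_trans; apply.
by rewrite lerD2l ler_nat.
Qed.

Let stage_cover x j : exists n, stage x n j.
Proof.
rewrite /stage /=; case: unpickle => [[k i]|]; last by exists 0%N.
exists (Num.bound `|i%:~R - x k|); rewrite -lerBlDl.
exact: le_trans (ler_norm _) (ltW (archi_boundP (normr_ge0 _))).
Qed.

Let stage_borel n j : borel {ptws nat -> R} [set x | stage x n j].
Proof.
rewrite /stage /=; case: unpickle => [[k i]|]; last exact: sigma_prop.
have c : continuous (fun x : {ptws nat -> R} => x k).
  exact: (@proj_continuous nat (fun=> R) k).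
have -> : [set x : {ptws nat -> R} | i%:~R <= x k + n%:R] =
    ~` ((fun x : {ptws nat -> R} => x k) @^-1` [set y | y < i%:~R - n%:R]).
  apply/seteqP; split=> x /=; first by rewrite -lerBlDr leNgt => /negP.
  by rewrite -lerBlDr leNgt => /negP.
apply: sigma_setC; apply: sub_sigma_algebra.
by apply: open_comp => [x _|]; [exact: c|exact: open_lt].
Qed.

Let ell_infty_stage x y : ell_infty x y <->
  (forall n, exists m, stage x n `<=` stage y m) /\
  (forall n, exists m, stage y n `<=` stage x m).
Proof.
have half u v M : (forall n, `|u n - v n| < M) ->
    forall n, exists m, stage u n `<=` stage v m.
  move=> uvM n; pose m := Num.bound `|M|; exists (n + m)%N => j.
  have Mm : M < m%:R by apply: le_lt_trans (ler_norm M) (archi_boundP (normr_ge0 M)).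
  rewrite /stage /=; case: unpickle => // -[k i] uk; have := uvM k.
  have := ler_norm (u k - v k); rewrite natrD; lra.
split=> [[M MP]|[xy yx]].
  split; apply: (half _ _ M) => // n; by rewrite distrC.
have bound u v : (forall n, exists m, stage u n `<=` stage v m) ->
    exists m : nat, forall k, u k - v k < m%:R + 1.
  move=> /(_ 0%N) [m mP]; exists m => k.
  (* The label [(k, Num.floor (u k))] is in stage 0 of [u], and its membership in stage [m] of [v]
     bounds [u k - v k] up to the rounding error 1. *)
  have := mP (pickle (k, Num.floor (u k))); rewrite /stage /= pickleK addr0 => h.
  have := h (ge_floor (u k)); have := lt_succ_floor (u k).
  by rewrite intrD; lra.
have [m1 m1P] := bound _ _ xy; have [m2 m2P] := bound _ _ yx.
exists (m1%:R + m2%:R + 1) => k; rewrite ltr_norml.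
have := m1P k; have := m2P k; have := ler0n R m1; have := ler0n R m2; lra.
Qed.

Let group_of (x : {ptws nat -> R}) : closed_subgroup Sinf :=
  closed_product_group code_inj (@stage_mono x) (@stage_cover x).

Let group_of_class x : nil2_exp_class p (group_of x).
Proof.
apply: product_group_class => //.
- exact: prime_gt0.
- by move=> j; exact: heis_nil2.
- by move=> j x'; exact: heis_exponent (F_pchar j).
Qed.

Theorem ell_infty_reducible_nil2 : borel_reducible (borel {ptws nat -> R})
  (@nil2_exp_borel p) (@ell_infty R) (@nil2_exp_iso p).
Proof.
pose f x : nil2_exp_class p := exist _ (group_of x) (mem_set (group_of_class x)).
exists f; split=> [_ [S SE <-]|x y].
  rewrite setTI.
  exact: (closed_product_group_measurable code_inj stage_mono stage_cover
    stage_borel SE).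
apply: iff_trans (ell_infty_stage x y) _; split=> [[xy yx]|xy].
  exact: product_group_isomorphic.
have yx : top_isomorphic (sval (group_of y)) (sval (group_of x)).
  have [_ xM _] := product_group_subgroup code_inj (stage x).
  exact: top_isomorphic_sym xM xy.
split.
- exact: (isomorphic_sub_labelling Hg_morphism Hg_nonabelian (stage_cover x)
    (stage_cover y) (@stage_mono y) yx).
- exact: (isomorphic_sub_labelling Hg_morphism Hg_nonabelian (stage_cover y)
    (stage_cover x) (@stage_mono x) xy).
Qed.

End reduction.

Theorem theorem1p2 (R : realType) (p : nat) (p_prime : prime p) (p_odd : odd p) :
  [/\ effros Sinf (nil2_exp_class p),
      borel_reducible (borel {ptws nat -> R}) (@nil2_exp_borel p)
        (@ell_infty R) (@nil2_exp_iso p),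
      forall (G : topologicalGroupType) (X : Type) (SX : set_system X)
             (a : G -> X -> X),
        polish_space R G -> standard_borel R SX -> is_action a ->
        borel_map (prod_algebra (borel G) SX) SX (fun gx => a gx.1 gx.2) ->
        ~ borel_reducible (@nil2_exp_borel p) SX
            (@nil2_exp_iso p) (orbit_relation a)
    & ~ borel_reducible (@nil2_exp_borel p) (borel graphs)
          (@nil2_exp_iso p) GI].
Proof.
have red := ell_infty_reducible_nil2 R p_prime p_odd.
split=> [||G X SX a GP XB aA aB /(borel_reducible_trans red)|].
- exact: nil2_exp_class_effros.
- exact: red.
- exact: ell_infty_not_reducible_to_polish_orbit.
- by move=> /(borel_reducible_trans red); exact: ell_infty_not_reducible_to_GI.
Qed.
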